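(* Let $N\ge 1$, $\mathcal N=\{1,\dots,N\}$, $T>0$, $Q_T=(0,T)\times\mathbb R$, and assume the standing hypotheses on $f^k,\nu^k,\mu^{j,k},\Gamma^{j,k}$ ($j,k\in\mathcal N$) listed in the context. Let $\boldsymbol U=(U^k)_{k\in\mathcal N}$ and $\boldsymbol V=(V^k)_{k\in\mathcal N}$ be entropy solutions (in the sense given in the context) of the system $$\partial_t U^{k}+\partial_x\big(f^k(U^k)\,\nu^k((\boldsymbol\Theta\circledast\boldsymbol U)^k)\big)=0\ \text{ in } Q_T,\qquad k\in\mathcal N,$$ with initial data $\boldsymbol U_0$ and $\boldsymbol V_0$ respectively, where $U_0^k,V_0^k\in (L^1\cap \mathrm{BV})(\mathbb R;[0,1])$ for all $k\in\mathcal N$. Then $$\|\boldsymbol U(T,\cdot)-\boldsymbol V(T,\cdot)\|_{(L^1(\mathbb R))^N}\le \|\boldsymbol U_0-\boldsymbol V_0\|_{(L^1(\mathbb R))^N}+\mathcal C\sum_{k\in\mathcal N}\int_0^T\|U^k(\tau,\cdot)-V^k(\tau,\cdot)\|_{L^1(\mathbb R)}\,d\tau,$$ where $$\begin{aligned}\mathcal C={}&NT\,|\boldsymbol f|_{(\mathrm{Lip}(\mathbb R))^N}\,|\boldsymbol\nu|_{(\mathrm{Lip}(\mathbb R^N))^N}\,\|\boldsymbol\Theta\|_{(L^\infty(\overline Q_T))^{N^2}}\,|\boldsymbol U|_{(L^\infty_t\mathrm{BV}_x)^N}\\&+NT\,|\boldsymbol f|_{(\mathrm{Lip}(\mathbb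 R))^N}\,\|\boldsymbol U_0\|_{(L^1(\mathbb R))^N}\,\|\nabla\boldsymbol\nu\|_{(L^\infty(\mathbb R^N))^{N^2}}\,\|\boldsymbol\Gamma\|_{(L^\infty(\mathbb R^+))^{N^2}}\,\|\boldsymbol\mu'\|_{(L^\infty(\mathbb R))^{N^2}}\\&+NT\,|\boldsymbol f|_{(\mathrm{Lip}(\mathbb R))^N}\,\|\boldsymbol U_0\|_{(L^1(\mathbb R))^N}\,\|\boldsymbol V\|_{(L^1(Q_T))^N}\,\|\boldsymbol\Gamma\|_{(L^\infty(\mathbb R^+))^{N^2}}\,\|\boldsymbol\mu'\|_{(L^\infty(\mathbb R))^{N^2}}\,\|\mathrm{Hess}\,\boldsymbol\nu\|_{(L^\infty(\mathbb R^N))^{N^3}}\,\|\boldsymbol\Theta\|_{(L^\infty(\overline Q_T))^{N^2}}.\end{aligned}$$ In particular, if $\boldsymbol U_0=\boldsymbol V_0$, then $\boldsymbol U=\boldsymbol V$ a.e. in $\overline Q_T$.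
   Context: **Standing hypotheses** (for all $j,k\in\mathcal N$): (H1) $f^k:\mathbb R\to\mathbb R$ is Lipschitz with $f^k(0)=f^k(1)=0$. (H2) $\nu^k\in (C^2\cap \mathrm{BV}\cap W^{2,\infty})(\mathbb R^N;\mathbb R)$. (H3) $\Theta^{j,k}(t,x)=\mu^{j,k}(x)\Gamma^{j,k}(t)$ with $\mu^{j,k}\in C^2(\mathbb R)\cap W^{2,\infty}(\mathbb R)$ and $\Gamma^{j,k}\in C^2([0,\infty);\mathbb R^+)\cap W^{2,\infty}([0,\infty);\mathbb R^+)$ (nonnegative values). **Nonlocal operator.** $(\boldsymbol\Theta\circledast\boldsymbol U)^k=(\Theta^{j,k}*U^j)_{j\in\mathcal N}$, an $\mathbb R^N$-valued function, with $$(\Theta^{j,k}*U^j)(t,x)=\int_0^t\int_{\mathbb R}U^j(\tau,\xi)\,\mu^{j,k}(x-\xi)\,\Gamma^{j,k}(t-\tau)\,d\xi\,d\tau .$$ **Entropy solution.** $\boldsymbol U\in (C([0,T];L^1(\mathbb R;[0,1]))\cap L^\infty([0,T];\mathrm{BV}(\mathbb R)))^N$ is an entropy solution with initial data $\boldsymbol U_0$ if for each $k\in\mathcal N$, $\alpha\in\mathbb R$ and each nonnegative $\phi\in C_c^\infty([0,T)\times\mathbb R)$, $$\begin{aligned}&\int_{Q_T}|U^k-\alpha|\,\phi_t\,dx\,dt+\int_{\mathbb R}|U_0^k(x)-\alpha|\,\phi(0,x)\,dx\\&+\int_{Q_T}\mathrm{sgn}(U^k-\alpha)\,\nu^k((\boldsymbol\Theta\circledast\boldsymbol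 U)^k)\,(f^k(U^k)-f^k(\alpha))\,\phi_x\,dx\,dt\\&-\int_{Q_T}f^k(\alpha)\,\mathrm{sgn}(U^k-\alpha)\,\partial_x\big[\nu^k((\boldsymbol\Theta\circledast\boldsymbol U)^k)\big]\,\phi\,dx\,dt\ \ge 0,\end{aligned}$$ all functions being evaluated at $(t,x)$ and $\partial_x$ denoting the total derivative in $x$ of the composite function. **Norms.** $\mathbb R^N$ carries the $1$-norm. $\|\boldsymbol Z\|_{(L^1)^N}=\sum_k\|Z^k\|_{L^1}$. $|\boldsymbol U|_{(L^\infty_t\mathrm{BV}_x)^N}=\max_k\sup_{t\in[0,T]}TV(U^k(t,\cdot))$. $|\boldsymbol f|_{(\mathrm{Lip}(\mathbb R))^N}$ and $|\boldsymbol\nu|_{(\mathrm{Lip}(\mathbb R^N))^N}$ are the maxima over $k$ of the Lipschitz constants of $f^k$, $\nu^k$. For the families $\boldsymbol\Theta=(\Theta^{j,k})$, $\boldsymbol\Gamma=(\Gamma^{j,k})$, $\boldsymbol\mu'=((\mu^{j,k})')$, $\nabla\boldsymbol\nu=(\partial_j\nu^k)$, $\mathrm{Hess}\,\boldsymbol\nu=(\partial_i\partial_j\nu^k)$, the $L^\infty$ norm is the maximum over all components of the $L^\infty$ norms. *)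

(* Defs.v *)
From HB Require Import structures.
From mathcomp Require Import all_boot all_order all_algebra.
From mathcomp Require Import all_classical all_reals all_analysis.

Set Implicit Arguments.
Unset Strict Implicit.
Unset Printing Implicit Defensive.

Import Order.TTheory GRing.Theory Num.Theory.
Import numFieldNormedType.Exports.

Local Open Scope ring_scope.
Local Open Scope classical_set_scope.

Section lebesgue_tuple.
Context {R : realType}.
Local Notation TR := (measurableTypeR R).

Definition cons_tuple n (p : TR * n.-tuple TR) : n.+1.-tuple TR :=
  [tuple of p.1 :: p.2].

Lemma measurable_cons_tuple n :
  measurable_fun [set: TR * n.-tuple TR] (@cons_tuple n).
Proof. exact: measurable_cons. Qed.

Section step.
Variables (n : nat) (m : {sigma_finite_measure set (n.-tuple TR) -> \bar R}).

Definition cons_measure : set (n.+1.-tuple TR) -> \bar R :=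
  pushforward (@lebesgue_measure R \x m)%E (@cons_tuple n).

Let cons_measure0 : cons_measure set0 = 0%E.
Proof. by rewrite /cons_measure /pushforward preimage_set0 measure0. Qed.
Let cons_measure_ge0 A : (0 <= cons_measure A)%E.
Proof. by rewrite /cons_measure /pushforward; exact: measure_ge0. Qed.
Let cons_measure_sigma_additive : semi_sigma_additive cons_measure.
Proof.
have mcons := @measurable_cons_tuple n.
move=> F mF tF mUF; rewrite /cons_measure /pushforward preimage_bigcup.
apply: measure_semi_sigma_additive.
- by move=> i; rewrite -[X in measurable X]setTI; exact: mcons.
- apply/trivIsetP => /= i j _ _ ij; rewrite -preimage_setI.
  by move/trivIsetP : tF => /(_ _ _ _ _ ij) ->//; rewrite preimage_set0.
- by rewrite -preimage_bigcup -[X in measurable X]setTI; exact: mcons.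
Qed.

HB.instance Definition _ := isMeasure.Build _ _ _ cons_measure
  cons_measure0 cons_measure_ge0 cons_measure_sigma_additive.

Lemma cons_measure_sigma_finite : sigma_finite setT cons_measure.
Proof.
have /sigma_finiteP[F [TF ndF Foo]] := sigma_finiteT (@lebesgue_measure R).
have /sigma_finiteP[G [TG ndG Goo]] := sigma_finiteT m.
pose uncons (t : n.+1.-tuple TR) : TR * n.-tuple TR :=
  (thead t, [tuple of behead t]).
have muncons : measurable_fun setT uncons.
  apply/measurable_fun_pair => /=; first exact: measurable_tnth.
  exact: measurable_behead.
have consK x : uncons (cons_tuple x) = x.
  by case: x => x t; congr pair; exact/val_inj.
exists (fun i => uncons @^-1` (F i `*` G i)).
  rewrite predeqE => t; split=> // _.
  have [i _ Fi] : (\bigcup_i F i) (uncons t).1 by rewrite -TF.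
  have [j _ Gj] : (\bigcup_i G i) (uncons t).2 by rewrite -TG.
  exists (maxn i j) => //; split.
  - by move: Fi; exact/subsetPset/ndF/leq_maxl.
  - by move: Gj; exact/subsetPset/ndG/leq_maxr.
move=> i; have [mF Fi] := Foo i; have [mG Gi] := Goo i; split.
  by rewrite -[X in measurable X]setTI; apply: muncons => //; exact: measurableX.
rewrite /cons_measure /pushforward (_ : _ @^-1` _ = F i `*` G i).
  by rewrite product_measure1E// lte_mul_pinfty// ge0_fin_numE.
by rewrite -[RHS]preimage_id; apply/seteqP; split=> x;
  rewrite /preimage /mkset consK.
Qed.

HB.instance Definition _ := Measure_isSigmaFinite.Build _ _ _ cons_measure
  cons_measure_sigma_finite.

End step.

(* Lebesgue measure on R^n, as the n-fold product measure on n-tuples. *)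
Fixpoint leb_tuple n : {sigma_finite_measure set (n.-tuple TR) -> \bar R} :=
  if n is n'.+1 then cons_measure (leb_tuple n') else \d_ [tuple].

(* The tuple type carries the measure, the row vectors carry the
   normed-space structure. *)
Definition rowv n (t : n.-tuple TR) : 'rV[R]_n := \row_i tnth t i.

End lebesgue_tuple.

Section function_spaces.
Context {R : realType}.
Local Notation TR := (measurableTypeR R).
Local Notation leb := (@lebesgue_measure R).
Local Notation leb2 := (leb \x leb)%E.

(* C^n on a finite-dimensional space; in finite dimension, existence and
   continuity of all directional derivatives amounts to C^1. *)
Fixpoint Cn (V : normedModType R) (n : nat) (f : V -> R) : Prop :=
  if n is n'.+1 then
    [/\ continuous f, forall v x, derivable f x v
      & forall v, Cn n' (fun x => 'D_v f x)]
  else continuous f.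

Definition compact_support (V : normedModType R) (f : V -> R) :=
  compact (closure [set x | f x != 0]).

(* Least Lipschitz constant of f with respect to the norm nm on the domain. *)
Definition lip (V : zmodType) (nm : V -> R) (f : V -> R) : \bar R :=
  ereal_inf [set L%:E | L in [set L : R |
    0 <= L /\ forall x y, `|f x - f y| <= L * nm (x - y)]].

Definition norm1 n (x : 'rV[R]_n) : R := \sum_(j < n) `|x ord0 j|.

Definition L1norm (u : R -> R) : \bar R := 'N[leb]_1[EFin \o u].

(* L^oo norm over a subset of the line. *)
Definition Linf (D : set R) (u : R -> R) : \bar R :=
  'N[leb]_+oo[EFin \o (u \_ D)].

Definition Linf2 (D : set (R * R)) (u : R * R -> R) : \bar R :=
  'N[leb2]_+oo[EFin \o (u \_ D)].

Definition Linfn n (u : 'rV[R]_n -> R) : \bar R :=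
  'N[leb_tuple n]_+oo[EFin \o u \o @rowv R n].

(* Total variation of (the Lebesgue class of) u, as the total mass of its
   distributional derivative. *)
Definition TV (u : R -> R) : \bar R :=
  ereal_sup [set (\int[leb]_x (u x * derive1 phi x))%:E | phi in
    [set phi : R -> R | [/\ Cn 1 phi, compact_support phi
                          & forall x, `|phi x| <= 1]]].

Definition partial n (j : 'I_n) (u : 'rV[R]_n -> R) (x : 'rV[R]_n) : R :=
  'D_(delta_mx ord0 j) u x.

(* BV(R^n) is finiteness of this variation; it does not include L^1(R^n). *)
Definition TVn n (u : 'rV[R]_n -> R) : \bar R :=
  ereal_sup [set (\int[leb_tuple n]_t
      (u (rowv t) * \sum_(j < n) partial j (phi j) (rowv t)))%:E | phi in
    [set phi : 'I_n -> 'rV[R]_n -> R |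
      [/\ forall j, Cn 1 (phi j), forall j, compact_support (phi j)
        & forall x, \sum_(j < n) phi j x ^+ 2 <= 1]]].

(* W^{2,oo} for functions of class C^2, whose weak derivatives are the
   classical ones. *)
Definition W2inf (u : R -> R) : Prop :=
  forall i, (i <= 2)%N -> (Linf setT u^`(i) < +oo)%E.

Definition W2infn n (u : 'rV[R]_n -> R) : Prop :=
  [/\ (Linfn u < +oo)%E, forall i, (Linfn (partial i u) < +oo)%E
    & forall i j, (Linfn (partial i (partial j u)) < +oo)%E].

(* C^2([0,oo)): the derivatives up to order 2 on ]0,oo[ extend continuously
   to 0.  The values on ]-oo,0[ of the total function are irrelevant. *)
Definition C2_halfline (g : R -> R) : Prop :=
  exists g1 g2 : R -> R,
    [/\ {within `[0%R, +oo[, continuous g},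
        {within `[0%R, +oo[, continuous g1},
        {within `[0%R, +oo[, continuous g2},
        forall t : R, 0 < t -> is_derive t 1 g (g1 t)
      & forall t : R, 0 < t -> is_derive t 1 g1 (g2 t)].

Definition W2inf_halfline (g : R -> R) : Prop :=
  forall i, (i <= 2)%N -> (Linf `]0%R, +oo[ g^`(i) < +oo)%E.

(* u represents an element of (L^1 \cap BV)(R;[0,1]). *)
Definition L1BV01 (u : R -> R) : Prop :=
  [/\ leb.-integrable setT (EFin \o u), (TV u < +oo)%E
    & {ae leb, forall x, 0 <= u x <= 1}].

(* u represents an element of C([0,T];L^1(R;[0,1])) \cap L^oo([0,T];BV(R));
   such an element always has a jointly measurable representative. *)
Definition solution_space (T : R) (u : R -> R -> R) : Prop :=
  [/\ measurable_fun (`[0%R, T] `*` setT : set (TR * TR)) (fun z => u z.1 z.2),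
      forall t, 0 <= t <= T -> leb.-integrable setT (EFin \o u t),
      forall t, 0 <= t <= T -> {ae leb, forall x, 0 <= u t x <= 1},
      forall t, 0 <= t <= T ->
        L1norm (u s \- u t) @[s --> within `[0%R, T] (nbhs t)] --> 0%E
    & (ereal_sup [set TV (u t) | t in `[0%R, T]] < +oo)%E].

(* Restrictions to [0,T) x R of these functions form C_c^oo([0,T) x R;R^+). *)
Definition test_function (T : R) (phi : R * R -> R) : Prop :=
  [/\ forall n, Cn n phi, compact_support phi,
      closure [set z | phi z != 0] `<=` [set z | z.1 < T]
    & forall z, 0 <= z.1 < T -> 0 <= phi z].

End function_spaces.

Section system.
Context {R : realType} (N : nat).
Local Notation TR := (measurableTypeR R).
Local Notation leb := (@lebesgue_measure R).
Local Notation leb2 := (leb \x leb)%E.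

Implicit Types (f : 'I_N -> R -> R) (nu : 'I_N -> 'rV[R]_N -> R).
Implicit Types (mu Gam : 'I_N -> 'I_N -> R -> R) (U V : 'I_N -> R -> R -> R).
Implicit Types (Z Uo : 'I_N -> R -> R) (T : R).

Definition hyp_f f : Prop :=
  forall k, [/\ lipschitz (f k), f k 0 = 0 & f k 1 = 0].

Definition hyp_nu nu : Prop :=
  forall k, [/\ Cn 2 (nu k), (TVn (nu k) < +oo)%E & W2infn (nu k)].

Definition hyp_mu mu : Prop :=
  forall j k, Cn 2 (mu j k) /\ W2inf (mu j k).

Definition hyp_Gam Gam : Prop :=
  forall j k, [/\ C2_halfline (Gam j k), W2inf_halfline (Gam j k)
                & forall t, 0 <= t -> 0 <= Gam j k t].

Definition Theta mu Gam j k (z : R * R) : R := mu j k z.2 * Gam j k z.1.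

Definition nonlocal mu Gam U (k : 'I_N) (t x : R) : 'rV[R]_N :=
  \row_j \int[leb]_(tau in `[0, t]) \int[leb]_xi
    (U j tau xi * mu j k (x - xi) * Gam j k (t - tau)).

Definition entropy_solution f nu mu Gam T U Uo : Prop :=
  (forall k, solution_space T (U k)) /\
  forall k (alpha : R) phi, test_function T phi ->
    let QT : set (TR * TR) := `]0%R, T[ `*` setT in
    let A t x := nu k (nonlocal mu Gam U k t x) in
    0 <= \int[leb2]_(z in QT)
           (`|U k z.1 z.2 - alpha| * 'D_((1, 0) : R * R) phi z)
       + \int[leb]_x (`|Uo k x - alpha| * phi (0, x))
       + \int[leb2]_(z in QT)
           (Num.sg (U k z.1 z.2 - alpha) * A z.1 z.2
            * (f k (U k z.1 z.2) - f k alpha) * 'D_((0, 1) : R * R) phi z)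
       - \int[leb2]_(z in QT)
           (f k alpha * Num.sg (U k z.1 z.2 - alpha) * derive1 (A z.1) z.2
            * phi z).

Definition lip_f f : \bar R := \big[maxe/0%E]_k lip Num.norm (f k).

Definition lip_nu nu : \bar R := \big[maxe/0%E]_k lip (@norm1 R N) (nu k).

Definition Linf_Theta mu Gam T : \bar R :=
  \big[maxe/0%E]_j \big[maxe/0%E]_k
    Linf2 (`[0%R, T] `*` setT) (Theta mu Gam j k).

Definition Linf_Gam Gam : \bar R :=
  \big[maxe/0%E]_j \big[maxe/0%E]_k Linf `[0%R, +oo[ (Gam j k).

Definition Linf_dmu mu : \bar R :=
  \big[maxe/0%E]_j \big[maxe/0%E]_k Linf setT (mu j k)^`().

Definition Linf_grad nu : \bar R :=
  \big[maxe/0%E]_j \big[maxe/0%E]_k Linfn (partial j (nu k)).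

Definition Linf_Hess nu : \bar R :=
  \big[maxe/0%E]_i \big[maxe/0%E]_j \big[maxe/0%E]_k
    Linfn (partial i (partial j (nu k))).

Definition L1normN Z : \bar R := \sum_k L1norm (Z k).

(* The (L^1(Q_T))^N norm. *)
Definition L1normQN T U : \bar R :=
  \sum_k 'N[leb2]_1[EFin \o ((fun z => U k z.1 z.2) \_ (`]0%R, T[ `*` setT))].

Definition BVnorm T U : \bar R :=
  \big[maxe/0%E]_k ereal_sup [set TV (U k t) | t in `[0%R, T]].

End system.

(* Main.v *)
(* The proof is Kruzkov's doubling of variables in Kuznetsov's quantitative
   form, applied to each component with its nonlocal coefficient frozen:
   A = nu^k(Theta * U) and B = nu^k(Theta * V).  Testing the two entropy
   inequalities against the product of mollifiers centred at a time a and on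
   the diagonal x = y bounds the growth rate in a of the smoothed distance
   between U^k and V^k by L (sup |A - B|) TV(U^k) + L (sup |A' - B'|) |U^k|_1:
   the x-derivative of the product of A - B with the mollifier is a limit of
   difference quotients, and translation invariance of the integral moves the
   difference onto U^k, where it is controlled by the total variation.
   Removing the mollification gives the estimate between the times 0 and b;
   the entropy inequality near t = 0 shows that U^k(0) is the initial datum
   and that the mass of U^k(t) never exceeds the initial one.  The convolution
   bounds sup |A - B| and sup |A' - B'| by the distance of U and V in
   L^1((0,b) x R).  Since this holds for every b <= T, uniqueness follows by
   Gronwall's argument. *)
Require Import Defs.
From HB Require Import structures.
From mathcomp Require Import all_boot all_order all_algebra.
From mathcomp Require Import all_classical all_reals all_analysis.
From mathcomp Require Import measurable_realfun ring lra.
Import Order.TTheory GRing.Theory Num.Theory.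
Import numFieldNormedType.Exports.
Local Open Scope ring_scope.
Local Open Scope classical_set_scope.

Set Implicit Arguments.
Unset Strict Implicit.
Unset Printing Implicit Defensive.

(** * Real-valued integrals on product spaces *)

(** The coefficient contains all components, so each component is first treated as a scalar equation
    with a given coefficient, and only sup bounds on A - B and A' - B' couple the components.
    Because u and v are merely of bounded variation and Kruzkov's flux is merely Lipschitz in u, the
    flux term cannot be integrated by parts in x; difference quotients replace this. Both time
    mollifiers are centred at the same a, instead of using a kernel in t - s: for one point fixed
    the doubled kernel is then a product of a function of time and one of space, and the sum of the
    two time derivatives is minus the derivative in a. Only u gets translated, so only its variation
    enters C; the variation of v serves to remove the mollification. The first term of C comes from
    A - B. The other two come from A' - B', split by the product rule into a change of the
    convolution with mu' and a change of the gradient of nu. All scalar estimates are run on [0, b]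
    with solutions cut off there, so that only times up to b enter the bounds, as Gronwall's
    argument requires. *)

Section real_integral.
Context d (T : measurableType d) (R : realType) (mu : {measure set T -> \bar R}).
Implicit Types f g : T -> R.

Lemma integrable_bound f g : measurable_fun setT f -> mu.-integrable setT (EFin \o g) ->
  (forall x, `|f x| <= g x) -> mu.-integrable setT (EFin \o f).
Proof.
move=> mf ig fg; apply: (le_integrable _ _ _ ig) => //; first exact/measurable_EFinP.
by move=> x _ /=; rewrite lee_fin (le_trans (fg x))// ler_norm.
Qed.

Lemma integrable_add f g : mu.-integrable setT (EFin \o f) ->
  mu.-integrable setT (EFin \o g) -> mu.-integrable setT (EFin \o (fun x => f x + g x)).
Proof. by move=> i1 i2; exact: (integrableD measurableT i1 i2). Qed.

Lemma integrable_sub f g : mu.-integrable setT (EFin \o f) ->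
  mu.-integrable setT (EFin \o g) -> mu.-integrable setT (EFin \o (fun x => f x - g x)).
Proof. by move=> i1 i2; exact: (integrableB measurableT i1 i2). Qed.

Lemma integrable_scale c f : mu.-integrable setT (EFin \o f) ->
  mu.-integrable setT (EFin \o (fun x => c * f x)).
Proof. by move=> i1; exact: (integrableZl measurableT c i1). Qed.

Lemma integrable_nrm f : mu.-integrable setT (EFin \o f) ->
  mu.-integrable setT (EFin \o (fun x => `|f x|)).
Proof. exact: integrable_norm. Qed.

Lemma integrable_measurable f : mu.-integrable setT (EFin \o f) -> measurable_fun setT f.
Proof. by move=> /measurable_int/measurable_EFinP. Qed.

Lemma Rint_EFin f : mu.-integrable setT (EFin \o f) ->
  (\int[mu]_x (f x)%:E)%E = (\int[mu]_x f x)%:E.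
Proof. by move=> i1; rewrite fineK//; exact: integrable_fin_num i1. Qed.

Lemma Rint_le f g : mu.-integrable setT (EFin \o f) ->
  mu.-integrable setT (EFin \o g) -> (forall x, f x <= g x) ->
  \int[mu]_x f x <= \int[mu]_x g x.
Proof. by move=> i1 i2 fg; apply: le_Rintegral. Qed.

Lemma Rint_abs_le f g : measurable_fun setT f -> mu.-integrable setT (EFin \o g) ->
  (forall x, `|f x| <= g x) -> `|\int[mu]_x f x| <= \int[mu]_x g x.
Proof.
move=> mf ig fg; have i1 := integrable_bound mf ig fg.
apply: le_trans (le_normr_Rintegral measurableT i1) _.
by apply: Rint_le => //; exact: integrable_nrm.
Qed.

Lemma integrable_of_bound f M : measurable_fun setT f ->
  (\int[mu]_x `|f x|%:E <= M%:E)%E ->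
  mu.-integrable setT (EFin \o f) /\ \int[mu]_x `|f x| <= M.
Proof.
move=> mf H; have i1 : mu.-integrable setT (EFin \o f).
  apply/integrableP; split; first exact/measurable_EFinP.
  by apply: le_lt_trans H (ltry _).
split=> //; rewrite -lee_fin -Rint_EFin//; exact: integrable_nrm.
Qed.

Lemma Rint_dominated (F : nat -> T -> R) f g :
  (forall n, measurable_fun setT (F n)) ->
  (forall x, F n x @[n --> \oo] --> f x) ->
  mu.-integrable setT (EFin \o g) -> (forall n x, `|F n x| <= g x) ->
  \int[mu]_x F n x @[n --> \oo] --> \int[mu]_x f x.
Proof.
move=> mF Ff ig Fg.
have [fi _ H] : [/\ mu.-integrable setT (EFin \o f),
    [sequence (\int[mu]_(x in setT) `|(F n x)%:E - (f x)%:E|)%E]_n @ \oo --> 0%E &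
    [sequence (\int[mu]_(x in setT) (F n x)%:E)%E]_n @ \oo --> (\int[mu]_(x in setT) (f x)%:E)%E].
  apply: (@dominated_convergence _ _ _ mu setT measurableT (fun n => EFin \o F n) (EFin \o f) (EFin \o g)) => //.
  - by move=> n; exact/measurable_EFinP.
  - by apply/measurable_EFinP; apply: (measurable_fun_cvg mF) => x _; exact: Ff.
  - by apply: aeW => x _; apply/cvg_EFin; [near=> n|exact: Ff].
  - by apply: aeW => n x _ /=; rewrite lee_fin.
have Fi n : mu.-integrable setT (EFin \o F n) by apply: integrable_bound ig _.
by rewrite (Rint_EFin fi) in H; exact: (fine_cvg H).
Unshelve. all: by end_near. Qed.
End real_integral.

Section product_sigma_finite.
Context d1 d2 (T1 : measurableType d1) (T2 : measurableType d2) (R : realType).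
Variables (m1 : {sigma_finite_measure set T1 -> \bar R})
  (m2 : {sigma_finite_measure set T2 -> \bar R}).

(* The library has no sigma-finite instance for [m1 \x m2], which is needed to
   iterate products. *)
Definition prodm : set (T1 * T2) -> \bar R := (m1 \x m2)%E.

HB.instance Definition _ := Measure.on prodm.

Lemma prodm_sigma_finite : sigma_finite setT prodm.
Proof.
have /sigma_finiteP[F [TF ndF Foo]] := sigma_finiteT m1.
have /sigma_finiteP[G [TG ndG Goo]] := sigma_finiteT m2.
exists (fun n => F n `*` G n).
  rewrite predeqE => -[x y]; split=> // _.
  have [i _ Fi] : (\bigcup_i F i) x by rewrite -TF.
  have [j _ Gj] : (\bigcup_i G i) y by rewrite -TG.
  exists (maxn i j) => //; split => /=.
  - by move: Fi; exact/subsetPset/ndF/leq_maxl.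
  - by move: Gj; exact/subsetPset/ndG/leq_maxr.
move=> i; have [mF Fi] := Foo i; have [mG Gi] := Goo i.
split; first exact: measurableX.
by rewrite /prodm product_measure1E// lte_mul_pinfty// ge0_fin_numE.
Qed.

HB.instance Definition _ := Measure_isSigmaFinite.Build _ _ _ prodm
  prodm_sigma_finite.
End product_sigma_finite.

Section real_fubini.
Context d1 d2 (T1 : measurableType d1) (T2 : measurableType d2) (R : realType).
Variables (m1 : {sigma_finite_measure set T1 -> \bar R})
  (m2 : {sigma_finite_measure set T2 -> \bar R}).
Implicit Types f : T1 * T2 -> R.

(** Tonelli with every section controlled, not almost every one, so that all inner integrals are
    genuine real integrals. These facts are proved for [m1 \x m2] and restated below for [prodm] by
    conversion, where they apply to products of products. *)
Let prod_bound1_ f (F : T1 -> R) : measurable_fun setT f ->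
  (forall x, m2.-integrable setT (fun y => (f (x, y))%:E)) ->
  (forall x, \int[m2]_y `|f (x, y)| <= F x) ->
  m1.-integrable setT (EFin \o F) ->
  (m1 \x m2)%E.-integrable setT (EFin \o f) /\
  \int[(m1 \x m2)%E]_z `|f z| <= \int[m1]_x F x.
Proof.
move=> mf i1 fF iF; apply: integrable_of_bound => //.
rewrite fubini_tonelli1//=; last first.
  by apply/measurable_EFinP; apply: measurableT_comp.
rewrite -Rint_EFin//; apply: ge0_le_integral => //=.
- by move=> x _; apply: integral_ge0 => y _; rewrite lee_fin.
- apply: measurable_fun_fubini_tonelli_F => //=.
  by apply/measurable_EFinP; apply: measurableT_comp.
- by move/integrable_measurable : iF => mF; apply/measurable_EFinP.
- move=> x _; rewrite /fubini_F/= Rint_EFin ?lee_fin//.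
  by apply: (@integrable_nrm _ _ _ m2 (fun y => f (x, y))); exact: i1.
Qed.

Let prod_bound2_ f (F : T2 -> R) : measurable_fun setT f ->
  (forall y, m1.-integrable setT (fun x => (f (x, y))%:E)) ->
  (forall y, \int[m1]_x `|f (x, y)| <= F y) ->
  m2.-integrable setT (EFin \o F) ->
  (m1 \x m2)%E.-integrable setT (EFin \o f) /\
  \int[(m1 \x m2)%E]_z `|f z| <= \int[m2]_y F y.
Proof.
move=> mf i1 fF iF; apply: integrable_of_bound => //.
rewrite fubini_tonelli2//=; last first.
  by apply/measurable_EFinP; apply: measurableT_comp.
rewrite -Rint_EFin//; apply: ge0_le_integral => //=.
- by move=> x _; apply: integral_ge0 => y _; rewrite lee_fin.
- apply: measurable_fun_fubini_tonelli_G => //=.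
  by apply/measurable_EFinP; apply: measurableT_comp.
- by move/integrable_measurable : iF => mF; apply/measurable_EFinP.
- move=> x _; rewrite /fubini_G/= Rint_EFin ?lee_fin//.
  by apply: (@integrable_nrm _ _ _ m1 (fun y => f (y, x))); exact: i1.
Qed.

Let prod_int1_ f : (m1 \x m2)%E.-integrable setT (EFin \o f) ->
  (forall x, m2.-integrable setT (fun y => (f (x, y))%:E)) ->
  m1.-integrable setT (fun x => (\int[m2]_y f (x, y))%:E) /\
  \int[(m1 \x m2)%E]_z f z = \int[m1]_x \int[m2]_y f (x, y).
Proof.
move=> fi i1.
have E : fubini_F m2 (EFin \o f) = (fun x => (\int[m2]_y f (x, y))%:E).
  by apply/funext => x; exact: (@Rint_EFin _ _ _ m2 (fun y => f (x, y)) (i1 x)).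
split; first by rewrite -E; exact: integrable_fubini_F.
by rewrite {1}/Rintegral -integral12_prod_meas1// E.
Qed.

Let prod_int2_ f : (m1 \x m2)%E.-integrable setT (EFin \o f) ->
  (forall y, m1.-integrable setT (fun x => (f (x, y))%:E)) ->
  m2.-integrable setT (fun y => (\int[m1]_x f (x, y))%:E) /\
  \int[(m1 \x m2)%E]_z f z = \int[m2]_y \int[m1]_x f (x, y).
Proof.
move=> fi i1.
have E : fubini_G m1 (EFin \o f) = (fun y => (\int[m1]_x f (x, y))%:E).
  by apply/funext => x; exact: (@Rint_EFin _ _ _ m1 (fun y => f (y, x)) (i1 x)).
have mf : measurable_fun setT (EFin \o f) by exact: measurable_int fi.
have mG : measurable_fun setT (fun y => \int[m1]_x f (x, y)).
  by apply/measurable_EFinP; have := measurable_fubini_G fi; rewrite E.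
split.
  apply/integrableP; split; first exact/measurable_EFinP.
  apply: le_lt_trans ((integrable21ltyP m1 m2 mf).1 fi).
  apply: ge0_le_integral => //=.
  - by apply/measurable_EFinP; exact: measurableT_comp.
  - apply: (@measurable_fun_fubini_tonelli_G _ _ _ _ _ m1 (fun z => `|f z|%:E)) => //.
    by apply/measurable_EFinP; apply: measurableT_comp => //; exact/measurable_EFinP.
  - move=> y _; have /measurable_int my := i1 y.
    have -> : `|\int[m1]_x f (x, y)|%:E = (`|\int[m1]_x (f (x, y))%:E|)%E.
      by rewrite (@Rint_EFin _ _ _ m1 (fun x => f (x, y)) (i1 y)).
    exact: le_abse_integral.
by rewrite {1}/Rintegral -integral21_prod_meas1// E.
Qed.

Lemma prod_bound1 f (F : T1 -> R) : measurable_fun setT f ->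
  (forall x, m2.-integrable setT (fun y => (f (x, y))%:E)) ->
  (forall x, \int[m2]_y `|f (x, y)| <= F x) ->
  m1.-integrable setT (EFin \o F) ->
  (prodm m1 m2).-integrable setT (EFin \o f) /\
  \int[(prodm m1 m2)]_z `|f z| <= \int[m1]_x F x.
Proof. exact: prod_bound1_. Qed.

Lemma prod_bound2 f (F : T2 -> R) : measurable_fun setT f ->
  (forall y, m1.-integrable setT (fun x => (f (x, y))%:E)) ->
  (forall y, \int[m1]_x `|f (x, y)| <= F y) ->
  m2.-integrable setT (EFin \o F) ->
  (prodm m1 m2).-integrable setT (EFin \o f) /\
  \int[(prodm m1 m2)]_z `|f z| <= \int[m2]_y F y.
Proof. exact: prod_bound2_. Qed.

Lemma prod_int1 f : (prodm m1 m2).-integrable setT (EFin \o f) ->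
  (forall x, m2.-integrable setT (fun y => (f (x, y))%:E)) ->
  m1.-integrable setT (fun x => (\int[m2]_y f (x, y))%:E) /\
  \int[(prodm m1 m2)]_z f z = \int[m1]_x \int[m2]_y f (x, y).
Proof. exact: prod_int1_. Qed.

Lemma prod_int2 f : (prodm m1 m2).-integrable setT (EFin \o f) ->
  (forall y, m1.-integrable setT (fun x => (f (x, y))%:E)) ->
  m2.-integrable setT (fun y => (\int[m1]_x f (x, y))%:E) /\
  \int[(prodm m1 m2)]_z f z = \int[m2]_y \int[m1]_x f (x, y).
Proof. exact: prod_int2_. Qed.
End real_fubini.

(** * Measure-preserving maps and translations *)

Section preserve.
Context d (T : measurableType d) (R : realType) (mu : {measure set T -> \bar R}).
Variable phi : T -> T.
Hypothesis mphi : measurable_fun setT phi.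
Hypothesis pphi : forall A, measurable A -> mu (phi @^-1` A) = mu A.

Lemma preserve_Rint (f : T -> R) : mu.-integrable setT (EFin \o f) ->
  mu.-integrable setT (EFin \o (f \o phi)) /\
  \int[mu]_x f (phi x) = \int[mu]_x f x.
Proof.
move=> fi; have mf := integrable_measurable fi.
have /measurable_EFinP mE := mf.
have mfp : measurable_fun setT (f \o phi) by exact: measurableT_comp.
have fip : mu.-integrable setT (EFin \o (f \o phi)).
  apply/integrableP; split; first exact/measurable_EFinP.
  move/integrableP : fi => [_]; apply: le_lt_trans.
  have ma : measurable_fun setT (fun x => `|(f x)%:E|%E).
    by apply/measurable_EFinP; exact: measurableT_comp.
  have := ge0_integral_pushforward mphi mu measurableT ma.
  rewrite preimage_setT => <- //.
  by rewrite le_eqVlt; apply/orP; left; apply/eqP/eq_measure_integral => A mA _; exact: pphi.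
split=> //; congr fine.
have := integral_pushforward mphi mE (D := setT).
move=> /(_ mu); rewrite preimage_setT => /(_ fip measurableT) <-.
by apply: eq_measure_integral => A mA _; exact: pphi.
Qed.
End preserve.

Section preserve_prod.
Context d1 d2 (T1 : measurableType d1) (T2 : measurableType d2) (R : realType).
Variables (m1 : {sigma_finite_measure set T1 -> \bar R})
  (m2 : {sigma_finite_measure set T2 -> \bar R}).

(** The pushforward and the product measure agree on rectangles, which determine a product of
    sigma-finite measures. *)
Lemma preserve_fst (phi : T1 -> T1) : measurable_fun setT phi ->
  (forall A, measurable A -> m1 (phi @^-1` A) = m1 A) ->
  measurable_fun setT (fun z : T1 * T2 => (phi z.1, z.2)) /\
  forall A, measurable A ->
    prodm m1 m2 ((fun z : T1 * T2 => (phi z.1, z.2)) @^-1` A) = prodm m1 m2 A.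
Proof.
move=> mphi pphi.
have mp : measurable_fun setT (fun z : T1 * T2 => (phi z.1, z.2)).
  by apply: measurable_fun_pair => //; exact: measurableT_comp.
split=> // A mA; apply/esym.
rewrite -[RHS]/(pushforward (prodm m1 m2) (fun z : T1 * T2 => (phi z.1, z.2)) A).
apply: product_measure_unique => // B C mB mC /=; rewrite /pushforward.
have mpB : measurable (phi @^-1` B) by rewrite -[X in measurable X]setTI; exact: mphi.
rewrite (_ : _ @^-1` _ = (phi @^-1` B) `*` C)//.
by rewrite /prodm product_measure1E//; congr (_ * _)%E; exact: pphi.
Qed.

Lemma preserve_snd (phi : T2 -> T2) : measurable_fun setT phi ->
  (forall A, measurable A -> m2 (phi @^-1` A) = m2 A) ->
  measurable_fun setT (fun z : T1 * T2 => (z.1, phi z.2)) /\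
  forall A, measurable A ->
    prodm m1 m2 ((fun z : T1 * T2 => (z.1, phi z.2)) @^-1` A) = prodm m1 m2 A.
Proof.
move=> mphi pphi.
have mp : measurable_fun setT (fun z : T1 * T2 => (z.1, phi z.2)).
  by apply: measurable_fun_pair => //; exact: measurableT_comp.
split=> // A mA; apply/esym.
rewrite -[RHS]/(pushforward (prodm m1 m2) (fun z : T1 * T2 => (z.1, phi z.2)) A).
apply: product_measure_unique => // B C mB mC /=; rewrite /pushforward.
have mpC : measurable (phi @^-1` C) by rewrite -[X in measurable X]setTI; exact: mphi.
rewrite (_ : _ @^-1` _ = B `*` (phi @^-1` C))//.
rewrite /prodm product_measure1E ?pphi//.
Qed.
End preserve_prod.

Section translation.
Context {R : realType}.
Local Notation TR := (measurableTypeR R).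
Local Notation leb := (@lebesgue_measure R).

Lemma measurable_shift (h : R) : measurable_fun [set: TR] (fun x : TR => (x + h : TR)).
Proof. by apply: measurable_funD => //; exact: measurable_cst. Qed.

Lemma lebesgue_measure_shift (h : R) (A : set TR) : measurable A ->
  pushforward leb (fun x : TR => (x + h : TR)) A = leb A.
Proof.
move=> mA.
apply/esym/lebesgue_measure_unique => //; first exact: measurable_shift.
move=> mS X [[a b] _ <-].
change (leb `]a, b] = leb ((fun x : TR => x + h) @^-1` `]a, b]%classic)).
rewrite (_ : _ @^-1` _ = `]a - h, b - h]%classic).
  rewrite !lebesgue_measure_itv/= !lte_fin ltrD2r -!EFinB.
  by case: ifPn => // _; congr EFin; ring.
by apply/seteqP; split => x/=; rewrite !in_itv/= ltrBlDr lerBrDr.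
Qed.

Lemma Rint_shift (f : R -> R) h : leb.-integrable setT (EFin \o f) ->
  leb.-integrable setT (fun x => (f (x + h))%:E) /\
  \int[leb]_x f (x + h) = \int[leb]_x f x.
Proof. exact: (preserve_Rint (measurable_shift h) (lebesgue_measure_shift h)). Qed.
End translation.

(** * Weighted integrals in the doubled variables *)

Section weights.
Context {R : realType}.
Local Notation TR := (measurableTypeR R).
Local Notation leb := (@lebesgue_measure R).
Local Notation leb2 := (prodm leb leb).
Local Notation leb4 := (prodm leb2 leb2).
Implicit Types (a b c k : R -> R).

(** Only the variable x of ((t, x), (s, y)) is translated. This invariance later transfers an
    increment in x from the coefficient and the kernel to [u]. *)
Lemma leb4_shift (h : R) (f : (TR * TR) * (TR * TR) -> R) :
  leb4.-integrable setT (EFin \o f) ->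
  leb4.-integrable setT (fun Z => (f ((Z.1.1, Z.1.2 + h), Z.2))%:E) /\
  \int[leb4]_Z f ((Z.1.1, Z.1.2 + h), Z.2) = \int[leb4]_Z f Z.
Proof.
have [m2 p2] := preserve_snd leb (measurable_shift h) (lebesgue_measure_shift h).
have [m4 p4] := preserve_fst leb2 m2 p2.
exact: (preserve_Rint m4 p4).
Qed.

Lemma integrable_tensor a b : leb.-integrable setT (EFin \o a) ->
  leb.-integrable setT (EFin \o b) ->
  leb2.-integrable setT (fun z => (a z.1 * b z.2)%:E) /\
  \int[leb2]_z (a z.1 * b z.2) = (\int[leb]_x a x) * (\int[leb]_x b x).
Proof.
move=> ia ib; have ma := integrable_measurable ia; have mb := integrable_measurable ib.
have sec (x : TR) : leb.-integrable setT (fun y => (a x * b y)%:E) by exact: (integrable_scale (a x) ib).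
have int2 : leb2.-integrable setT (fun z => (a z.1 * b z.2)%:E).
  have := @prod_bound1 _ _ TR TR R leb leb (fun z => a z.1 * b z.2)
    (fun x => (\int[leb]_y `|b y|) * `|a x|).
  move=> []//.
  - by apply: measurable_funM; exact: measurableT_comp.
  - move=> x /=; under eq_Rintegral do rewrite normrM.
    by rewrite RintegralZl ?integrable_nrm// mulrC.
  - by apply: integrable_scale; exact: integrable_nrm.
split=> //; have [_ ->/=] := prod_int1 int2 sec.
under eq_Rintegral do rewrite RintegralZl//.
by rewrite RintegralZr.
Qed.

(** By evenness k(x - y) is the translate k(y - x) of [k], so translation invariance gives its
    integral in y. *)
Lemma integrable_kernel c k (x : R) : leb.-integrable setT (EFin \o c) ->
  leb.-integrable setT (EFin \o k) -> (forall y, k (- y) = k y) ->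
  leb2.-integrable setT (fun z => (c z.1 * k (x - z.2))%:E) /\
  \int[leb2]_z (c z.1 * k (x - z.2)) = (\int[leb]_x c x) * (\int[leb]_x k x).
Proof.
move=> ic ik kN.
have E y : k (x - y) = k (y + - x) by rewrite -kN opprB.
have [ik' Ek] := Rint_shift (- x) ik.
have [i2 E2] := integrable_tensor ic ik'.
under eq_fun do rewrite E.
by under eq_Rintegral do rewrite E; rewrite -Ek.
Qed.

(** The weight c(s) k(x - y) integrates over (s, y) to a constant independent of (t, x). With
    mollifiers the constant is 1; with tents the lemma yields the integrable majorant [dom]. *)
Lemma weight1 (h : TR * TR -> R) c k : leb2.-integrable setT (EFin \o h) ->
  leb.-integrable setT (EFin \o c) -> leb.-integrable setT (EFin \o k) ->
  (forall y, k (- y) = k y) ->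
  leb4.-integrable setT (fun Z => (h Z.1 * (c Z.2.1 * k (Z.1.2 - Z.2.2)))%:E) /\
  \int[leb4]_Z (h Z.1 * (c Z.2.1 * k (Z.1.2 - Z.2.2))) =
  (\int[leb2]_z h z) * ((\int[leb]_x c x) * (\int[leb]_x k x)).
Proof.
move=> ih ic ik kN.
have mh := integrable_measurable ih; have mc := integrable_measurable ic.
have mk := integrable_measurable ik.
have sec (z : TR * TR) :
    leb2.-integrable setT (fun z' => (h z * (c z'.1 * k (z.2 - z'.2)))%:E).
  by apply: (@integrable_scale _ _ R leb2 (h z)); case: (integrable_kernel z.2 ic ik kN).
have int4 : leb4.-integrable setT (fun Z => (h Z.1 * (c Z.2.1 * k (Z.1.2 - Z.2.2)))%:E).
  have := @prod_bound1 _ _ _ _ R leb2 leb2 (fun Z => h Z.1 * (c Z.2.1 * k (Z.1.2 - Z.2.2)))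
    (fun z => ((\int[leb]_y `|c y|) * (\int[leb]_y `|k y|)) * `|h z|).
  move=> []//.
  - apply: measurable_funM; first exact: measurableT_comp.
    apply: measurable_funM.
      by apply: (measurableT_comp mc); exact: measurableT_comp.
    apply: (measurableT_comp mk); apply: measurable_funB; exact: measurableT_comp.
  - move=> z /=; under eq_Rintegral do rewrite !normrM.
    have := @integrable_kernel (fun x => `|c x|) (fun x => `|k x|) z.2.
    move=> []; [exact: integrable_nrm|exact: integrable_nrm|by move=> y; rewrite kN|].
    by move=> i1 E1; rewrite RintegralZl// E1 mulrC.
  - by apply: integrable_scale; exact: integrable_nrm.
split=> //; have [_ ->/=] := prod_int1 int4 sec.
rewrite -RintegralZr//; apply: eq_Rintegral => z _.
have [i1 E1] := integrable_kernel z.2 ic ik kN.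
by rewrite RintegralZl// E1.
Qed.

Lemma weight2 (h : TR * TR -> R) c k : leb2.-integrable setT (EFin \o h) ->
  leb.-integrable setT (EFin \o c) -> leb.-integrable setT (EFin \o k) ->
  (forall y, k (- y) = k y) ->
  leb4.-integrable setT (fun Z => (h Z.2 * (c Z.1.1 * k (Z.1.2 - Z.2.2)))%:E) /\
  \int[leb4]_Z (h Z.2 * (c Z.1.1 * k (Z.1.2 - Z.2.2))) =
  (\int[leb2]_z h z) * ((\int[leb]_x c x) * (\int[leb]_x k x)).
Proof.
move=> ih ic ik kN.
have mh := integrable_measurable ih; have mc := integrable_measurable ic.
have mk := integrable_measurable ik.
have E (x y : R) : k (x - y) = k (y - x) by rewrite -kN opprB.
have sec (z : TR * TR) :
    leb2.-integrable setT (fun z' => (h z * (c z'.1 * k (z'.2 - z.2)))%:E).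
  under eq_fun do rewrite E.
  by apply: (@integrable_scale _ _ R leb2 (h z)); case: (integrable_kernel z.2 ic ik kN).
have int4 : leb4.-integrable setT (fun Z => (h Z.2 * (c Z.1.1 * k (Z.1.2 - Z.2.2)))%:E).
  have := @prod_bound2 _ _ _ _ R leb2 leb2 (fun Z => h Z.2 * (c Z.1.1 * k (Z.1.2 - Z.2.2)))
    (fun z => ((\int[leb]_y `|c y|) * (\int[leb]_y `|k y|)) * `|h z|).
  move=> []//.
  - apply: measurable_funM; first exact: measurableT_comp.
    apply: measurable_funM.
      by apply: (measurableT_comp mc); exact: measurableT_comp.
    apply: (measurableT_comp mk); apply: measurable_funB; exact: measurableT_comp.
  - move=> z /=; under eq_Rintegral do rewrite !normrM E.
    have := @integrable_kernel (fun x => `|c x|) (fun x => `|k x|) z.2.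
    move=> []; [exact: integrable_nrm|exact: integrable_nrm|by move=> y; rewrite kN|].
    by move=> i1 E1; rewrite RintegralZl// E1 mulrC.
  - by apply: integrable_scale; exact: integrable_nrm.
split=> //; have [_ ->/=] := prod_int2 int4 sec.
rewrite -RintegralZr//; apply: eq_Rintegral => z _.
have [i1 E1] := integrable_kernel z.2 ic ik kN.
under eq_Rintegral do rewrite E.
by rewrite RintegralZl// E1.
Qed.
End weights.

(** * Smooth functions and mollifiers *)

Section Cn_calculus.
Context {R : realType} {V : normedModType R}.
Implicit Types f g : V -> R.

Lemma Cn_continuous n f : Cn n f -> continuous f.
Proof. by case: n => //= n []. Qed.

Lemma CnW n f : Cn n.+1 f -> Cn n f.
Proof.
elim: n f => [|n IH] f; first by case.
move=> [cf df dcf]; split=> // v; exact/IH/dcf.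
Qed.

Lemma Cn_cst n (c : R) : Cn n (cst c : V -> R).
Proof.
elim: n c => [|n IH] c; first by move=> x; exact: cst_continuous.
split=> [x|v x|v]; [exact: cst_continuous|exact: derivable_cst|].
by rewrite (_ : (fun _ => _) = cst 0); [exact: IH|apply/funext => x; rewrite derive_cst].
Qed.

Lemma CnD n f g : Cn n f -> Cn n g -> Cn n (f \+ g).
Proof.
elim: n f g => [|n IH] f g; first by move=> cf cg x; exact: continuousD (cf x) (cg x).
move=> [cf df dcf] [cg dg dcg]; split=> [x|v x|v].
- exact: continuousD (cf x) (cg x).
- exact: derivableD.
- rewrite (_ : (fun _ => _) = (fun x => 'D_v f x) \+ (fun x => 'D_v g x)).
    exact: IH (dcf v) (dcg v).
  by apply/funext => x; rewrite deriveD.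
Qed.

Lemma CnM n f g : Cn n f -> Cn n g -> Cn n (f \* g).
Proof.
elim: n f g => [|n IH] f g; first by move=> cf cg x; exact: continuousM (cf x) (cg x).
move=> Cf Cg; move: (Cf) (Cg) => [cf df dcf] [cg dg dcg]; split=> [x|v x|v].
- exact: continuousM (cf x) (cg x).
- exact: derivableM.
- rewrite (_ : (fun _ => _) =
    (f \* (fun x => 'D_v g x)) \+ (g \* (fun x => 'D_v f x))).
    by apply: CnD; apply: IH; [exact: CnW|exact: dcg|exact: CnW|exact: dcf].
  by apply/funext => x; rewrite deriveM.
Qed.

Lemma CnZ n (c : R) f : Cn n f -> Cn n (fun x => c * f x).
Proof. by move=> Cf; apply: (@CnM n (cst c) f) => //; exact: Cn_cst. Qed.
End Cn_calculus.

Section Cn_affine.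
Context {R : realType} {V W : normedModType R}.
Variables (L L0 : V -> W).
Hypothesis LL0 : forall h v a, L (h *: v + a) = h *: L0 v + L a.
Hypothesis cL : continuous L.

(** [L] is affine with linear part [L0]: the difference quotient of [f \o L] along v is literally
    that of [f] along [L0 v]. *)
Lemma derivable_affine (f : W -> R) x v :
  derivable f (L x) (L0 v) -> derivable (f \o L) x v.
Proof. by rewrite /derivable/= ; under eq_fun do rewrite -LL0. Qed.

Lemma derive_affine (f : W -> R) x v : 'D_v (f \o L) x = 'D_(L0 v) f (L x).
Proof. by rewrite /derive/=; under eq_fun do rewrite LL0. Qed.

Lemma Cn_affine n (f : W -> R) : Cn n f -> Cn n (f \o L).
Proof.
elim: n f => [|n IH] f; first by move=> cf x; apply: continuous_comp; [exact: cL|exact: cf].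
move=> [cf df dcf]; split=> [x|v x|v].
- by apply: continuous_comp; [exact: cL|exact: cf].
- exact: derivable_affine.
- rewrite (_ : (fun _ => _) = (fun y => 'D_(L0 v) f y) \o L); first exact: IH (dcf _).
  by apply/funext => x; rewrite derive_affine.
Qed.
End Cn_affine.

Section derive_R.
Context {R : realType}.
Implicit Types (f : R -> R) (x v d : R).

Lemma is_derive_dir f x v d : is_derive x 1 f d -> is_derive x v f (v * d).
Proof.
move=> [/derivable1_diffP df <-]; split; first exact: diff_derivable.
rewrite deriveE// (_ : v = v *: (1 : R)); last by rewrite /GRing.scale/= mulr1.
by rewrite linearZ/= -deriveE// [in RHS]/GRing.scale/= mulr1.
Qed.

(** A quadratic remainder is how derivatives are obtained where calculus rules do not reach: for
    [flat] at 0, for convolutions, and for [nu] composed with a convolution. *)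
Lemma is_derive_quad f x d C :
  (forall h, `|h| <= 1 -> `|f (x + h) - f x - d * h| <= C * h ^+ 2) ->
  is_derive x 1 f d.
Proof.
move=> H.
have key : h^-1 *: (f (h *: 1 + x) - f x) @[h --> 0^'] --> d.
  apply/cvgrPdist_le => e e0; near=> h.
  have h0 : h != 0 by near: h; exact: nbhs_dnbhs_neq.
  have h1 : `|h| <= 1.
    by near: h; apply: dnbhs0_le.
  have hC : `|h| <= e / (`|C| + 1).
    by near: h; apply: dnbhs0_le; rewrite divr_gt0// ltr_wpDl.
  rewrite /GRing.scale/= mulr1 [h + x]addrC distrC.
  rewrite (_ : _ - d = h^-1 * (f (x + h) - f x - d * h)); last by field.
  rewrite normrM normfV ler_pdivrMl ?normr_gt0//.
  apply: le_trans (H _ h1) _; rewrite -real_normK ?num_real// expr2.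
  have hh : `|C| * `|h| <= e.
    move: hC; rewrite ler_pdivlMr ?ltr_wpDl// => hC; rewrite (le_trans _ hC)//.
    by rewrite mulrC ler_wpM2l// lerDl.
  rewrite (@le_trans _ _ (`|C| * (`|h| * `|h|)))//.
    by rewrite ler_wpM2r ?mulr_ge0// ler_norm.
  by rewrite mulrCA ler_wpM2l.
split; last exact: cvg_lim.
by apply/cvg_ex; exists d.
Unshelve. all: by end_near. Qed.

Lemma is_derive_continuous f (df : R -> R) :
  (forall x, is_derive x 1 f (df x)) -> continuous f.
Proof.
move=> H x; apply: differentiable_continuous; apply/derivable1_diffP.
by case: (H x).
Qed.

Lemma CnS_R n f (df : R -> R) :
  (forall x, is_derive x 1 f (df x)) -> Cn n df -> Cn n.+1 f.
Proof.
move=> H Cdf; split=> [x|v x|v]; first exact: is_derive_continuous H x.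
- by case: (is_derive_dir v (H x)).
- rewrite (_ : (fun _ => _) = (fun x => v * df x)); first exact: CnZ.
  by apply/funext => x; case: (is_derive_dir v (H x)).
Qed.

Lemma Cn_is_derive n f x : Cn n.+1 f -> is_derive x 1 f ('D_1 f x).
Proof. by case=> _ df _; split=> //; exact: df. Qed.
End derive_R.

Section flat_function.
Context {R : realType}.
Implicit Types x : R.

(* flat (n + 2) - n * flat (n + 1) is the derivative of flat n, so that the
   family is closed under differentiation. *)
Definition flat (n : nat) (x : R) : R :=
  if 0 < x then x ^- n * expR (- x^-1) else 0.

Lemma flat_ge0 n x : 0 <= flat n x.
Proof.
rewrite /flat; case: ifPn => // x0.
by rewrite mulr_ge0 ?expR_ge0// invr_ge0 exprn_ge0// ltW.
Qed.

Lemma flat_gt0 n x : 0 < x -> 0 < flat n x.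
Proof. by move=> x0; rewrite /flat x0 mulr_gt0 ?expR_gt0// invr_gt0 exprn_gt0. Qed.

Lemma flat_le0 n x : x <= 0 -> flat n x = 0.
Proof. by move=> x0; rewrite /flat ltNge x0. Qed.

(** For x > 0 one term of the exponential series gives exp(1/x) >= x^-(n+1) / (n+1)!, which beats
    the pole x^-n with one power of x to spare. *)
Lemma flat_le n x : `|flat n x| <= n.+1`!%:R * `|x|.
Proof.
rewrite ger0_norm ?flat_ge0//; have [x0|x0] := leP x 0.
  by rewrite flat_le0// mulr_ge0.
rewrite /flat x0 gtr0_norm// expRN -ler_pdivlMr ?invr_gt0 ?expR_gt0// invrK.
have h := expR_ge1Dxn n (ltW (etrans (invr_gt0 x) x0)).
have f0 : (0 : R) < n.+1`!%:R by rewrite ltr0n fact_gt0.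
have : x^-1 ^+ n.+1 / n.+1`!%:R <= expR x^-1 by rewrite (le_trans _ h)// lerDr.
rewrite ler_pdivrMr// => {}h.
rewrite mulrAC -ler_pdivrMr// (le_trans _ (le_trans h _)) //.
  by rewrite exprSr exprVn.
by rewrite mulrC.
Qed.

Lemma flat_derive n x : is_derive x 1 (flat n) (- n%:R * flat n.+1 x + flat n.+2 x).
Proof.
have [x0|x0|x0] := ltgtP x 0.
- rewrite !flat_le0 ?ltW// mulr0 addr0.
  apply: (near_eq_is_derive (f := cst 0)).
  by near=> y; rewrite flat_le0// ltW//; near: y; exact: lt_nbhsl.
- have x1 : x != 0 by rewrite gt_eqF.
  have d1 : is_derive x 1 (fun y : R => y^-1) (- x ^- 2).
    by have := is_deriveV x1 (is_derive_id x 1); rewrite /GRing.scale/= mulr1.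
  have d2 : is_derive x 1 (fun y : R => - y^-1) (x ^- 2).
    by have := is_deriveN d1; rewrite opprK.
  have d3 : is_derive x 1 (fun y : R => expR (- y^-1)) (expR (- x^-1) * x ^- 2).
    exact: (@is_derive1_comp _ expR (fun y : R => - y^-1)).
  have d4 : is_derive x 1 (fun y : R => y^-1 ^+ n) (n%:R * x^-1 ^+ n.-1 * - x ^- 2).
    have := is_deriveX n d1; rewrite (_ : _ ^+ n = (fun y : R => y^-1 ^+ n))//.
    by apply/funext => y; rewrite exprfctE.
  suff H : is_derive x 1 (fun y : R => y^-1 ^+ n * expR (- y^-1))
      (- n%:R * flat n.+1 x + flat n.+2 x).
    apply: near_eq_is_derive H.
    near=> y; rewrite /flat ifT ?exprVn//; near: y; exact: lt_nbhsr.
  apply: (is_derive_eq (is_deriveM d4 d3)).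
  rewrite /GRing.scale/= /flat x0 -!exprVn; case: n {d4} => [|n]/=.
    by rewrite !(mul0r,mulr0,oppr0,add0r,addr0,expr0,mul1r); ring.
  by rewrite !exprS; ring.
- rewrite x0 !flat_le0// mulr0 addr0.
  (* At 0 the identity flat n h = h flat (n+1) h and [flat_le] bound the increment by (n+2)! h^2, so
     the derivative there is 0. *)
  apply: (@is_derive_quad _ _ _ _ (n.+2)`!%:R) => h _.
  rewrite add0r mul0r (flat_le0 _ (lexx 0)) !subr0.
  have -> : flat n h = h * flat n.+1 h.
    rewrite /flat; case: ifPn => [h0|]; last by rewrite mulr0.
    by rewrite exprS invfM !mulrA mulfV ?mul1r// gt_eqF.
  by rewrite normrM -real_normK ?num_real// expr2 mulrCA ler_wpM2l// flat_le.
Unshelve. all: by end_near. Qed.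

Lemma Cn_flat m n : Cn m (flat n).
Proof.
elim: m n => [|m IH] n; first exact: is_derive_continuous (flat_derive n).
by apply: CnS_R (flat_derive n) _; apply: CnD => //; exact: CnZ.
Qed.

End flat_function.

Section bump_scaled.
Context {R : realType}.
Variable d : R.
Hypothesis d0 : 0 < d.
Implicit Types x : R.

Definition bump0 x : R := flat 0 (d + x) * flat 0 (d - x).

Lemma Cn_bump0 n : Cn n bump0.
Proof.
have H s : Cn n (fun x : R => flat 0 (d + s * x)).
  apply: (@Cn_affine _ _ _ (fun x : R => d + s * x) (fun x : R => s * x)).
  - by move=> h v a; rewrite /GRing.scale/=; ring.
  - by move=> x; apply: continuousD; [exact: cst_continuous|exact: mulrl_continuous].
  - exact: Cn_flat.
have -> : bump0 = (fun x => flat 0 (d + 1 * x)) \* (fun x => flat 0 (d + (-1) * x)).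
  by apply/funext => x; rewrite /bump0/= mul1r mulN1r.
by apply: CnM; exact: H.
Qed.

Lemma bump0_ge0 x : 0 <= bump0 x.
Proof. by rewrite mulr_ge0 ?flat_ge0. Qed.

Lemma bump0N x : bump0 (- x) = bump0 x.
Proof. by rewrite /bump0 opprK mulrC. Qed.

Lemma bump0_out x : d <= `|x| -> bump0 x = 0.
Proof.
rewrite ler_normr => /orP[x1|x1]; rewrite /bump0.
  by rewrite [X in _ * X]flat_le0 ?mulr0// subr_le0.
by rewrite [X in X * _]flat_le0 ?mul0r//; lra.
Qed.

Lemma bump0_gt0 x : `|x| < d -> 0 < bump0 x.
Proof. by rewrite ltr_norml => /andP[x1 x2]; rewrite mulr_gt0// flat_gt0//; lra. Qed.

Definition bumpI : R := \int[@lebesgue_measure R]_(x in `[-d, d]) bump0 x.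

Lemma continuous_bump0 : continuous bump0.
Proof. exact: Cn_continuous (Cn_bump0 0). Qed.

Lemma integrable_bump0 : (@lebesgue_measure R).-integrable `[-d, d] (EFin \o bump0).
Proof.
apply: continuous_compact_integrable; first exact: segment_compact.
apply: continuous_subspaceT; exact: continuous_bump0.
Qed.

Lemma bumpI_gt0 : 0 < bumpI.
Proof.
have cb := continuous_bump0.
have b0 : 0 < bump0 0 by apply: bump0_gt0; rewrite normr0.
have : \forall x \near (0 : R), bump0 0 / 2 <= bump0 x.
  have /cvgrPdist_le/(_ (bump0 0 / 2)) := cb 0.
  rewrite divr_gt0// => /(_ isT); apply: filterS => x.
  by rewrite ler_norml => /andP[_]; lra.
move=> /nbhs_ballP[e/= e0 He].
pose c := Num.min (e / 2) d.
have c0 : 0 < c by rewrite lt_min d0 divr_gt0.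
have cI : `[0, c] `<=` `[-d, d]%classic.
  move=> x/=; rewrite !in_itv/= => /andP[x0 xc].
  rewrite (le_trans _ x0)/= ?oppr_le0; last exact: ltW.
  by rewrite (le_trans xc)// ge_min lexx orbT.
have H : (\int[@lebesgue_measure R]_(x in `[0%R, c]) (bump0 0 / 2)%:E <=
  \int[@lebesgue_measure R]_(x in `[(-d)%R, d]) (bump0 x)%:E)%E.
  apply: (@le_trans _ _ (\int[@lebesgue_measure R]_(x in `[0%R, c]) (bump0 x)%:E)%E).
    apply: ge0_le_integral => //=.
    - by move=> x _; rewrite lee_fin divr_ge0// ltW.
    - by apply/measurable_EFinP; apply: measurable_funTS; exact: continuous_measurable_fun.
    - move=> x; rewrite in_itv/= => /andP[x0 xd]; rewrite lee_fin; apply: He.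
      rewrite /ball/= sub0r normrN ger0_norm//.
      by rewrite (le_lt_trans xd)// gt_min; apply/orP; left; lra.
  apply: ge0_subset_integral => //=.
  - by apply/measurable_EFinP; apply: measurable_funTS; exact: continuous_measurable_fun.
  - by move=> x _; rewrite lee_fin bump0_ge0.
rewrite /bumpI /Rintegral -lte_fin fineK; last exact: integrable_fin_num integrable_bump0.
apply: lt_le_trans H; rewrite integral_cst//= lebesgue_measure_itv/= lte_fin c0.
by rewrite -EFinD -EFinM lte_fin mulr_gt0 ?divr_gt0// subr0.
Qed.

Definition moll x : R := bumpI^-1 * bump0 x.

Lemma Cn_moll n : Cn n moll.
Proof. exact/CnZ/Cn_bump0. Qed.

Lemma moll_ge0 x : 0 <= moll x.
Proof. by rewrite mulr_ge0 ?bump0_ge0// invr_ge0 ltW// bumpI_gt0. Qed.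

Lemma mollN x : moll (- x) = moll x.
Proof. by rewrite /moll bump0N. Qed.

Lemma moll_out x : d <= `|x| -> moll x = 0.
Proof. by move=> x1; rewrite /moll bump0_out// mulr0. Qed.

Lemma moll_restrict : moll = moll \_ `[-d, d].
Proof.
apply/funext => x; rewrite patchE; case: ifPn => //.
rewrite notin_setE/= in_itv/= => /negP; rewrite -ler_norml -ltNge => /ltW.
exact: moll_out.
Qed.

Lemma integrable_moll : (@lebesgue_measure R).-integrable setT (EFin \o moll).
Proof.
have H : (@lebesgue_measure R).-integrable `[-d, d] (EFin \o moll).
  rewrite (_ : EFin \o moll = fun x => (bumpI^-1%:E * (EFin \o bump0) x)%E)//.
  by apply: integrableZl => //; exact: integrable_bump0.
move/integrable_mkcond : H; rewrite restrict_EFin -moll_restrict; apply.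
exact: measurable_itv.
Qed.

Lemma integral_moll : \int[@lebesgue_measure R]_x moll x = 1.
Proof.
rewrite moll_restrict -Rintegral_mkcond RintegralZl//; last exact: integrable_bump0.
by rewrite mulVf// gt_eqF// bumpI_gt0.
Qed.
End bump_scaled.

(** * Mean value estimates and supports *)

Section mean_value.
Context {R : realType}.
Implicit Types (f df : R -> R) (x y h M d : R).

Lemma MVT_le f df M : (forall x, is_derive x 1 f (df x)) ->
  (forall x, `|df x| <= M) -> forall x y, `|f x - f y| <= M * `|x - y|.
Proof.
move=> H HM; suff K x y : x < y -> `|f y - f x| <= M * `|y - x|.
  move=> x y; have [xy|xy|->] := ltgtP x y; last by rewrite !subrr normr0 mulr0.
    by rewrite distrC [in X in _ <= X]distrC K.
  exact: K.
move=> xy.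
have cf : {within `[x, y], continuous f}.
  by apply: continuous_subspaceT; exact: is_derive_continuous H.
have [c _ ->] := MVT xy (fun z _ => H z) cf.
by rewrite normrM ler_wpM2r.
Qed.

Lemma taylor2 f df M : (forall x, is_derive x 1 f (df x)) ->
  (forall x y, `|df x - df y| <= M * `|x - y|) ->
  forall x h, `|f (x + h) - f x - df x * h| <= M * h ^+ 2.
Proof.
move=> H HM x h.
have cf a b : {within `[a, b], continuous f}.
  by apply: continuous_subspaceT; exact: is_derive_continuous H.
have M0 : 0 <= M.
  by have := le_trans (normr_ge0 _) (HM 1 0); rewrite subr0 normr1 mulr1.
suff [c [cx ->]] : exists c, `|c - x| <= `|h| /\ f (x + h) - f x = df c * h.
  rewrite -mulrBl normrM -real_normK ?num_real// expr2 mulrA ler_wpM2r//.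
  by rewrite (le_trans (HM _ _))// ler_wpM2l.
have [h0|h0|->] := ltgtP h 0.
- have xh : x + h < x by lra.
  have [c] := MVT xh (fun z _ => H z) (cf _ _).
  rewrite in_itv/= => /andP[c1 c2] E; exists c; split.
    by rewrite ltr0_norm ?subr_lt0// ltr0_norm//; lra.
  by rewrite -opprB E; ring.
- have xh : x < x + h by lra.
  have [c] := MVT xh (fun z _ => H z) (cf _ _).
  rewrite in_itv/= => /andP[c1 c2] E; exists c; split.
    by rewrite gtr0_norm ?subr_gt0// gtr0_norm//; lra.
  by rewrite E; ring.
- by exists x; rewrite addr0 !subrr normr0 mulr0.
Qed.

Lemma continuous_bounded_out f d : continuous f ->
  (forall x, d <= `|x| -> f x = 0) -> exists M, 0 <= M /\ forall x, `|f x| <= M.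
Proof.
move=> cf f0.
have cK : compact (f @` `[-d, d]).
  apply: continuous_compact; last exact: segment_compact.
  exact: continuous_subspaceT.
have [M [_ HM]] := compact_bounded cK.
exists (Num.max (M + 1) 0); split; first by rewrite le_max lexx orbT.
move=> x; have [dx|xd] := leP d `|x|.
  by rewrite f0// normr0 le_max lexx orbT.
rewrite le_max; apply/orP; left; apply: (HM (M + 1)); first by rewrite ltrDl.
by exists x => //=; rewrite in_itv/= -ler_norml ltW.
Qed.

Lemma compact_support_R f d : (forall x, d <= `|x| -> f x = 0) -> compact_support f.
Proof.
move=> f0; apply: (@subclosed_compact _ _ `[-d, d]%classic).
- exact: closed_closure.
- exact: segment_compact.
- rewrite [X in _ `<=` X](closure_id _).1; last exact: itv_closed.
  apply: closureS => x/= fx; rewrite in_itv/= -ler_norml leNgt.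
  by apply: contra_neqN fx => /ltW; exact: f0.
Qed.

Lemma derive_out f d x : (forall y, d <= `|y| -> f y = 0) ->
  d < `|x| -> 'D_1 f x = 0.
Proof.
move=> f0 dx; suff : is_derive x 1 f 0 by case.
apply: (@near_eq_is_derive _ _ _ (cst 0)).
have : \forall y \near x, d < `|y|.
  by have := @norm_continuous _ _ x; move/cvgr_gt; exact.
by apply: filterS => y /ltW /f0 ->.
Qed.
End mean_value.

(** * Products of a function of time and a function of space as test functions *)

Section tensor.
Context {R : realType}.
Implicit Types (chi psi : R -> R).

Definition tensor chi psi (z : R * R) : R := chi z.1 * psi z.2.

Lemma tensorE chi psi : tensor chi psi = (chi \o fst) \* (psi \o snd).
Proof. by []. Qed.

Let fstP (h : R) (v a : R * R) : fst (h *: v + a) = h *: fst v + fst a.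
Proof. by []. Qed.
Let sndP (h : R) (v a : R * R) : snd (h *: v + a) = h *: snd v + snd a.
Proof. by []. Qed.
Let cfst : continuous (fst : R * R -> R). Proof. by move=> x; exact: cvg_fst. Qed.
Let csnd : continuous (snd : R * R -> R). Proof. by move=> x; exact: cvg_snd. Qed.

Lemma Cn_tensor n chi psi : Cn n chi -> Cn n psi -> Cn n (tensor chi psi).
Proof.
move=> Cc Cp; rewrite tensorE; apply: CnM.
- exact: (Cn_affine fstP cfst).
- exact: (Cn_affine sndP csnd).
Qed.

Lemma derive_tensor chi psi z v : Cn 1 chi -> Cn 1 psi ->
  'D_v (tensor chi psi) z =
  v.1 * 'D_1 chi z.1 * psi z.2 + v.2 * chi z.1 * 'D_1 psi z.2.
Proof.
move=> Cc Cp; rewrite tensorE.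
have dc := is_derive_dir v.1 (Cn_is_derive z.1 Cc).
have dp := is_derive_dir v.2 (Cn_is_derive z.2 Cp).
have d1 : is_derive z v (chi \o fst) (v.1 * 'D_1 chi z.1).
  split; first by apply: (derivable_affine fstP); case: dc.
  by rewrite (derive_affine fstP); case: dc.
have d2 : is_derive z v (psi \o snd) (v.2 * 'D_1 psi z.2).
  split; first by apply: (derivable_affine sndP); case: dp.
  by rewrite (derive_affine sndP); case: dp.
have [_ ->] := is_deriveM d1 d2.
by rewrite /GRing.scale/=; ring.
Qed.

Lemma closure_le_tensor chi psi a b :
  (forall t, ~~ (a <= t <= b) -> chi t = 0) ->
  closure [set z | tensor chi psi z != 0] `<=` [set z | a <= z.1 <= b].
Proof.
move=> H; rewrite [X in _ `<=` X](closure_id _).1.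
  apply: closureS => -[t x]/=; rewrite /tensor/=; apply: contra_neqT => /H ->.
  by rewrite mul0r.
rewrite (_ : [set _ | _] = fst @^-1` `[a, b]%classic); last first.
  by apply/seteqP; split => z/=; rewrite in_itv.
by apply: preimage_closed; [move=> x _; exact: cfst|exact: itv_closed].
Qed.

Lemma compact_support_tensor chi psi a b d :
  (forall t, ~~ (a <= t <= b) -> chi t = 0) ->
  (forall x, d <= `|x| -> psi x = 0) ->
  compact_support (tensor chi psi).
Proof.
move=> H1 H2.
apply: (@subclosed_compact _ _ (`[a, b]%classic `*` `[-d, d]%classic)).
- exact: closed_closure.
- by apply: compact_setX; exact: segment_compact.
- rewrite [X in _ `<=` X](closure_id _).1; last first.
    apply: closedI.
      by apply: preimage_closed; [move=> x _; exact: cfst|exact: itv_closed].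
    by apply: preimage_closed; [move=> x _; exact: csnd|exact: itv_closed].
  apply: closureS => -[t x]/= tx; split => /=; rewrite in_itv/=.
    by move: tx; apply: contra_neqT => /H1; rewrite /tensor/= => ->; rewrite mul0r.
  rewrite -ler_norml leNgt; move: tx; apply: contra_neqN => /ltW/H2.
  by rewrite /tensor/= => ->; rewrite mulr0.
Qed.

Lemma test_function_tensor T chi psi a b d :
  (forall n, Cn n chi) -> (forall n, Cn n psi) ->
  (forall t, ~~ (a <= t <= b) -> chi t = 0) -> b < T ->
  (forall x, d <= `|x| -> psi x = 0) ->
  (forall t, 0 <= chi t) -> (forall x, 0 <= psi x) ->
  test_function T (tensor chi psi).
Proof.
move=> Cc Cp H1 bT H2 c0 p0; split => [n|||z _].
- exact: Cn_tensor.
- exact: compact_support_tensor H1 H2.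
- apply: subset_trans (closure_le_tensor H1) _ => z/= /andP[_ zb].
  exact: le_lt_trans bT.
- exact: mulr_ge0.
Qed.
End tensor.

(** * Total variation and translations *)

Section TV_shift.
Context {R : realType}.
Local Notation TR := (measurableTypeR R).
Local Notation leb := (@lebesgue_measure R).
Implicit Types (u w psi g : R -> R) (h d K : R).

Lemma continuous_mfun g : continuous g -> measurable_fun [set: TR] g.
Proof. exact: continuous_measurable_fun. Qed.

Lemma integrable_out g d : continuous g -> (forall x, d <= `|x| -> g x = 0) ->
  leb.-integrable setT (EFin \o g).
Proof.
move=> cg g0.
have H : leb.-integrable `[-d, d] (EFin \o g).
  apply: continuous_compact_integrable; first exact: segment_compact.
  exact: continuous_subspaceT.
have E : g \_ `[-d, d] = g.
  apply/funext => x; rewrite patchE; case: ifPn => //.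
  by rewrite notin_setE/= in_itv/= => /negP; rewrite -ler_norml -ltNge => /ltW/g0.
move/integrable_mkcond : H; rewrite restrict_EFin E; apply.
exact: measurable_itv.
Qed.

Lemma integrableM_bounded w g K : leb.-integrable setT (EFin \o w) ->
  measurable_fun [set: TR] g -> (forall x, `|g x| <= K) ->
  leb.-integrable setT (EFin \o (fun x => w x * g x)).
Proof.
move=> iw mg gK.
apply: (@integrable_bound _ _ _ _ _ (fun x : TR => K * `|w x|)).
- by apply: measurable_funM => //; exact: integrable_measurable iw.
- by apply: integrable_scale; exact: integrable_nrm.
- by move=> x; rewrite normrM mulrC ler_wpM2r.
Qed.

Lemma tentP n (c : R -> R := fun x : R => Num.max 0 (Num.min 1 (n.+1%:R - `|x|))) :
  [/\ continuous c, forall x, 0 <= c x, forall x, c x <= 1 &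
      forall x, n.+1%:R <= `|x| -> c x = 0].
Proof.
split.
- move=> x; apply: (@continuous_max _ _ (cst 0) (fun x : R => Num.min 1 (n.+1%:R - `|x|))); first exact: cst_continuous.
  apply: (@continuous_min _ _ (cst 1) (fun x : R => n.+1%:R - `|x|)); first exact: cst_continuous.
  apply: continuousB; first exact: cst_continuous.
  exact: norm_continuous.
- by move=> x; rewrite le_max lexx.
- by move=> x; rewrite ge_max ler01/= ge_min lexx.
- by move=> x xn; apply/max_idPl; rewrite ge_min; apply/orP; right; rewrite subr_le0.
Qed.

Lemma tent_limit (w : R -> R) : leb.-integrable setT (EFin \o w) ->
  \int[leb]_x (Num.max 0 (Num.min 1 (n.+1%:R - `|x|)) * `|w x|) @[n --> \oo] -->
  \int[leb]_x `|w x|.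
Proof.
move=> iw; apply: (@Rint_dominated _ _ _ _ _ _ (fun x : TR => `|w x|)).
- move=> n; apply: measurable_funM; last first.
    by apply: measurableT_comp => //; exact: integrable_measurable iw.
  by apply: continuous_mfun; case: (tentP n).
- move=> x; apply: cvg_near_cst; near=> n.
  have nx : `|x| <= n%:R by near: n; exact: nbhs_infty_ger.
  have /min_idPl -> : 1 <= n.+1%:R - `|x| by rewrite lerBrDr -natr1 addrC lerD2r.
  by have /max_idPr -> : (0 : R) <= 1 by []; rewrite mul1r.
- exact: integrable_nrm.
- move=> n x; rewrite normrM normr_id ler_piMl//.
  by rewrite ger0_norm ?le_max ?lexx// ge_max ler01/= ge_min lexx.
Unshelve. all: by end_near. Qed.

(* By density it suffices to test against g / (|g| + e) for a continuous g close
   to w, times a cut-off. *)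
Lemma L1_dual w K : leb.-integrable setT (EFin \o w) ->
  (forall psi d, continuous psi -> (forall x, d <= `|x| -> psi x = 0) ->
    (forall x, `|psi x| <= 1) -> \int[leb]_x (w x * psi x) <= K) ->
  \int[leb]_x `|w x| <= K.
Proof.
move=> iw H.
have mw := integrable_measurable iw.
suff key n : \int[leb]_x (Num.max 0 (Num.min 1 (n.+1%:R - `|x|)) * `|w x|) <= K.
  have := tent_limit iw; move/ler_cvg_to; apply; first exact: cvg_cst.
  by near=> n; exact: key.
have [cc c0 c1 cout] := tentP n.
set c : R -> R := fun x => Num.max 0 (Num.min 1 (n.+1%:R - `|x|)).
pose E := `[- n.+1%:R, n.+1%:R]%classic : set R.
have mE : measurable (E : set TR) by exact: measurable_itv.
have iwE : leb.-integrable E (EFin \o w) by apply: integrableS iw.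
have EE : leb E = (2 * n.+1%:R)%:E.
  rewrite lebesgue_measure_itv/= lte_fin ifT; last by rewrite gtrN// ltr0n.
  by rewrite -EFinD; congr EFin; ring.
have Efin : (leb E < +oo)%E by rewrite EE ltry.
apply/ler_addgt0Pr => e e0.
have [g_ [cg ig Hg]] := approximation_continuous_integrable mE Efin iwE.
(* The interval [E] has length 2(n+1); this choice makes the total error 2 e1 + e1 |E| equal to
   e. *)
pose e1 := e / (2 * n.+1%:R + 2).
have n0 : 0 < 2 * n.+1%:R + 2 :> R by rewrite ltr_wpDl.
have e10 : 0 < e1 by rewrite divr_gt0.
have [m Hm] : exists m, (\int[leb]_(z in E) `|(w z - g_ m z)%:E| <= e1%:E)%E.
  have [m _ Hm] : \forall n \near \oo, (\int[leb]_(z in E) `|(w z - g_ n z)%:E| <= e1%:E)%E.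
    move/fine_cvgP : Hg => [Hf Hg]; move/cvgr_le : Hg => /(_ _ e10) Hg.
    near=> k; rewrite -[X in (X <= _)%E]fineK; last by near: k.
    by rewrite lee_fin; near: k.
  by exists m; apply: Hm => /=.
set g := g_ m in Hm.
(* A continuous regularisation of the sign of [g], multiplied by the tent [c] to make its support
   compact. *)
pose psi x := c x * (g x / (`|g x| + e1)).
have ge1 x : 0 < `|g x| + e1 by rewrite ltr_wpDl.
have psi1 x : `|psi x| <= 1.
  have h : `|g x / (`|g x| + e1)| <= 1.
    rewrite normrM [X in _ * X]ger0_norm ?invr_ge0; last exact: ltW.
    by rewrite ltW// ltr_pdivrMr// mul1r ltrDl.
  by rewrite /psi normrM mulr_ile1// ger0_norm ?c0 ?c1//; exact: c1.
have cpsi : continuous psi.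
  move=> x; apply: continuousM; first exact: cc.
  apply: continuousM; first exact: cg.
  apply: continuousV; first by rewrite gt_eqF.
  apply: continuousD; last exact: cst_continuous.
  by apply: continuous_comp; [exact: cg|exact: norm_continuous].
have psio x : n.+1%:R <= `|x| -> psi x = 0 by move=> /cout; rewrite /psi/c => ->; rewrite mul0r.
have := H psi _ cpsi psio psi1.
have i1 : leb.-integrable setT (EFin \o (fun x => w x * psi x)).
  by apply: integrableM_bounded psi1 => //; exact: continuous_mfun.
have iwg : leb.-integrable E (EFin \o (fun x => `|w x - g x|)).
  apply/integrableP; split.
    apply/measurable_EFinP; apply: measurable_funTS; apply: measurableT_comp => //.
    by apply: measurable_funB => //; apply: continuous_mfun; exact: cg.
  under eq_integral do rewrite /= normr_id.
  exact: le_lt_trans Hm (ltry _).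
(* Pointwise error on [E]: replacing w by g costs |w - g| twice, once in |w| and once in the product
   with the regularised sign, and |g| - g^2 / (|g| + e1) <= e1. *)
pose r x := (2 * `|w x - g x| + e1).
have i2 : leb.-integrable E (EFin \o (fun x => 2 * `|w x - g x|)).
  by have := integrableZl mE 2 iwg.
have i3 : leb.-integrable E (EFin \o (fun=> e1)).
  apply: (@continuous_compact_integrable _ (cst e1)); first exact: segment_compact.
  by apply: continuous_subspaceT => x; exact: cst_continuous.
have ir : leb.-integrable E (EFin \o r) by have := integrableD mE i2 i3.
have ir' : leb.-integrable setT (EFin \o (r \_ E)).
  by rewrite -restrict_EFin; apply/(integrable_mkcond _ _).1.
have rle : \int[leb]_x (r \_ E) x <= e.
  have R1 : \int[leb]_(x in E) e1 = e1 * (2 * n.+1%:R).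
    by rewrite Rintegral_cst//; congr (_ * _); move/(congr1 fine) : EE.
  rewrite -Rintegral_mkcond RintegralD// RintegralZl// R1.
  have : \int[leb]_(x in E) `|w x - g x| <= e1.
    by rewrite -lee_fin /Rintegral fineK//; exact: integrable_fin_num iwg.
  rewrite /e1; have := @ler0n R n.+1; set N := n.+1%:R => N0 h.
  rewrite [leRHS](_ : _ = 2 * (e / (2 * N + 2)) + e / (2 * N + 2) * (2 * N)).
    by rewrite lerD2r ler_wpM2l.
  by field; rewrite gt_eqF.
move=> HK; apply: (@le_trans _ _ (\int[leb]_x (w x * psi x + (r \_ E) x))).
  apply: Rint_le.
  - rewrite (_ : EFin \o _ = EFin \o (fun x => `|w x| * c x)); last first.
      by apply/funext => x /=; rewrite mulrC.
    apply: (@integrableM_bounded _ _ 1); first exact: integrable_nrm.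
      exact: continuous_mfun.
    by move=> x; rewrite /c ger0_norm; [exact: c1|exact: c0].
  - exact: integrable_add.
  - move=> x; rewrite -/(c x); have [xE|xE] := boolP (x \in E); last first.
      have xn : n.+1%:R <= `|x|.
        move: xE; rewrite notin_setE /E/= in_itv/= -ler_norml => /negP.
        by rewrite -ltNge => /ltW.
      by rewrite {1}/c cout ?mul0r// psio// mulr0 add0r patchE ifN.
    rewrite patchE xE /r.
    have c0' : 0 <= c x := c0 x. have c1' : c x <= 1 := c1 x.
    have -> : w x * psi x = c x * (w x * (g x / (`|g x| + e1))).
      by rewrite /psi; ring.
    suff : `|w x| <= w x * (g x / (`|g x| + e1)) + (2 * `|w x - g x| + e1).
      move=> h; apply: le_trans (ler_wpM2l c0' h) _.
      by rewrite mulrDr lerD2l ler_piMl// addr_ge0 ?mulr_ge0// ltW.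
    have gg : `|g x| - e1 <= g x * (g x / (`|g x| + e1)).
      rewrite mulrA ler_pdivlMr// -expr2 -real_normK ?num_real//.
      by rewrite -subr_sqr lerBlDr lerDl sqr_ge0.
    have wg : - `|w x - g x| <= (w x - g x) * (g x / (`|g x| + e1)).
      rewrite lerNl (le_trans (ler_norm _))// normrN normrM ler_piMr//.
      rewrite normrM [X in _ * X]ger0_norm ?invr_ge0; last exact: ltW.
      by rewrite ltW// ltr_pdivrMr// mul1r ltrDl.
    have : `|w x| <= `|w x - g x| + `|g x| by rewrite -lerBlDr; exact: lerB_dist.
    have : w x * (g x / (`|g x| + e1)) = (w x - g x) * (g x / (`|g x| + e1)) +
       g x * (g x / (`|g x| + e1)) by ring.
    lra.
by rewrite RintegralD// lerD.
Unshelve. all: by end_near. Qed.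

Lemma primitive g d : continuous g -> (forall x, d <= `|x| -> g x = 0) ->
  exists G : R -> R, forall x : R, is_derive x 1 G (g x).
Proof.
move=> cg g0; have ig := integrable_out cg g0.
exists (fun x => \int[leb]_(t in `]-oo, x]) g t) => x.
have x1 : x < x + 1 by rewrite ltrDl.
have ig1 : leb.-integrable `]-oo, (x + 1)] (EFin \o g) by apply: integrableS ig.
have := @continuous_FTC1 R g -oo%O x (x + 1) x1 ig1.
move=> /= /(_ _ (cg x)) []; first exact: ltNyr.
move=> dG dGE.
by rewrite derive1E in dGE; exact: DeriveDef dG dGE.
Qed.

Lemma MVT_between (G g : R -> R) x h : (forall x : R, is_derive x 1 G (g x)) ->
  exists c, `|c - x| <= `|h| /\ G x - G (x - h) = g c * h.
Proof.
move=> H.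
have cf a b : {within `[a, b], continuous G}.
  by apply: continuous_subspaceT; exact: is_derive_continuous H.
have [h0|h0|->] := ltgtP h 0.
- have xh : x < x - h by lra.
  have [c] := MVT xh (fun z _ => H z) (cf _ _).
  rewrite in_itv/= => /andP[c1 c2] E; exists c; split.
    by rewrite gtr0_norm ?subr_gt0// ltr0_norm//; lra.
  by rewrite -opprB E; ring.
- have xh : x - h < x by lra.
  have [c] := MVT xh (fun z _ => H z) (cf _ _).
  rewrite in_itv/= => /andP[c1 c2] E; exists c; split.
    by rewrite ltr0_norm ?subr_lt0// gtr0_norm//; lra.
  by rewrite E; ring.
- by exists x; rewrite subr0 !subrr normr0 mulr0.
Qed.

(** By duality with test functions psi bounded by 1. Up to sign, [phi] is the mean of psi over the
    interval between x - h and x, so it is C^1 with compact support and |phi| <= 1, hence admissible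
    in [TV]; moving the translation from u to psi turns the integral of (u(x + h) - u(x)) psi into
    |h| times that of u phi'. *)
Lemma TV_shift u (b : R) h : leb.-integrable setT (EFin \o u) -> (TV u <= b%:E)%E ->
  \int[leb]_x `|u (x + h) - u x| <= b * `|h|.
Proof.
move=> iu TVu; have [->|h0] := eqVneq h 0.
  under eq_Rintegral do rewrite addr0 subrr normr0.
  by rewrite normr0 mulr0 Rintegral_cst// mul0r.
have [iuh _] := Rint_shift h iu.
apply: L1_dual => [|psi d cp p0 p1]; first exact: integrable_sub.
have [G dG] := primitive cp p0.
pose phi (x : R) : R := - `|h|^-1 * (G x - G (x - h)).
have mvt x := MVT_between x h dG.
have dphi (x : R) : is_derive x 1 phi (- `|h|^-1 * (psi x - psi (x - h))).
  have dGh : is_derive x 1 (fun y => G (y - h)) (psi (x - h)).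
    have := @is_derive1_comp _ G (fun y => y - h) x (psi (x - h)) 1 (dG _).
    rewrite mulr1; apply.
    exact: is_derive_shift.
  have := is_deriveZ (- `|h|^-1) (is_deriveB (dG x) dGh).
  by [].
have cphi : continuous (fun x => - `|h|^-1 * (psi x - psi (x - h))).
  move=> x; apply: (@continuousM _ _ (cst (- `|h|^-1)) (fun x : R => psi x - psi (x - h))).
    exact: cst_continuous.
  apply: (@continuousB _ _ _ psi (fun x => psi (x - h))); first exact: cp.
  apply: (@continuous_comp _ _ _ (fun y : R => y - h) psi); last exact: cp.
  by apply: continuousB; [exact: id|exact: cst_continuous].
have E : \int[leb]_x ((u (x + h) - u x) * psi x) =
    `|h| * \int[leb]_x (u x * derive1 phi x).
  have mp : measurable_fun [set: TR] psi by exact: continuous_mfun.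
  have i1 : leb.-integrable setT (EFin \o (fun x => u x * psi x)).
    exact: integrableM_bounded p1.
  have mph : measurable_fun [set: TR] (fun x : TR => psi (x - h)).
    by apply: (measurableT_comp mp); exact: measurable_shift.
  have i2 : leb.-integrable setT (EFin \o (fun x => u x * psi (x - h))).
    by apply: (@integrableM_bounded _ _ 1) => //.
  have [i3 E3] := Rint_shift h i2.
  rewrite -RintegralZl//; last first.
    have := integrable_scale (- `|h|^-1) (integrable_sub i1 i2).
    apply: eq_integrable => // x _ /=.
    by congr EFin; rewrite derive1E; have [_ ->] := dphi x; ring.
  transitivity (\int[leb]_x (u (x + h) * psi (x + h - h) - u x * psi x)).
    by apply: eq_Rintegral => x _; rewrite addrK; ring.
  rewrite RintegralB// E3 -RintegralB//.
  apply: eq_Rintegral => x _; rewrite derive1E; have [_ ->] := dphi x.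
  by field; rewrite normr_eq0.
rewrite E mulrC ler_wpM2r// -lee_fin (le_trans _ TVu)//.
apply: ereal_sup_ubound; exists phi => //; split.
- exact: (CnS_R (n := 0) dphi).
- apply: (@compact_support_R _ _ (`|d| + `|h|)) => x dx.
  rewrite /phi; have [c [cx ->]] := mvt x; rewrite p0 ?mul0r ?mulr0//.
  have : `|x| <= `|c - x| + `|c| by rewrite distrC -lerBlDr; exact: lerB_dist.
  have := ler_norm d; lra.
- move=> x; rewrite /phi; have [c [cx ->]] := mvt x.
  rewrite !normrM normrN normfV normr_id mulrC -mulrA mulfV ?normr_eq0// mulr1.
  exact: p1.
Qed.
End TV_shift.

(** * Doubling of variables *)

Section kruzkov_flux.
Context {R : realType}.
Variables (f : R -> R) (L : R).
Hypothesis fL : forall x y, `|f x - f y| <= L * `|x - y|.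
Implicit Types a b c : R.

Definition kflux a c : R := Num.sg (a - c) * (f a - f c).

Lemma kflux_le a c : `|kflux a c| <= L * `|a - c|.
Proof.
rewrite /kflux normrM; apply: le_trans (fL a c).
by rewrite ler_piMl// normr_sg; case: (_ != 0).
Qed.

(** The sign jumps only at a = c, where the flux vanishes. If c separates a and b, then |f a - f c|
    + |f b - f c| <= L (|a - c| + |c - b|) = L |a - b|. *)
Lemma kflux_lip a b c : `|kflux a c - kflux b c| <= L * `|a - b|.
Proof.
rewrite /kflux.
have L0 : 0 <= L by have := le_trans (normr_ge0 _) (fL 1 0); rewrite subr0 normr1 mulr1.
have [ac|ac|->] := ltgtP a c; have [bc|bc|->] := ltgtP b c;
  rewrite ?subrr ?mulr0 ?subr0 ?sub0r ?normr0 ?(mulr_ge0 L0)//.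
- rewrite !ltr0_sg ?subr_lt0// !mulN1r -opprD normrN.
  by rewrite (_ : f a - f c - (f b - f c) = f a - f b) ?fL//; ring.
- rewrite ltr0_sg ?subr_lt0// gtr0_sg ?subr_gt0// mulN1r mul1r.
  have := fL a c; have := fL b c.
  rewrite [`|a - c|]ltr0_norm ?subr_lt0// [`|b - c|]gtr0_norm ?subr_gt0//.
  rewrite [`|a - b|]ltr0_norm ?subr_lt0 ?(lt_trans ac)// => h1 h2.
  apply: le_trans (ler_normB _ _) _; rewrite normrN.
  by apply: le_trans (lerD h2 h1) _; lra.
- rewrite ltr0_sg ?subr_lt0// mulN1r normrN; exact: fL.
- rewrite gtr0_sg ?subr_gt0// ltr0_sg ?subr_lt0// mulN1r mul1r.
  have := fL a c; have := fL b c.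
  rewrite [`|a - c|]gtr0_norm ?subr_gt0// [`|b - c|]ltr0_norm ?subr_lt0//.
  rewrite [`|a - b|]gtr0_norm ?subr_gt0 ?(lt_trans bc)// => h1 h2.
  apply: le_trans (ler_normB _ _) _; rewrite normrN.
  by apply: le_trans (lerD h2 h1) _; lra.
- rewrite !gtr0_sg ?subr_gt0// !mul1r.
  by rewrite (_ : f a - f c - (f b - f c) = f a - f b) ?fL//; ring.
- rewrite gtr0_sg ?subr_gt0// mul1r; exact: fL.
- by rewrite ltr0_sg ?subr_lt0// mulN1r opprK [in leRHS]distrC fL.
- by rewrite gtr0_sg ?subr_gt0// mul1r normrN [in leRHS]distrC fL.
Qed.
End kruzkov_flux.

Section measurability.
Context {R : realType} d (T : measurableType d).

Lemma measurable_sg : measurable_fun setT (Num.sg : R -> R).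
Proof.
apply: nondecreasing_measurable => // x y xy.
have [x0|x0|x0] := ltgtP x 0; have [y0|y0|y0] := ltgtP y 0;
  rewrite ?x0 ?y0 ?sgr0 ?(ltr0_sg x0) ?(gtr0_sg x0) ?(ltr0_sg y0) ?(gtr0_sg y0)//;
  try lra.
Qed.

Lemma lipschitz_continuous (f : R -> R) L : (forall x y, `|f x - f y| <= L * `|x - y|) ->
  continuous f.
Proof.
move=> fL x; apply/cvgrPdist_le => e e0; near=> y.
apply: le_trans (fL _ _) _.
have : `|x - y| <= e / (`|L| + 1).
  by near: y; apply: cvgr_dist_le; [exact: cvg_id|rewrite divr_gt0// ltr_wpDl].
rewrite ler_pdivlMr ?ltr_wpDl// => h; apply: le_trans h.
by rewrite mulrC ler_wpM2l// (le_trans (ler_norm L))// lerDl.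
Unshelve. all: by end_near. Qed.
End measurability.

Section product_taylor.
Context {R : realType}.

(** Second-order expansion of x -> (A x - c) w(x - y), with [A'] and [w'] only Lipschitz. The
    constant 4 collects M K from the remainder of A, M K from the cross term, and 2 M K from the
    remainder of w multiplied by |A x - c| <= 2 M. *)
Lemma product_taylor (A A' w w' : R -> R) (M K c x y h : R) :
  (forall x : R, is_derive x 1 A (A' x)) -> (forall x, `|A' x| <= M) ->
  (forall x y, `|A' x - A' y| <= M * `|x - y|) -> (forall x, `|A x - c| <= 2 * M) ->
  (forall x : R, is_derive x 1 w (w' x)) -> (forall x, `|w x| <= K) -> (forall x, `|w' x| <= K) ->
  (forall x y, `|w' x - w' y| <= K * `|x - y|) ->
  `|(A (x + h) - c) * w (x + h - y) - (A x - c) * w (x - y)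
     - ((A x - c) * w' (x - y) + A' x * w (x - y)) * h| <= 4 * M * K * h ^+ 2.
Proof.
move=> dA A'M A'L AM dw wK w'K w'L.
have M0 : 0 <= M := le_trans (normr_ge0 _) (A'M 0).
have K0 : 0 <= K := le_trans (normr_ge0 _) (wK 0).
have r1 := taylor2 dA A'L x h.
have r2 := taylor2 dw w'L (x - y) h.
have r3 := MVT_le dw w'K (x - y + h) (x - y).
have e1 : x + h - y = x - y + h by ring.
rewrite e1.
rewrite (_ : _ - _ = (A (x + h) - A x - A' x * h) * w (x - y + h)
  + (A' x * h) * (w (x - y + h) - w (x - y))
  + (A x - c) * (w (x - y + h) - w (x - y) - w' (x - y) * h)); last by ring.
apply: le_trans (ler_normD _ _) _.
have s1 : `|(A (x + h) - A x - A' x * h) * w (x - y + h)| <= M * h ^+ 2 * K.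
  by rewrite normrM ler_pM.
have s2 : `|A' x * h * (w (x - y + h) - w (x - y))| <= M * K * h ^+ 2.
  rewrite !normrM.
  have -> : M * K * h ^+ 2 = M * `|h| * (K * `|h|).
    by rewrite -real_normK ?num_real//; ring.
  rewrite ler_pM ?mulr_ge0// ?ler_wpM2r//.
  by apply: le_trans r3 _; rewrite ler_wpM2l// (_ : _ - _ = h)//; ring.
have s3 : `|(A x - c) * (w (x - y + h) - w (x - y) - w' (x - y) * h)| <= 2 * M * (K * h ^+ 2).
  by rewrite normrM ler_pM.
have := ler_normD ((A (x + h) - A x - A' x * h) * w (x - y + h)) (A' x * h * (w (x - y + h) - w (x - y))).
by lra.
Qed.
End product_taylor.

Section tents.
Context {R : realType}.
Local Notation TR := (measurableTypeR R).
Local Notation leb := (@lebesgue_measure R).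

Definition tent n (x : R) : R := Num.max 0 (Num.min 1 (n.+1%:R - `|x|)).

Lemma tentN n x : tent n (- x) = tent n x.
Proof. by rewrite /tent normrN. Qed.

Lemma tent_ge0 n x : 0 <= tent n x.
Proof. by case: (@tentP R n) => _ h _ _; exact: h. Qed.

Lemma tent_le1 n x : tent n x <= 1.
Proof. by case: (@tentP R n) => _ _ h _; exact: h. Qed.

Lemma tent1 n x : `|x| <= n%:R -> tent n x = 1.
Proof.
move=> xn; rewrite /tent.
have /min_idPl -> : 1 <= n.+1%:R - `|x| by rewrite lerBrDr -natr1 addrC lerD2r.
by have /max_idPr -> : (0 : R) <= 1.
Qed.

Lemma normr_tent n x : `|tent n x| <= tent n x.
Proof. by rewrite ger0_norm// tent_ge0. Qed.

Lemma measurable_tent n : measurable_fun [set: TR] (tent n).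
Proof. by apply: continuous_mfun; case: (@tentP R n). Qed.

Lemma integrable_tent n : leb.-integrable setT (EFin \o tent n).
Proof. by case: (@tentP R n) => c _ _ o; exact: integrable_out c o. Qed.

Lemma le_tent n (g : R -> R) K d x : 0 <= K -> (forall x, `|g x| <= K) ->
  (forall x, d <= `|x| -> g x = 0) -> d <= n%:R -> `|g x| <= K * tent n x.
Proof.
move=> K0 gK g0 dn; have [xd|dx] := leP `|x| d.
  by rewrite tent1 ?mulr1// (le_trans xd).
by rewrite g0; [rewrite normr0 mulr_ge0// tent_ge0|exact: ltW].
Qed.
End tents.

Section moll_bounds.
Context {R : realType}.

Lemma moll_bounds (d : R) : exists K, [/\ 0 <= K, forall x, `|moll d x| <= K,
  forall x, `|'D_1 (moll d) x| <= K &
  forall x y, `|'D_1 (moll d) x - 'D_1 (moll d) y| <= K * `|x - y|].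
Proof.
have C n := Cn_moll d n.
have o0 x : d + 2 <= `|x| -> moll d x = 0 by move=> h; apply: moll_out; lra.
have o1' x : d < `|x| -> 'D_1 (moll d) x = 0.
  by move=> h; apply: (derive_out _ h) => y; exact: moll_out.
have o1 x : d + 1 <= `|x| -> 'D_1 (moll d) x = 0 by move=> h; apply: o1'; lra.
have o2 x : d + 2 <= `|x| -> 'D_1 ('D_1 (moll d)) x = 0.
  by move=> h; apply: (derive_out o1); lra.
have [[c0 _ _] [_ _ C1]] := (C 1, C 2).
have [K0 [K0p H0]] := continuous_bounded_out c0 o0.
have [c1 _ _] := C1 1.
have [K1 [K1p H1]] := continuous_bounded_out c1 o1.
have [_ _ C2] := C1 1.
have [K2 [K2p H2]] := continuous_bounded_out (C2 1) o2.
exists (K0 + K1 + K2); split.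
- by rewrite !addr_ge0.
- by move=> x; apply: le_trans (H0 x) _; lra.
- by move=> x; apply: le_trans (H1 x) _; lra.
- move=> x y.
  have D2 (z : R) : is_derive z 1 ('D_1 (moll d)) ('D_1 ('D_1 (moll d)) z).
    exact: (Cn_is_derive (n := 0) z (C1 1)).
  apply: le_trans (MVT_le D2 H2 x y) _.
  by rewrite ler_wpM2r//; lra.
Qed.

Lemma moll_derive (d x : R) : is_derive x 1 (moll d) ('D_1 (moll d) x).
Proof. exact: Cn_is_derive (Cn_moll d 1). Qed.

Lemma moll_deriveN (d x : R) : 'D_1 (moll d) (- x) = - 'D_1 (moll d) x.
Proof.
have H1 := moll_derive d (- x).
have H2 : is_derive x 1 (moll d \o -%R) ('D_1 (moll d) (- x) * -1) by exact: is_derive1_comp.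
have E : moll d \o -%R = moll d by apply/funext => y /=; exact: mollN.
rewrite E in H2; have [_ ->] := H2; ring.
Qed.
End moll_bounds.

Section doubling.
Context {R : realType}.
Local Notation TR := (measurableTypeR R).
Local Notation leb := (@lebesgue_measure R).
Local Notation leb2 := (prodm leb leb).
Local Notation leb4 := (prodm leb2 leb2).
Local Notation T4 := ((TR * TR) * (TR * TR))%type.

(* The entropy inequality for a scalar equation with given coefficient A, where
   A' stands for its derivative in x, and with test functions vanishing for t
   outside a compact subset of (lo, hi). *)
Definition kruzkov (lo hi : R) (f : R -> R) (u A A' : R -> R -> R) : Prop :=
  forall (al : R) (chi psi : R -> R) c r d,
  (forall n, Cn n chi) -> (forall n, Cn n psi) ->
  (forall t, 0 <= chi t) -> (forall x, 0 <= psi x) ->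
  (forall t, ~~ (c <= t <= r) -> chi t = 0) -> lo < c -> r < hi ->
  (forall x, d <= `|x| -> psi x = 0) ->
  0 <= \int[leb2]_z (`|u z.1 z.2 - al| * 'D_1 chi z.1 * psi z.2
     + Num.sg (u z.1 z.2 - al) * A z.1 z.2 * (f (u z.1 z.2) - f al) * chi z.1 * 'D_1 psi z.2
     - f al * Num.sg (u z.1 z.2 - al) * A' z.1 z.2 * chi z.1 * psi z.2).

Definition l1path (m : R) (u : R -> R -> R) : Prop :=
  [/\ measurable_fun setT (fun z : TR * TR => u z.1 z.2),
      forall t, leb.-integrable setT (EFin \o u t) &
      forall t, \int[leb]_x `|u t x| <= m].

(** One constant serves for the sizes and the joint Lipschitz bounds. [M] only ever multiplies
    errors that vanish in a limit, so its value does not reach the final estimate. *)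
Definition coefficient (M : R) (A A' : R -> R -> R) : Prop :=
  [/\ measurable_fun setT (fun z : TR * TR => A z.1 z.2) /\
      measurable_fun setT (fun z : TR * TR => A' z.1 z.2),
      forall t x, `|A t x| <= M, forall t x, `|A' t x| <= M,
      (forall t s x y, `|A t x - A s y| <= M * (`|t - s| + `|x - y|)) /\
      (forall t s x y, `|A' t x - A' s y| <= M * (`|t - s| + `|x - y|)) &
      forall t x : R, is_derive x 1 (A t) (A' t x)].

Lemma weighted_l1path m u c C : l1path m u -> leb.-integrable setT (EFin \o c) ->
  (forall t, `|c t| <= C t) -> leb.-integrable setT (EFin \o C) ->
  leb2.-integrable setT (fun z => (c z.1 * `|u z.1 z.2|)%:E) /\
  \int[leb2]_z `|c z.1 * `|u z.1 z.2| | <= m * \int[leb]_t C t.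
Proof.
move=> [mu iu um] ic cC iC.
have m0 : 0 <= m by apply: le_trans (um 0); exact: Rintegral_ge0.
have mc := integrable_measurable ic.
have := @prod_bound1 _ _ TR TR R leb leb (fun z => c z.1 * `|u z.1 z.2|) (fun t => m * C t).
move=> [].
- apply: measurable_funM; first exact: measurableT_comp.
  exact: measurableT_comp.
- by move=> t /=; apply: (@integrable_scale _ TR R leb (c t)); exact: integrable_nrm.
- move=> t /=; under eq_Rintegral do rewrite normrM normr_id.
  rewrite RintegralZl//; last exact: integrable_nrm.
  by rewrite mulrC ler_pM//; exact: Rintegral_ge0.
- exact: integrable_scale.
- by move=> i1; rewrite RintegralZl.
Qed.

Section dom.
Variables (u v : R -> R -> R) (mu mv : R) (n : nat).
Hypotheses (pu : l1path mu u) (pv : l1path mv v).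

(* A common integrable majorant, up to constants, of the integrands in the four
   variables (t, x), (s, y). *)
Definition dom (Z : T4) : R :=
  (tent n Z.1.1 * `|u Z.1.1 Z.1.2|) * (tent n Z.2.1 * tent n (Z.1.2 - Z.2.2)) +
  (tent n Z.2.1 * `|v Z.2.1 Z.2.2|) * (tent n Z.1.1 * tent n (Z.1.2 - Z.2.2)).

Lemma domE Z : dom Z = tent n Z.1.1 * tent n Z.2.1 * tent n (Z.1.2 - Z.2.2) *
  (`|u Z.1.1 Z.1.2| + `|v Z.2.1 Z.2.2|).
Proof. by rewrite /dom; ring. Qed.

Lemma dom_ge0 Z : 0 <= dom Z.
Proof. by rewrite domE !mulr_ge0 ?tent_ge0// addr_ge0. Qed.

Let tu := weighted_l1path pu (integrable_tent n)
  (normr_tent n) (integrable_tent n).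
Let tv := weighted_l1path pv (integrable_tent n)
  (normr_tent n) (integrable_tent n).

Lemma dom_int : leb4.-integrable setT (EFin \o dom).
Proof.
have [i1 _] := weight1 tu.1 (integrable_tent n) (integrable_tent n) (@tentN R n).
have [i2 _] := weight2 tv.1 (integrable_tent n) (integrable_tent n) (@tentN R n).
exact: (integrable_add i1 i2).
Qed.

Lemma dom_sec1 z : leb2.-integrable setT (fun z' => (dom (z, z'))%:E).
Proof.
have [i1 _] := integrable_kernel z.2 (integrable_tent n) (integrable_tent n) (@tentN R n).
have i2 := integrable_scale (tent n z.1 * `|u z.1 z.2|) i1.
have i3 : leb2.-integrable setT (EFin \o (fun z' => tent n z'.1 * `|v z'.1 z'.2| *
    (tent n z.1 * tent n (z.2 - z'.2)))).
  apply: (@integrable_bound _ _ R leb2 _ (fun z' => tent n z'.1 * `|v z'.1 z'.2|)).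
  - have [mv' _ _] := pv; have mt := @measurable_tent R n.
    apply: measurable_funM; [apply: measurable_funM|apply: measurable_funM].
    + exact: measurableT_comp.
    + exact: measurableT_comp.
    + exact: measurable_cst.
    + apply: (measurableT_comp mt); apply: measurable_funB; first exact: measurable_cst.
      exact: measurable_snd.
  - exact: tv.1.
  - move=> z'; rewrite !normrM normr_id (ger0_norm (tent_ge0 _ _)).
    rewrite ler_piMr ?mulr_ge0 ?tent_ge0// !ger0_norm ?tent_ge0//.
    by rewrite mulr_ile1 ?tent_ge0 ?tent_le1.
exact: (integrable_add i2 i3).
Qed.

Lemma dom_sec2 z' : leb2.-integrable setT (fun z => (dom (z, z'))%:E).
Proof.
have [i1 _] := integrable_kernel z'.2 (integrable_tent n) (integrable_tent n) (@tentN R n).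
have i2 := integrable_scale (tent n z'.1 * `|v z'.1 z'.2|) i1.
have i3 : leb2.-integrable setT (EFin \o (fun z => tent n z.1 * `|u z.1 z.2| *
    (tent n z'.1 * tent n (z.2 - z'.2)))).
  apply: (@integrable_bound _ _ R leb2 _ (fun z => tent n z.1 * `|u z.1 z.2|)).
  - have [mu' _ _] := pu; have mt := @measurable_tent R n.
    apply: measurable_funM; [apply: measurable_funM|apply: measurable_funM].
    + exact: measurableT_comp.
    + exact: measurableT_comp.
    + exact: measurable_cst.
    + apply: (measurableT_comp mt); apply: measurable_funB; last exact: measurable_cst.
      exact: measurable_snd.
  - exact: tu.1.
  - move=> z; rewrite !normrM normr_id (ger0_norm (tent_ge0 _ _)).
    rewrite ler_piMr ?mulr_ge0 ?tent_ge0// !ger0_norm ?tent_ge0//.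
    by rewrite mulr_ile1 ?tent_ge0 ?tent_le1.
have E z : dom (z, z') = tent n z.1 * `|u z.1 z.2| * (tent n z'.1 * tent n (z.2 - z'.2)) +
    tent n z'.1 * `|v z'.1 z'.2| * (tent n z.1 * tent n (z'.2 - z.2)).
  by rewrite /dom/= -(tentN n (z.2 - z'.2)) opprB.
under eq_fun do rewrite E.
exact: (integrable_add i3 i2).
Qed.

(** The sections are included because the real-valued Fubini lemmas above ask for integrability of
    each of them. *)
Lemma dom_bound (G : T4 -> R) C : measurable_fun setT G -> (forall Z, `|G Z| <= C * dom Z) ->
  [/\ leb4.-integrable setT (EFin \o G),
      forall z, leb2.-integrable setT (fun z' => (G (z, z'))%:E) &
      forall z', leb2.-integrable setT (fun z => (G (z, z'))%:E)].
Proof.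
move=> mG GC; split.
- by apply: (@integrable_bound _ _ R leb4 _ (fun Z => C * dom Z)) => //; exact: (integrable_scale C dom_int).
- move=> z; apply: (@integrable_bound _ _ R leb2 (fun z' => G (z, z')) (fun z' => C * dom (z, z'))) => //.
  + exact: (measurable_fun_pair2 z mG).
  + exact: (integrable_scale C (dom_sec1 z)).
- move=> z; apply: (@integrable_bound _ _ R leb2 (fun z' => G (z', z)) (fun z' => C * dom (z', z))) => //.
  + exact: (measurable_fun_pair1 z mG).
  + exact: (integrable_scale C (dom_sec2 z)).
Qed.

Lemma dom_prod (al be ka : R -> R) (g : T4 -> R) a b k C :
  (forall t, `|al t| <= a * tent n t) -> (forall t, `|be t| <= b * tent n t) ->
  (forall t, `|ka t| <= k * tent n t) ->
  (forall Z, `|g Z| <= C * (`|u Z.1.1 Z.1.2| + `|v Z.2.1 Z.2.2|)) ->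
  forall Z, `|al Z.1.1 * be Z.2.1 * ka (Z.1.2 - Z.2.2) * g Z| <= a * b * k * C * dom Z.
Proof.
move=> ha hb hk hg Z; rewrite domE !normrM.
rewrite (_ : _ * (_ * _) = a * tent n Z.1.1 * (b * tent n Z.2.1) *
  (k * tent n (Z.1.2 - Z.2.2)) * (C * (`|u Z.1.1 Z.1.2| + `|v Z.2.1 Z.2.2|))); last by ring.
by rewrite !ler_pM// ?mulr_ge0.
Qed.
End dom.
End doubling.

Section translated_moll.
Context {R : realType}.
Local Notation TR := (measurableTypeR R).
Local Notation leb := (@lebesgue_measure R).
Implicit Types (d a c t x : R).

Lemma Cn_moll_shift n d a c : Cn n (fun t => c * moll d (t - a)).
Proof.
apply: CnZ; apply: (@Cn_affine _ _ _ (fun t : R => t - a) id).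
- by move=> h v b; rewrite addrA.
- by move=> x; apply: continuousB; [exact: id|exact: cst_continuous].
- exact: Cn_moll.
Qed.

Lemma moll_shift_derive d a c (t : R) :
  is_derive t 1 (fun t => c * moll d (t - a)) (c * 'D_1 (moll d) (t - a)).
Proof.
have H : is_derive t 1 (fun t => moll d (t - a)) ('D_1 (moll d) (t - a)).
  have := @is_derive1_comp _ (moll d) (fun y => y - a) t ('D_1 (moll d) (t - a)) 1.
  by rewrite mulr1; apply; [exact: moll_derive|exact: is_derive_shift].
exact: (is_deriveZ c H).
Qed.

Lemma moll_shift_out d a c t : 0 < d -> ~~ (a - d <= t <= a + d) -> c * moll d (t - a) = 0.
Proof.
move=> d0 h; rewrite moll_out ?mulr0//; rewrite leNgt; apply: contra h.
by rewrite ltr_norml => /andP[h1 h2]; apply/andP; split; lra.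
Qed.

Lemma moll_shift_int d a : 0 < d -> leb.-integrable setT (EFin \o (fun t => moll d (t - a))) /\
  \int[leb]_t moll d (t - a) = 1.
Proof.
move=> d0; have [i1 E] := Rint_shift (- a) (integrable_moll d).
by split=> //; rewrite E integral_moll.
Qed.

Lemma continuous_moll d : continuous (moll d).
Proof. exact: Cn_continuous (Cn_moll d 0). Qed.

Lemma continuous_dmoll d : continuous ('D_1 (moll d)).
Proof. by have [_ _ H] := Cn_moll d 1; exact: H. Qed.

Lemma measurable_moll d : measurable_fun [set: TR] (moll d).
Proof. by apply: continuous_mfun; exact: continuous_moll. Qed.

Lemma measurable_dmoll d : measurable_fun [set: TR] ('D_1 (moll d)).
Proof. by apply: continuous_mfun; exact: continuous_dmoll. Qed.
End translated_moll.

(** * The doubled entropy inequality *)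

Section kuznetsov.
Context {R : realType}.
Local Notation TR := (measurableTypeR R).
Local Notation leb := (@lebesgue_measure R).
Local Notation leb2 := (prodm leb leb).
Local Notation leb4 := (prodm leb2 leb2).
Local Notation T4 := ((TR * TR) * (TR * TR))%type.

Variables (f : R -> R) (L : R).
Hypothesis fL : forall x y, `|f x - f y| <= L * `|x - y|.
Hypothesis f0 : f 0 = 0.
Variables (u v A A' B B' : R -> R -> R) (mu mv bu k1 k2 M lo hi : R).
Hypotheses (pu : l1path mu u) (pv : l1path mv v) (tvu : forall t, (TV (u t) <= bu%:E)%E).
Hypotheses (cA : coefficient M A A') (cB : coefficient M B B').
Hypothesis hk1 : forall t x, `|A t x - B t x| <= k1.
Hypothesis hk2 : forall t x, `|A' t x - B' t x| <= k2.
Hypotheses (Ku : kruzkov lo hi f u A A') (Kv : kruzkov lo hi f v B B').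
Variables (d e : R) (n : nat).
Hypotheses (d0 : 0 < d) (e0 : 0 < e).
Hypothesis hn : `|lo| + `|hi| + d + e + 3 <= n%:R.

Let L0 : 0 <= L.
Proof. by have := le_trans (normr_ge0 _) (fL 1 0); rewrite subr0 normr1 mulr1. Qed.
Let M0 : 0 <= M.
Proof. by have [_ h _ _ _] := cA; exact: le_trans (normr_ge0 _) (h 0 0). Qed.
Let mu0 : 0 <= mu.
Proof. by have [_ _ h] := pu; apply: le_trans (h 0); exact: Rintegral_ge0. Qed.
Let bu0 : 0 <= bu.
Proof.
have [_ h _] := pu.
have := TV_shift 1 (h 0) (tvu 0); rewrite normr1 mulr1; apply: le_trans.
exact: Rintegral_ge0.
Qed.

Let U (Z : T4) : R := u Z.1.1 Z.1.2.
Let V (Z : T4) : R := v Z.2.1 Z.2.2.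
Let w (Z : T4) : R := moll e (Z.1.2 - Z.2.2).
Let w' (Z : T4) : R := 'D_1 (moll e) (Z.1.2 - Z.2.2).
Let t1 a (Z : T4) : R := moll d (Z.1.1 - a).
Let t2 a (Z : T4) : R := moll d (Z.2.1 - a).
Let dt1 a (Z : T4) : R := 'D_1 (moll d) (Z.1.1 - a).
Let dt2 a (Z : T4) : R := 'D_1 (moll d) (Z.2.1 - a).

Let m11 : measurable_fun [set: T4] (fun Z => Z.1.1).
Proof. exact: measurableT_comp. Qed.
Let m12 : measurable_fun [set: T4] (fun Z => Z.1.2).
Proof. exact: measurableT_comp. Qed.
Let m21 : measurable_fun [set: T4] (fun Z => Z.2.1).
Proof. exact: measurableT_comp. Qed.
Let m22 : measurable_fun [set: T4] (fun Z => Z.2.2).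
Proof. exact: measurableT_comp. Qed.

Let mcomp1 (g : R -> R -> R) : measurable_fun setT (fun z : TR * TR => g z.1 z.2) ->
  measurable_fun [set: T4] (fun Z => g Z.1.1 Z.1.2).
Proof. by move=> mg; exact: (measurableT_comp mg measurable_fst). Qed.
Let mcomp2 (g : R -> R -> R) : measurable_fun setT (fun z : TR * TR => g z.1 z.2) ->
  measurable_fun [set: T4] (fun Z => g Z.2.1 Z.2.2).
Proof. by move=> mg; exact: (measurableT_comp mg measurable_snd). Qed.

Let mU : measurable_fun setT U. Proof. by have [h _ _] := pu; exact: mcomp1 h. Qed.
Let mV : measurable_fun setT V. Proof. by have [h _ _] := pv; exact: mcomp2 h. Qed.
Let mA : measurable_fun [set: T4] (fun Z => A Z.1.1 Z.1.2).
Proof. by have [[h _] _ _ _ _] := cA; exact: mcomp1 h. Qed.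
Let mA' : measurable_fun [set: T4] (fun Z => A' Z.1.1 Z.1.2).
Proof. by have [[_ h] _ _ _ _] := cA; exact: mcomp1 h. Qed.
Let mB : measurable_fun [set: T4] (fun Z => B Z.2.1 Z.2.2).
Proof. by have [[h _] _ _ _ _] := cB; exact: mcomp2 h. Qed.
Let mB' : measurable_fun [set: T4] (fun Z => B' Z.2.1 Z.2.2).
Proof. by have [[_ h] _ _ _ _] := cB; exact: mcomp2 h. Qed.

Let mg1 (g : R -> R) (h : T4 -> R) : measurable_fun [set: TR] g -> measurable_fun setT h ->
  measurable_fun setT (fun Z => g (h Z)).
Proof. by move=> mg mh; exact: (measurableT_comp mg mh). Qed.

Let mw : measurable_fun setT w.
Proof. by apply: mg1; [exact: measurable_moll|exact: measurable_funB]. Qed.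
Let mw' : measurable_fun setT w'.
Proof. by apply: (@mg1 ('D_1 (moll e))); [exact: measurable_dmoll|exact: measurable_funB]. Qed.
Let mt1 a : measurable_fun setT (t1 a).
Proof. by apply: mg1; [exact: measurable_moll|apply: measurable_funB => //; exact: measurable_cst]. Qed.
Let mt2 a : measurable_fun setT (t2 a).
Proof. by apply: mg1; [exact: measurable_moll|apply: measurable_funB => //; exact: measurable_cst]. Qed.
Let mdt1 a : measurable_fun setT (dt1 a).
Proof. by apply: (@mg1 ('D_1 (moll d))); [exact: measurable_dmoll|apply: measurable_funB => //; exact: measurable_cst]. Qed.
Let mdt2 a : measurable_fun setT (dt2 a).
Proof. by apply: (@mg1 ('D_1 (moll d))); [exact: measurable_dmoll|apply: measurable_funB => //; exact: measurable_cst]. Qed.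
Let mf : measurable_fun [set: TR] f.
Proof. by apply: continuous_mfun; exact: (lipschitz_continuous fL). Qed.
Let msg : measurable_fun [set: T4] (fun Z => Num.sg (U Z - V Z)).
Proof. by apply: mg1; [exact: measurable_sg|exact: measurable_funB]. Qed.

Let dom := @dom R u v n.

Let uvC Z : `|U Z - V Z| <= 1 * (`|u Z.1.1 Z.1.2| + `|v Z.2.1 Z.2.2|).
Proof. by rewrite mul1r; exact: ler_normB. Qed.

(** The choice of [n] in [hn] places the support of the mollifier centred at [a] inside [-n, n],
    where the tent equals 1. *)
Lemma moll_tent (a t K : R) : lo + d < a < hi - d ->
  (forall x, `|moll d x| <= K) -> `|moll d (t - a)| <= K * tent n t.
Proof.
move=> /andP[a1 a2] hK.
have K0 : 0 <= K := le_trans (normr_ge0 _) (hK 0).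
have [td|dt] := ltP `|t - a| d.
  rewrite tent1 ?mulr1//.
  have : `|t| <= `|t - a| + `|a| by rewrite -lerBlDr; exact: lerB_dist.
  have : `|a| <= `|lo| + `|hi|.
    rewrite ler_norml; have := ler_norm lo; have := ler_norm (- lo); have := ler_norm hi; have := ler_norm (- hi).
    by have d0' := d0; rewrite !normrN => *; apply/andP; split; lra.
  by have := e0; have := hn; lra.
by rewrite moll_out// normr0 mulr_ge0// tent_ge0.
Qed.

Lemma dmoll_tent (a t K : R) : lo + d < a < hi - d ->
  (forall x, `|'D_1 (moll d) x| <= K) -> `|'D_1 (moll d) (t - a)| <= K * tent n t.
Proof.
move=> /andP[a1 a2] hK.
have K0 : 0 <= K := le_trans (normr_ge0 _) (hK 0).
have [td|dt] := leP `|t - a| d.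
  rewrite tent1 ?mulr1//.
  have : `|t| <= `|t - a| + `|a| by rewrite -lerBlDr; exact: lerB_dist.
  have : `|a| <= `|lo| + `|hi|.
    rewrite ler_norml; have := ler_norm lo; have := ler_norm (- lo); have := ler_norm hi; have := ler_norm (- hi).
    by have d0' := d0; rewrite !normrN => *; apply/andP; split; lra.
  by have := e0; have := hn; lra.
have : 'D_1 (moll d) (t - a) = 0.
  by apply: (derive_out _ dt) => y; exact: moll_out.
by move=> ->; rewrite normr0 mulr_ge0// tent_ge0.
Qed.

Let en : e + 1 <= n%:R.
Proof. by have := normr_ge0 lo; have := normr_ge0 hi; have := d0; have := hn; lra. Qed.

Lemma w_tent (K x : R) : (forall x, `|moll e x| <= K) -> `|moll e x| <= K * tent n x.
Proof.
move=> hK; have K0 : 0 <= K := le_trans (normr_ge0 _) (hK 0).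
by apply: (@le_tent _ n (moll e) K (e + 1)) => // y ye; apply: moll_out; lra.
Qed.

Let w'_tent (K x : R) : (forall x, `|'D_1 (moll e) x| <= K) -> `|'D_1 (moll e) x| <= K * tent n x.
Proof.
move=> hK; have K0 : 0 <= K := le_trans (normr_ge0 _) (hK 0).
apply: (@le_tent _ n ('D_1 (moll e)) K (e + 1)) => // y ye.
by apply: (derive_out (d := e)); [move=> z; exact: moll_out|lra].
Qed.

(** Where the kernel is nonzero, t and s are both within d of a, and |x - y| < e. *)
Let near_diag a Z : t1 a Z * t2 a Z * w Z * (`|Z.1.1 - Z.2.1| + `|Z.1.2 - Z.2.2|) <=
  t1 a Z * t2 a Z * w Z * (2 * d + e).
Proof.
rewrite /t1 /t2 /w.
have [h1|h1] := leP d `|Z.1.1 - a|; first by rewrite moll_out// !mul0r.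
have [h2|h2] := leP d `|Z.2.1 - a|; first by rewrite [moll d (Z.2.1 - a)]moll_out// mulr0 !mul0r.
have [h3|h3] := leP e `|Z.1.2 - Z.2.2|; first by rewrite [moll e _]moll_out// mulr0 !mul0r.
have p1 y := moll_ge0 d0 y; have p2 y := moll_ge0 e0 y.
apply: ler_wpM2l; first by apply: mulr_ge0; [apply: mulr_ge0; exact: p1|exact: p2].
have : `|Z.1.1 - Z.2.1| <= `|Z.1.1 - a| + `|Z.2.1 - a|.
  by rewrite (_ : Z.1.1 - Z.2.1 = (Z.1.1 - a) - (Z.2.1 - a)) ?ler_normB//; ring.
by lra.
Qed.

(** Bounds for |A(t, x) - B(s, y)| and |A'(t, x) - B'(s, y)| on the support of the kernel: the bound
    at equal points plus the Lipschitz cost of moving from (t, x) to (s, y). *)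
Let k1' := k1 + M * (2 * d + e).
Let k2' := k2 + M * (2 * d + e).

(** [jU] is the entropy integrand of [u] at level v(s, y), and [jV] that of [v] at level u(t, x),
    written with the sign of u - v. In [jV] the flux term changes sign because the derivative of
    [moll e] is odd, the source term because of the sign factor. *)
Let jU a Z := dt1 a Z * t2 a Z * w Z * `|U Z - V Z|
  + t1 a Z * t2 a Z * w' Z * (Num.sg (U Z - V Z) * A Z.1.1 Z.1.2 * (f (U Z) - f (V Z)))
  - t1 a Z * t2 a Z * w Z * (f (V Z) * Num.sg (U Z - V Z) * A' Z.1.1 Z.1.2).
Let jV a Z := t1 a Z * dt2 a Z * w Z * `|U Z - V Z|
  - t1 a Z * t2 a Z * w' Z * (Num.sg (U Z - V Z) * B Z.2.1 Z.2.2 * (f (U Z) - f (V Z)))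
  + t1 a Z * t2 a Z * w Z * (f (U Z) * Num.sg (U Z - V Z) * B' Z.2.1 Z.2.2).

Let sgM (x : R) y C : `|y| <= C -> `|Num.sg x * y| <= C.
Proof.
move=> h; apply: le_trans h; rewrite normrM ler_piMl// normr_sg.
by case: (_ != 0).
Qed.

Let fle x : `|f x| <= L * `|x|.
Proof. by have := fL x 0; rewrite f0 !subr0. Qed.

Let mabs : measurable_fun [set: T4] (fun Z => `|U Z - V Z|).
Proof. exact: (measurableT_comp (@normr_measurable R setT) (measurable_funB mU mV)). Qed.
Let mfU : measurable_fun [set: T4] (fun Z => f (U Z)). Proof. exact: mg1 mf mU. Qed.
Let mfV : measurable_fun [set: T4] (fun Z => f (V Z)). Proof. exact: mg1 mf mV. Qed.
Let mttw a : measurable_fun [set: T4] (fun Z => t1 a Z * t2 a Z * w Z).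
Proof. exact: measurable_funM (measurable_funM (mt1 a) (mt2 a)) mw. Qed.
Let mttw' a : measurable_fun [set: T4] (fun Z => t1 a Z * t2 a Z * w' Z).
Proof. exact: measurable_funM (measurable_funM (mt1 a) (mt2 a)) mw'. Qed.

Let mjU a : measurable_fun setT (jU a).
Proof.
apply: measurable_funB; first apply: measurable_funD.
- exact: measurable_funM (measurable_funM (measurable_funM (mdt1 a) (mt2 a)) mw) mabs.
- exact: measurable_funM (mttw' a) (measurable_funM (measurable_funM msg mA) (measurable_funB mfU mfV)).
- exact: measurable_funM (mttw a) (measurable_funM (measurable_funM mfV msg) mA').
Qed.

Let mjV a : measurable_fun setT (jV a).
Proof.
apply: measurable_funD; first apply: measurable_funB.
- exact: measurable_funM (measurable_funM (measurable_funM (mt1 a) (mdt2 a)) mw) mabs.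
- exact: measurable_funM (mttw' a) (measurable_funM (measurable_funM msg mB) (measurable_funB mfU mfV)).
- exact: measurable_funM (mttw a) (measurable_funM (measurable_funM mfU msg) mB').
Qed.

Let j_dom (a : R) : lo + d < a < hi - d ->
  exists C, forall Z, `|jU a Z| <= C * dom Z /\ `|jV a Z| <= C * dom Z.
Proof.
move=> ha.
have [Kd [Kd0 D1 D2 _]] := moll_bounds d; have [Ke [Ke0 E1 E2 _]] := moll_bounds e.
exists (Kd * Kd * Ke * 1 + Kd * Kd * Ke * (L * M) + Kd * Kd * Ke * (L * M)) => Z.
have T1 t := moll_tent t ha D1; have T2 t := dmoll_tent t ha D2.
have W1 x := w_tent x E1; have W2 x := w'_tent x E2.
have [_ bA bA' _ _] := cA; have [_ bB bB' _ _] := cB.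
have fUV Z' (q : R) : `|q| <= M -> `|Num.sg (U Z' - V Z') * q * (f (U Z') - f (V Z'))| <=
    L * M * (`|u Z'.1.1 Z'.1.2| + `|v Z'.2.1 Z'.2.2|).
  move=> hq; rewrite -mulrA; apply: sgM; rewrite normrM.
  apply: le_trans (ler_pM _ _ hq (fL _ _)) _ => //.
  by rewrite mulrA (mulrC M) ler_wpM2l ?mulr_ge0//; have := uvC Z'; rewrite mul1r.
have fUV' Z' (q r : R) : `|r| <= `|u Z'.1.1 Z'.1.2| + `|v Z'.2.1 Z'.2.2| -> `|q| <= M ->
    `|f r * Num.sg (U Z' - V Z') * q| <=
    L * M * (`|u Z'.1.1 Z'.1.2| + `|v Z'.2.1 Z'.2.2|).
  move=> hr hq; rewrite (_ : _ * _ * q = Num.sg (U Z' - V Z') * (f r * q)); last by ring.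
  apply: sgM; rewrite normrM.
  apply: le_trans (ler_pM _ _ (fle r) hq) _ => //.
  by rewrite mulrAC ler_wpM2l ?mulr_ge0.
split.
- apply: le_trans (ler_normB _ _) _; rewrite !mulrDl lerD//.
    apply: le_trans (ler_normD _ _) _; rewrite lerD//.
    + by apply: (dom_prod (al := fun t => 'D_1 (moll d) (t - a)) (be := fun t => moll d (t - a))
        (g := fun Z => `|U Z - V Z|)) => // Z'; rewrite normr_id.
    + by apply: (dom_prod (al := fun t => moll d (t - a)) (be := fun t => moll d (t - a))
        (ka := 'D_1 (moll e))
        (g := fun Z => Num.sg (U Z - V Z) * A Z.1.1 Z.1.2 * (f (U Z) - f (V Z)))) => // Z'; exact: fUV.
  apply: (dom_prod (al := fun t => moll d (t - a)) (be := fun t => moll d (t - a))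
     (g := fun Z => f (V Z) * Num.sg (U Z - V Z) * A' Z.1.1 Z.1.2)) => // Z'.
  by apply: fUV' => //; rewrite lerDr.
- apply: le_trans (ler_normD _ _) _; rewrite !mulrDl lerD//.
    apply: le_trans (ler_normB _ _) _; rewrite lerD//.
    + by apply: (dom_prod (al := fun t => moll d (t - a)) (be := fun t => 'D_1 (moll d) (t - a))
        (g := fun Z => `|U Z - V Z|)) => // Z'; rewrite normr_id.
    + by apply: (dom_prod (al := fun t => moll d (t - a)) (be := fun t => moll d (t - a))
        (ka := 'D_1 (moll e))
        (g := fun Z => Num.sg (U Z - V Z) * B Z.2.1 Z.2.2 * (f (U Z) - f (V Z)))) => // Z'; exact: fUV.
  apply: (dom_prod (al := fun t => moll d (t - a)) (be := fun t => moll d (t - a))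
     (g := fun Z => f (U Z) * Num.sg (U Z - V Z) * B' Z.2.1 Z.2.2)) => // Z'.
  by apply: fUV' => //; rewrite lerDl.
Qed.

(** For fixed (s, y) the doubled kernel is chi(t) psi(x) with the constant [moll d (s - a)] absorbed
    in chi, so the entropy inequality for product test functions makes every inner integral
    nonnegative. *)
Let jU_ge0 (a : R) : lo + d < a < hi - d -> 0 <= \int[leb4]_Z jU a Z.
Proof.
move=> ha; have [C HC] := j_dom ha.
have [i4 _ sec] := dom_bound pu pv (mjU a) (fun Z => (HC Z).1).
have [_ ->] := prod_int2 i4 sec.
apply: Rintegral_ge0 => z' _.
have := Ku (v z'.1 z'.2) (fun m => Cn_moll_shift m d a (moll d (z'.1 - a)))
  (fun m => Cn_moll_shift m e z'.2 1).
move=> /(_ (a - d) (a + d) (`|z'.2| + e)).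
move: ha => /andP[a1 a2].
have h1 t : 0 <= moll d (z'.1 - a) * moll d (t - a) by rewrite mulr_ge0// moll_ge0.
have h2 x : 0 <= 1 * moll e (x - z'.2) by rewrite mulr_ge0// moll_ge0.
have h3 t : ~~ (a - d <= t <= a + d) -> moll d (z'.1 - a) * moll d (t - a) = 0.
  exact: moll_shift_out.
have h4 x : `|z'.2| + e <= `|x| -> 1 * moll e (x - z'.2) = 0.
  move=> h; rewrite mul1r moll_out//; have := lerB_dist x z'.2; lra.
move=> /(_ h1 h2 h3 _ _ h4) H; have {H} := H _ _.
have a1' : lo < a - d by lra. have a2' : a + d < hi by lra.
move=> /(_ a1' a2'); set I1 := Rintegral _ _ _; set I2 := Rintegral _ _ _.
suff -> : I1 = I2 by [].
apply: eq_Rintegral => z _; rewrite /jU /U /V /w /w' /t1 /t2 /dt1/=.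
have [_ ->] := moll_shift_derive d a (moll d (z'.1 - a)) z.1.
have [_ ->] := moll_shift_derive e z'.2 1 z.2.
by ring.
Qed.

Let jV_ge0 (a : R) : lo + d < a < hi - d -> 0 <= \int[leb4]_Z jV a Z.
Proof.
move=> ha; have [C HC] := j_dom ha.
have [i4 sec _] := dom_bound pu pv (mjV a) (fun Z => (HC Z).2).
have [_ ->] := prod_int1 i4 sec.
apply: Rintegral_ge0 => z' _.
have := Kv (u z'.1 z'.2) (fun m => Cn_moll_shift m d a (moll d (z'.1 - a)))
  (fun m => Cn_moll_shift m e z'.2 1).
move=> /(_ (a - d) (a + d) (`|z'.2| + e)).
move: ha => /andP[a1 a2].
have h1 t : 0 <= moll d (z'.1 - a) * moll d (t - a) by rewrite mulr_ge0// moll_ge0.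
have h2 x : 0 <= 1 * moll e (x - z'.2) by rewrite mulr_ge0// moll_ge0.
have h3 t : ~~ (a - d <= t <= a + d) -> moll d (z'.1 - a) * moll d (t - a) = 0.
  exact: moll_shift_out.
have h4 x : `|z'.2| + e <= `|x| -> 1 * moll e (x - z'.2) = 0.
  move=> h; rewrite mul1r moll_out//; have := lerB_dist x z'.2; lra.
move=> /(_ h1 h2 h3 _ _ h4) H; have {H} := H _ _.
have a1' : lo < a - d by lra. have a2' : a + d < hi by lra.
move=> /(_ a1' a2'); set I1 := Rintegral _ _ _; set I2 := Rintegral _ _ _.
suff -> : I1 = I2 by [].
apply: eq_Rintegral => z _; rewrite /jV /U /V /w /w' /t1 /t2 /dt2/=.
have [_ ->] := moll_shift_derive d a (moll d (z'.1 - a)) z.1.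
have [_ ->] := moll_shift_derive e z'.2 1 z.2.
have -> : z'.2 - z.2 = - (z.2 - z'.2) by ring.
rewrite mollN moll_deriveN -[`|u _ _ - _|]distrC.
have -> : u z'.1 z'.2 - v z.1 z.2 = - (v z.1 z.2 - u z'.1 z'.2) by ring.
by rewrite sgrN; ring.
Qed.
Let int1 (a : R) : \int[leb]_t moll d (t - a) = 1.
Proof. by case: (moll_shift_int a d0). Qed.
Let imd (a : R) : leb.-integrable setT (EFin \o (fun t => moll d (t - a))).
Proof. by case: (moll_shift_int a d0). Qed.
Let normr_molld (a t : R) : `|moll d (t - a)| <= moll d (t - a).
Proof. by rewrite ger0_norm// moll_ge0. Qed.
Let ime : leb.-integrable setT (EFin \o moll e). Proof. exact: integrable_moll. Qed.

Let integrate_z' (a : R) (h : TR * TR -> R) c : leb2.-integrable setT (EFin \o h) ->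
  leb4.-integrable setT (EFin \o (fun Z => c * (h Z.1 * (t2 a Z * w Z)))) /\
  \int[leb4]_Z (c * (h Z.1 * (t2 a Z * w Z))) = c * \int[leb2]_z h z.
Proof.
move=> ih; have [i1 E1] := weight1 ih (imd a) ime (mollN e).
split; first exact: (integrable_scale c i1).
by rewrite RintegralZl// E1 int1 integral_moll// !mulr1.
Qed.

Let time_part a Z := `|U Z - V Z| * w Z * (dt1 a Z * t2 a Z + t1 a Z * dt2 a Z).
Let flux_part a Z := t1 a Z * t2 a Z * (kflux f (U Z) (V Z) *
  ((A Z.1.1 Z.1.2 - B Z.2.1 Z.2.2) * w' Z + A' Z.1.1 Z.1.2 * w Z)).
Let source_part a Z := t1 a Z * t2 a Z * w Z *
  (`|f (U Z)| * `|B' Z.2.1 Z.2.2 - A' Z.1.1 Z.1.2|).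

(** In the sum of the source terms write f(V) A' = f(U) A' - (f(U) - f(V)) A'. The last piece joins
    the flux term, completing (A - B) w' + A' w, the x-derivative of (A(t, x) - B(s, y)) w(x - y);
    what is left is f(U) (B' - A'). *)
Let j_le a Z : jU a Z + jV a Z <= time_part a Z + flux_part a Z + source_part a Z.
Proof.
have E : jU a Z + jV a Z = time_part a Z + flux_part a Z + t1 a Z * t2 a Z * w Z *
   (Num.sg (U Z - V Z) * (f (U Z) * (B' Z.2.1 Z.2.2 - A' Z.1.1 Z.1.2))).
  by rewrite /jU /jV /time_part /flux_part /kflux; ring.
rewrite E lerD2l ler_wpM2l//.
  by rewrite /t1 /t2 /w; apply: mulr_ge0; [apply: mulr_ge0|]; exact: moll_ge0.
by apply: le_trans (ler_norm _) _; apply: sgM; rewrite normrM.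
Qed.

(** Since f(0) = 0, |f(U)| <= L |U|; the mass of u is at most [mu] at each time and the mollifiers
    integrate to 1. *)
Let source_le (a : R) : lo + d < a < hi - d ->
  leb4.-integrable setT (EFin \o source_part a) /\
  \int[leb4]_Z source_part a Z <= k2' * (L * mu).
Proof.
move=> ha.
have [iw iwle] := weighted_l1path pu (imd a) (normr_molld a) (imd a).
rewrite int1 mulr1 in iwle.
have [i1 E1] := integrate_z' a (k2' * L) iw.
have mS : measurable_fun setT (source_part a).
  apply: measurable_funM; first exact: mttw.
  apply: measurable_funM; apply: (measurableT_comp (@normr_measurable R setT)) => //.
  exact: measurable_funB.
have lA' : forall t s x y, `|B' t x - B' s y| <= M * (`|t - s| + `|x - y|).
  by have [_ _ _ [_ h] _] := cB.
have bound Z : source_part a Z <= k2' * L * (moll d (Z.1.1 - a) * `|u Z.1.1 Z.1.2| * (t2 a Z * w Z)).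
  have h1 : `|B' Z.2.1 Z.2.2 - A' Z.1.1 Z.1.2| <= k2 + M * (`|Z.1.1 - Z.2.1| + `|Z.1.2 - Z.2.2|).
    have := hk2 Z.1.1 Z.1.2; have := lA' Z.1.1 Z.2.1 Z.1.2 Z.2.2.
    have := ler_distD (B' Z.1.1 Z.1.2) (B' Z.2.1 Z.2.2) (A' Z.1.1 Z.1.2).
    by rewrite [`|B' Z.2.1 Z.2.2 - B' _ _|]distrC [`|B' Z.1.1 Z.1.2 - A' _ _|]distrC; lra.
  have ttw0 : 0 <= t1 a Z * t2 a Z * w Z.
    by rewrite /t1 /t2 /w; apply: mulr_ge0; [apply: mulr_ge0|]; exact: moll_ge0.
  have h2 : t1 a Z * t2 a Z * w Z * `|B' Z.2.1 Z.2.2 - A' Z.1.1 Z.1.2| <= t1 a Z * t2 a Z * w Z * k2'.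
    apply: le_trans (ler_wpM2l ttw0 h1) _.
    rewrite mulrDr /k2' [leRHS]mulrDr lerD2l mulrCA.
    rewrite [leRHS](_ : _ = M * (t1 a Z * t2 a Z * w Z * (2 * d + e))); last by ring.
    by rewrite ler_wpM2l// near_diag.
  rewrite /source_part mulrCA mulrA.
  apply: (@le_trans _ _ (`|f (U Z)| * (t1 a Z * t2 a Z * w Z * k2'))).
    by rewrite -mulrA ler_wpM2l.
  rewrite (_ : k2' * L * _ = (L * `|U Z|) * (t1 a Z * t2 a Z * w Z * k2')); last by rewrite /U /t1; ring.
  rewrite ler_wpM2r//; apply: le_trans h2.
  by rewrite mulr_ge0.
have iS : leb4.-integrable setT (EFin \o source_part a).
  apply: (integrable_bound mS i1) => Z; apply: le_trans (bound Z).
  rewrite ger0_norm// /source_part; apply: mulr_ge0; last by apply: mulr_ge0.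
  by rewrite /t1 /t2 /w; apply: mulr_ge0; [apply: mulr_ge0|]; exact: moll_ge0.
split=> //; apply: le_trans (Rint_le iS i1 bound) _.
rewrite E1 -mulrA; apply: ler_wpM2l.
  by rewrite /k2'; have := hk2 0 0; have := normr_ge0 (A' 0 0 - B' 0 0); have := d0; have := e0; have := M0; nra.
rewrite ler_wpM2l//; apply: le_trans iwle; apply: le_trans (ler_norm _) _.
apply: Rint_abs_le => //; first exact: integrable_measurable iw.
exact: integrable_nrm.
Qed.
Let ttw_ge0 a Z : 0 <= t1 a Z * t2 a Z * w Z.
Proof. by rewrite /t1 /t2 /w; apply: mulr_ge0; [apply: mulr_ge0|]; exact: moll_ge0. Qed.

Let k1_ge0 : 0 <= k1. Proof. exact: le_trans (normr_ge0 _) (hk1 0 0). Qed.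

Let diffAB_le a Z : t1 a Z * t2 a Z * w Z * `|A Z.1.1 Z.1.2 - B Z.2.1 Z.2.2| <=
  k1' * (t1 a Z * t2 a Z * w Z).
Proof.
have lB : forall t s x y, `|B t x - B s y| <= M * (`|t - s| + `|x - y|).
  by have [_ _ _ [h _] _] := cB.
have h1 : `|A Z.1.1 Z.1.2 - B Z.2.1 Z.2.2| <= k1 + M * (`|Z.1.1 - Z.2.1| + `|Z.1.2 - Z.2.2|).
  have := hk1 Z.1.1 Z.1.2; have := lB Z.1.1 Z.2.1 Z.1.2 Z.2.2.
  by have := ler_distD (B Z.1.1 Z.1.2) (A Z.1.1 Z.1.2) (B Z.2.1 Z.2.2); lra.
apply: le_trans (ler_wpM2l (ttw_ge0 a Z) h1) _.
rewrite mulrDr /k1' mulrDl [k1 * _]mulrC lerD2l mulrCA.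
rewrite [leRHS](_ : _ = M * (t1 a Z * t2 a Z * w Z * (2 * d + e))); last by ring.
by rewrite ler_wpM2l// near_diag.
Qed.

Let weighted_shift (a h : R) :
  leb2.-integrable setT (EFin \o (fun z => moll d (z.1 - a) * `|u z.1 (z.2 - h) - u z.1 z.2|)) /\
  \int[leb2]_z (moll d (z.1 - a) * `|u z.1 (z.2 - h) - u z.1 z.2|) <= bu * `|h|.
Proof.
have [mu' iu _] := pu.
have := @prod_bound1 _ _ TR TR R leb leb
  (fun z => moll d (z.1 - a) * `|u z.1 (z.2 - h) - u z.1 z.2|) (fun t => (bu * `|h|) * moll d (t - a)).
have mm : measurable_fun [set: TR] (fun t : TR => moll d (t - a)) by exact: integrable_measurable (imd a).
have ms : measurable_fun [set: TR * TR] (fun z => u z.1 (z.2 - h)).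
  have mp : measurable_fun [set: TR * TR] (fun z : TR * TR => (z.1, z.2 - h)).
    apply: measurable_fun_pair; first exact: measurable_fst.
    by apply: measurable_funB; [exact: measurable_snd|exact: measurable_cst].
  exact: (measurableT_comp mu' mp).
move=> [].
- apply: measurable_funM; first exact: (measurableT_comp mm measurable_fst).
  exact: (measurableT_comp (@normr_measurable R setT) (measurable_funB ms mu')).
- move=> t /=; apply: (@integrable_scale _ TR R leb (moll d (t - a))).
  apply: integrable_nrm; apply: integrable_sub => //.
  by have [] := Rint_shift (- h) (iu t).
- move=> t /=; under eq_Rintegral do rewrite normrM normr_id (ger0_norm (moll_ge0 d0 _)).
  rewrite RintegralZl//; last first.
    apply: integrable_nrm; apply: integrable_sub => //.
    by have [] := Rint_shift (- h) (iu t).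
  rewrite mulrC ler_wpM2r ?moll_ge0//.
  by have := TV_shift (- h) (iu t) (tvu t); rewrite normrN.
- exact: (integrable_scale _ (imd a)).
- move=> i1; rewrite RintegralZl// int1 mulr1 => E1; split=> //.
  apply: le_trans E1; apply: le_trans (ler_norm _) _.
  by apply: Rint_abs_le => //; [exact: integrable_measurable i1|exact: integrable_nrm].
Qed.

(* [P a h - P a 0] is the increment in x of the flux term; shifting x by - h in
   the integral of [P a h] turns it into an increment of u. *)
Let P a h Z := t1 a Z * t2 a Z * moll e (Z.1.2 - Z.2.2 + h) *
  (kflux f (U Z) (V Z) * (A Z.1.1 (Z.1.2 + h) - B Z.2.1 Z.2.2)).

Let mkf : measurable_fun [set: T4] (fun Z => kflux f (U Z) (V Z)).
Proof. exact: measurable_funM msg (measurable_funB mfU mfV). Qed.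

Let iP (a h : R) : lo + d < a < hi - d -> `|h| <= 1 ->
  leb4.-integrable setT (EFin \o P a h).
Proof.
move=> ha h1.
have [Kd [Kd0 D1 _ _]] := moll_bounds d; have [Ke [Ke0 E1 _ _]] := moll_bounds e.
have mP : measurable_fun setT (P a h).
  apply: measurable_funM.
    apply: measurable_funM; first exact: measurable_funM.
    apply: mg1; first exact: measurable_moll.
    by apply: measurable_funD; [exact: measurable_funB m12 m22|exact: measurable_cst].
  apply: measurable_funM; first exact: mkf.
  apply: measurable_funB => //.
  have [[mA0 _] _ _ _ _] := cA.
  apply: (measurableT_comp mA0 (g := fun Z : T4 => (Z.1.1, Z.1.2 + h))).
  apply: measurable_fun_pair => //; apply: measurable_funD => //; exact: measurable_cst.
have [_ bA _ _ _] := cA; have [_ bB _ _ _] := cB.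
have [] // := dom_bound pu pv mP (n := n) (C := Kd * Kd * Ke * (L * (2 * M))) _.
apply: (dom_prod (al := fun t => moll d (t - a)) (be := fun t => moll d (t - a))
  (ka := fun z => moll e (z + h)) (g := fun Z => kflux f (U Z) (V Z) * (A Z.1.1 (Z.1.2 + h) - B Z.2.1 Z.2.2))).
- by move=> t; exact: moll_tent.
- by move=> t; exact: moll_tent.
- move=> x; apply: (@le_tent _ n (fun z => moll e (z + h)) Ke (e + 1)) => // y ye.
  by apply: moll_out; have := lerB_dist y (- h); rewrite normrN opprK; lra.
- move=> Z; rewrite normrM.
  have h2 : `|A Z.1.1 (Z.1.2 + h) - B Z.2.1 Z.2.2| <= 2 * M.
    apply: le_trans (ler_normB _ _) _; have := bA Z.1.1 (Z.1.2 + h); have := bB Z.2.1 Z.2.2.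
    lra.
  apply: le_trans (ler_pM _ _ (kflux_le fL _ _) h2) _ => //.
  by rewrite mulrAC ler_wpM2l ?mulr_ge0//; have := uvC Z; rewrite mul1r.
Qed.

(** After the shift both integrals carry the same kernel and the same factor A - B; they differ only
    in Kruzkov's flux, by at most L |u(t, x - h) - u(t, x)|. The point (s, y) is not moved, so the
    variation of [v] does not appear. *)
Let flux_step (a h : R) : lo + d < a < hi - d -> 0 < h <= 1 ->
  \int[leb4]_Z P a h Z - \int[leb4]_Z P a 0 Z <= k1' * L * (bu * h).
Proof.
move=> ha /andP[h0 h1].
have hn1 : `|h| <= 1 by rewrite gtr0_norm.
have z1 : `|0 : R| <= 1 by rewrite normr0.
have i1 := iP ha hn1; have i2 := iP ha z1.
have [iQ <-] := leb4_shift (- h) i1.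
rewrite -RintegralB//.
have [iw wle] := weighted_shift a h.
have [i3 E3] := integrate_z' a (k1' * L) iw.
have k10 : 0 <= k1'.
  apply: addr_ge0; [exact: k1_ge0|apply: mulr_ge0; first exact: M0].
  exact: addr_ge0 (mulr_ge0 (ler0n _ 2) (ltW d0)) (ltW e0).
apply: (@le_trans _ _ (k1' * L * \int[leb2]_z (moll d (z.1 - a) * `|u z.1 (z.2 - h) - u z.1 z.2|))); last first.
  rewrite ler_wpM2l ?mulr_ge0//; apply: le_trans wle _.
  by rewrite ler_wpM2l// gtr0_norm.
rewrite -E3; apply: Rint_le => //; first exact: integrable_sub.
move=> Z; rewrite /P /t1 /t2/= /U /V /= addr0 subrK addr0.
rewrite (_ : _ - _ - _ + h = Z.1.2 - Z.2.2); last by ring.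
set x := kflux f (u Z.1.1 (Z.1.2 - h)) _; set y := kflux f (u _ Z.1.2) _; set q := A _ _ - _.
have hx : `|x - y| <= L * `|u Z.1.1 (Z.1.2 - h) - u Z.1.1 Z.1.2| by exact: kflux_lip.
rewrite -mulrBr -mulrBl -/(t1 a Z) -/(t2 a Z) -/(w Z).
apply: (@le_trans _ _ (t1 a Z * t2 a Z * w Z * (L * `|u Z.1.1 (Z.1.2 - h) - u Z.1.1 Z.1.2| * `|q|))).
  rewrite ler_wpM2l ?ttw_ge0//; apply: le_trans (ler_norm _) _.
  by rewrite normrM ler_wpM2r.
rewrite (_ : _ * (_ * _) = L * `|u Z.1.1 (Z.1.2 - h) - u Z.1.1 Z.1.2| *
   (t1 a Z * t2 a Z * w Z * `|q|)); last by ring.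
apply: le_trans (ler_wpM2l _ (diffAB_le a Z)) _; first by rewrite mulr_ge0.
by rewrite le_eqVlt; apply/orP; left; apply/eqP; rewrite /t1 /t2 /w; ring.
Qed.

Let flux_le (a : R) : lo + d < a < hi - d ->
  leb4.-integrable setT (EFin \o flux_part a) /\
  \int[leb4]_Z flux_part a Z <= k1' * L * bu.
Proof.
move=> ha.
have [Kd [Kd0 D1 _ _]] := moll_bounds d; have [Ke [Ke0 E1 E2 E3]] := moll_bounds e.
have [_ bA bA' [_ lA'] dA] := cA; have [_ bB _ _ _] := cB.
pose C := Kd * Kd * (4 * M * Ke) * L.
have taylor h Z : 0 < h <= 1 ->
    (* For h <= 1 the remainder vanishes when |x - y| > e + 1, because every mollifier value in it
       does; on the rest the tent equals 1, so [dom] majorises it. *)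
    `|P a h Z - P a 0 Z - h * flux_part a Z| <= C * h ^+ 2 * dom Z.
  move=> /andP[h0 h1].
  have bdA x : `|A Z.1.1 x - B Z.2.1 Z.2.2| <= 2 * M.
    apply: le_trans (ler_normB _ _) _; have := bA Z.1.1 x; have := bB Z.2.1 Z.2.2; lra.
  have lipA' x y : `|A' Z.1.1 x - A' Z.1.1 y| <= M * `|x - y|.
    by have := lA' Z.1.1 Z.1.1 x y; rewrite subrr normr0 add0r.
  have := product_taylor (c := B Z.2.1 Z.2.2) Z.1.2 Z.2.2 h (dA Z.1.1) (bA' Z.1.1) lipA' bdA
     (moll_derive e) E1 E2 E3.
  set q := _ - _ => hq.
  have hq' : `|q| <= 4 * M * Ke * h ^+ 2 * tent n (Z.1.2 - Z.2.2).
    have [xe|ex] := leP `|Z.1.2 - Z.2.2| (e + 1).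
      by rewrite tent1 ?mulr1// (le_trans xe).
    have o1 : moll e (Z.1.2 - Z.2.2) = 0 by apply: moll_out; lra.
    have o2 : moll e (Z.1.2 + h - Z.2.2) = 0.
      apply: moll_out; have := lerB_dist (Z.1.2 - Z.2.2) (- h).
      by rewrite normrN opprK (gtr0_norm h0) (_ : Z.1.2 - Z.2.2 + h = Z.1.2 + h - Z.2.2); [lra|ring].
    have o3 : 'D_1 (moll e) (Z.1.2 - Z.2.2) = 0.
      by apply: (derive_out (d := e)); [move=> z; exact: moll_out|lra].
    rewrite /q o1 o2 o3 !mulr0 addr0 mul0r !subr0 normr0.
    apply: mulr_ge0; last exact: tent_ge0.
    apply: mulr_ge0; last exact: sqr_ge0.
    by apply: mulr_ge0 => //; apply: mulr_ge0.
  have -> : P a h Z - P a 0 Z - h * flux_part a Z = t1 a Z * t2 a Z * (kflux f (U Z) (V Z) * q).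
    rewrite /P /flux_part /q /w /w' !addr0.
    by rewrite (_ : Z.1.2 + h - Z.2.2 = Z.1.2 - Z.2.2 + h); ring.
  rewrite normrM (normrM (t1 a Z)) (normrM (kflux f (U Z) (V Z))) /dom domE.
  have ht1 := moll_tent Z.1.1 ha D1; have ht2 := moll_tent Z.2.1 ha D1.
  have hk : `|kflux f (U Z) (V Z)| <= L * (`|u Z.1.1 Z.1.2| + `|v Z.2.1 Z.2.2|).
    apply: le_trans (kflux_le fL _ _) _; rewrite ler_wpM2l//.
    by have := uvC Z; rewrite mul1r.
  rewrite [leRHS](_ : _ = Kd * tent n Z.1.1 * (Kd * tent n Z.2.1) * (L * (`|u Z.1.1 Z.1.2| + `|v Z.2.1 Z.2.2|)
     * (4 * M * Ke * h ^+ 2 * tent n (Z.1.2 - Z.2.2)))); last by rewrite /C; ring.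
  apply: ler_pM (ler_pM _ _ ht1 ht2) (ler_pM _ _ hk hq') => //; exact: mulr_ge0.
have mFl : measurable_fun setT (flux_part a).
  apply: measurable_funM; first exact: measurable_funM.
  apply: measurable_funM; first exact: mkf.
  by apply: measurable_funD; [exact: measurable_funM (measurable_funB mA mB) mw'|exact: measurable_funM].
have o1 : 0 < (1 : R) <= 1 by rewrite ltr01 lexx.
have z1 : `|0 : R| <= 1 by rewrite normr0.
have n1 : `|1 : R| <= 1 by rewrite normr1.
have iD : leb4.-integrable setT (EFin \o dom) := dom_int n pu pv.
have iFl : leb4.-integrable setT (EFin \o flux_part a).
  (* The expansion with h = 1 expresses [flux_part] through integrable terms. *)
  apply: (integrable_bound mFl (g := fun Z => `|P a 1 Z| + `|P a 0 Z| + C * dom Z)).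
    apply: integrable_add; last exact: (integrable_scale C iD).
    by apply: integrable_add; apply: integrable_nrm; exact: iP.
  move=> Z; have := taylor _ Z o1; rewrite expr1n mulr1 mul1r => ht.
  rewrite (_ : flux_part a Z = P a 1 Z - P a 0 Z - (P a 1 Z - P a 0 Z - flux_part a Z)); last by ring.
  by apply: le_trans (ler_normB _ _) _; rewrite lerD//; exact: ler_normB.
split=> //; apply/ler_addgt0Pr => eps eps0.
pose I := \int[leb4]_Z dom Z.
have I0 : 0 <= I by apply: Rintegral_ge0 => Z _; exact: dom_ge0.
have C0 : 0 <= C by rewrite /C !mulr_ge0.
(* Chosen so that, after division by h, the remainder C h I is at most eps. *)
pose h := Num.min 1 (eps / (C * I + 1)).
have CI : 0 < C * I + 1 by rewrite ltr_wpDl// mulr_ge0.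
have h0 : 0 < h by rewrite lt_min ltr01 divr_gt0.
have h1 : h <= 1 by rewrite ge_min lexx.
have hh : 0 < h <= 1 by rewrite h0.
have hn1 : `|h| <= 1 by rewrite gtr0_norm.
have hs := flux_step ha hh.
have key : h * \int[leb4]_Z flux_part a Z <= \int[leb4]_Z P a h Z - \int[leb4]_Z P a 0 Z + C * h ^+ 2 * I.
  have i1 := iP ha hn1; have i2 := iP ha z1.
  rewrite -!RintegralZl// -RintegralB// -RintegralD//; last 2 first.
  - exact: integrable_sub.
  - exact: (integrable_scale _ iD).
  apply: Rint_le.
  - exact: (integrable_scale h iFl).
  - by apply: integrable_add; [exact: integrable_sub|exact: (integrable_scale _ iD)].
  - by move=> Z; have := taylor _ Z hh; rewrite ler_norml => /andP[+ _]; rewrite lerNl opprB lerBlDl.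
have : h * \int[leb4]_Z flux_part a Z <= h * (k1' * L * bu + C * h * I).
  apply: le_trans key _; rewrite mulrDr.
  rewrite [X in _ <= _ + X](_ : _ = C * h ^+ 2 * I); last by ring.
  by rewrite lerD2r (le_trans hs)// le_eqVlt; apply/orP; left; apply/eqP; ring.
rewrite ler_pM2l// => /le_trans; apply; rewrite lerD2l.
have : h <= eps / (C * I + 1) by rewrite ge_min lexx orbT.
rewrite ler_pdivlMr// mulrDr mulr1 => h2; apply: le_trans h2.
by rewrite mulrAC mulrC lerDl ltW.
Qed.

Let kappa := k1' * L * bu + k2' * (L * mu).

Let time_le (a : R) : lo + d < a < hi - d ->
  leb4.-integrable setT (EFin \o time_part a) /\ - kappa <= \int[leb4]_Z time_part a Z.
Proof.
move=> ha; have [C HC] := j_dom ha.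
have [i1 _ _] := dom_bound pu pv (mjU a) (fun Z => (HC Z).1).
have [i2 _ _] := dom_bound pu pv (mjV a) (fun Z => (HC Z).2).
have [i3 le3] := flux_le ha; have [i4 le4] := source_le ha.
have mT : measurable_fun setT (time_part a).
  exact: measurable_funM (measurable_funM mabs mw)
    (measurable_funD (measurable_funM (mdt1 a) (mt2 a)) (measurable_funM (mt1 a) (mdt2 a))).
have [Kd [Kd0 D1 D2 _]] := moll_bounds d; have [Ke [Ke0 E1 _ _]] := moll_bounds e.
have iT : leb4.-integrable setT (EFin \o time_part a).
  have [] // := dom_bound pu pv mT (n := n) (C := Kd * Kd * Ke * 1 + Kd * Kd * Ke * 1) _.
  move=> Z; rewrite /time_part mulrDr mulrDl.
  apply: le_trans (ler_normD _ _) _; rewrite lerD//.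
  - rewrite (_ : _ * _ * _ = dt1 a Z * t2 a Z * w Z * `|U Z - V Z|); last by ring.
    apply: (dom_prod (al := fun t => 'D_1 (moll d) (t - a)) (be := fun t => moll d (t - a))
        (g := fun Z => `|U Z - V Z|)) => [t|t|x|Z'].
    + exact: dmoll_tent. + exact: moll_tent. + exact: w_tent. + by rewrite normr_id.
  - rewrite (_ : _ * _ * _ = t1 a Z * dt2 a Z * w Z * `|U Z - V Z|); last by ring.
    apply: (dom_prod (al := fun t => moll d (t - a)) (be := fun t => 'D_1 (moll d) (t - a))
        (g := fun Z => `|U Z - V Z|)) => [t|t|x|Z'].
    + exact: moll_tent. + exact: dmoll_tent. + exact: w_tent. + by rewrite normr_id.
split=> //.
have := addr_ge0 (jU_ge0 ha) (jV_ge0 ha); rewrite -RintegralD// => h0.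
have h1 : \int[leb4]_Z (jU a Z + jV a Z) <= \int[leb4]_Z (time_part a Z + flux_part a Z + source_part a Z).
  apply: Rint_le (j_le a); first exact: integrable_add.
  by apply: integrable_add => //; exact: integrable_add.
have := le_trans h0 h1; rewrite RintegralD//; last exact: integrable_add.
rewrite RintegralD// => h; have := le_trans h (lerD (lerD (lexx _) le3) le4).
by rewrite -addrA -lerBlDr sub0r.
Qed.

(** Both time mollifiers are centred at [a], so the sum of the t- and s-derivatives of the kernel is
    minus its derivative in [a]: the bound below is a bound from above for the growth of the
    smoothed distance. *)
Lemma doubled_derivative (a : R) : lo + d < a < hi - d ->
  leb4.-integrable setT (EFin \o (fun Z : T4 => `|u Z.1.1 Z.1.2 - v Z.2.1 Z.2.2| *
    moll e (Z.1.2 - Z.2.2) * ('D_1 (moll d) (Z.1.1 - a) * moll d (Z.2.1 - a)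
                            + moll d (Z.1.1 - a) * 'D_1 (moll d) (Z.2.1 - a)))) /\
  - ((k1 + M * (2 * d + e)) * L * bu + (k2 + M * (2 * d + e)) * (L * mu)) <=
  \int[leb4]_Z (`|u Z.1.1 Z.1.2 - v Z.2.1 Z.2.2| *
    moll e (Z.1.2 - Z.2.2) * ('D_1 (moll d) (Z.1.1 - a) * moll d (Z.2.1 - a)
                            + moll d (Z.1.1 - a) * 'D_1 (moll d) (Z.2.1 - a))).
Proof. exact: time_le. Qed.
End kuznetsov.

Lemma Rint_scale d (T : measurableType d) (R : realType) (mu : {measure set T -> \bar R})
    (c : R) (f : T -> R) :
  mu.-integrable setT (EFin \o f) -> \int[mu]_x (c * f x) = c * \int[mu]_x f x.
Proof. exact: RintegralZl. Qed.

Lemma derive_growth (R : realType) (F : R -> R) (lo hi K a1 a2 : R) :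
  (forall a : R, lo < a < hi -> derivable F a 1 /\ derive1 F a <= K) ->
  lo < a1 -> a1 <= a2 -> a2 < hi -> F a2 - F a1 <= K * (a2 - a1).
Proof.
move=> dF h1 h2 h3; have [->|a12] := eqVneq a1 a2; first by rewrite !subrr mulr0.
have {}h2 : a1 < a2 by rewrite lt_neqAle a12.
have hd (x : R) : x \in `[a1, a2]%R -> lo < x < hi.
  by rewrite in_itv/= => /andP[x1 x2]; rewrite (lt_le_trans h1)//= (le_lt_trans x2).
have [c hc ->] : exists2 c : R, c \in `]a1, a2[%R & (F a2 - F a1 = derive1 F c * (a2 - a1))%R.
  apply: (MVT h2).
    move=> x hx; apply: DeriveDef; last by rewrite derive1E.
    by apply: (dF _ _).1; apply: hd; exact: subset_itv_oo_cc.
  apply: derivable_within_continuous => x hx.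
  by apply: (dF _ _).1; exact: hd.
rewrite ler_wpM2r ?subr_ge0 ?(ltW h2)//.
by apply: (dF _ _).2; apply: hd; exact: subset_itv_oo_cc.
Qed.

(** * Growth of the smoothed distance and removal of the mollification *)

Section mollified_variation.
Context {R : realType}.
Local Notation TR := (measurableTypeR R).
Local Notation leb := (@lebesgue_measure R).
Local Notation leb2 := (prodm leb leb).

(** Substitute x = y + h and integrate in y first: for |h| < e [TV_shift] gives b |h| <= b e, and
    the mollifier has mass 1. *)
Lemma mollified_TV (g : R -> R) b e : 0 < e -> leb.-integrable setT (EFin \o g) ->
  (TV g <= b%:E)%E ->
  leb.-integrable setT (EFin \o (fun y => \int[leb]_x (moll e (x - y) * `|g y - g x|))) /\
  \int[leb]_y \int[leb]_x (moll e (x - y) * `|g y - g x|) <= b * e.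
Proof.
move=> e0 ig bg; have ime := integrable_moll e.
have mg := integrable_measurable ig.
have [Ke [Ke0 E1 _ _]] := moll_bounds e.
pose K (z : TR * TR) := moll e z.1 * `|g z.2 - g (z.2 + z.1)|.
have mK : measurable_fun setT K.
  apply: measurable_funM; first exact: (measurableT_comp (@measurable_moll R e) measurable_fst).
  apply: (measurableT_comp (@normr_measurable R setT)); apply: measurable_funB.
    exact: (measurableT_comp mg measurable_snd).
  by apply: (measurableT_comp mg); exact: measurable_funD measurable_snd measurable_fst.
have i0 (h : R) : leb.-integrable setT (EFin \o (fun x : TR => `|g x - g (x + h)|)).
  by apply: integrable_nrm; apply: integrable_sub => //; have [] := Rint_shift h ig.
have b0 : 0 <= b.
  by have := TV_shift 1 ig bg; rewrite normr1 mulr1; apply: le_trans; exact: Rintegral_ge0.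
have [iK leK] : leb2.-integrable setT (EFin \o K) /\ \int[leb2]_z `|K z| <= \int[leb]_h (b * e * moll e h).
  apply: (@prod_bound1 _ _ TR TR R leb leb K (fun h => b * e * moll e h)) => //.
  - move=> h; apply: (@integrable_scale _ TR R leb (moll e h)); exact: i0.
  - move=> h; rewrite /K/=; under eq_Rintegral do rewrite normrM normr_id.
    rewrite (Rint_scale _ (i0 _)).
    rewrite ger0_norm ?moll_ge0// mulrC.
    have [he|eh] := leP e `|h|; first by rewrite (moll_out he) !mulr0.
    rewrite ler_wpM2r ?moll_ge0//.
    have := TV_shift h ig bg; under eq_Rintegral do rewrite distrC.
    by move=> /le_trans; apply; rewrite ler_wpM2l// ltW.
  - exact: (integrable_scale (b * e) ime).
have sec y : leb.-integrable setT (fun h => (K (h, y))%:E).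
  have ms : measurable_fun [set: TR] (fun h : TR => g (y + h)).
    apply: (measurableT_comp mg); apply: measurable_funD; [exact: measurable_cst|exact: measurable_id].
  have iS : leb.-integrable setT (EFin \o (fun h : TR => g (y + h))).
    rewrite (_ : (fun h => g (y + h)) = (fun h => g (h + y))); last by apply/funext => h; rewrite addrC.
    by have [] := Rint_shift y ig.
  apply: (@integrable_bound _ TR R leb _ (fun h => `|g y| * moll e h + Ke * `|g (y + h)|)).
  - exact: (measurable_fun_pair1 y mK).
  - apply: integrable_add; first exact: (integrable_scale _ ime).
    by apply: (@integrable_scale _ TR R leb Ke (fun h : TR => `|g (y + h)|)); exact: integrable_nrm.
  - move=> h; rewrite /K/= normrM normr_id.
    have m0 := moll_ge0 e0 h; rewrite (ger0_norm m0).
    apply: le_trans (ler_wpM2l m0 (ler_normB _ _)) _; rewrite mulrDr [X in X + _]mulrC lerD2l.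
    by rewrite ler_wpM2r//; have := E1 h; rewrite ger0_norm.
have [iQ EQ] := prod_int2 iK sec.
have E y : \int[leb]_x (moll e (x - y) * `|g y - g x|) = \int[leb]_h K (h, y).
  have [_ <-] := Rint_shift (- y) (sec y); rewrite /K/=.
  by apply: eq_Rintegral => x _; rewrite (addrC y) subrK.
split.
  by apply: eq_integrable iQ => // y _ /=; rewrite E.
under eq_Rintegral do rewrite E.
rewrite -EQ; apply: le_trans (ler_norm _) _.
apply: le_trans (Rint_abs_le mK (integrable_nrm iK) _) _ => //.
apply: le_trans leK _; rewrite RintegralZl//.
by rewrite integral_moll// mulr1.
Qed.
End mollified_variation.

Section doubled.
Context {R : realType}.
Local Notation TR := (measurableTypeR R).
Local Notation leb := (@lebesgue_measure R).
Local Notation leb2 := (prodm leb leb).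
Local Notation leb4 := (prodm leb2 leb2).
Local Notation T4 := ((TR * TR) * (TR * TR))%type.

Variables (f : R -> R) (L : R).
Hypothesis fL : forall x y, `|f x - f y| <= L * `|x - y|.
Hypothesis f0 : f 0 = 0.
Variables (u v A A' B B' : R -> R -> R) (mu mv bu bv k1 k2 M lo hi : R).
Hypotheses (pu : l1path mu u) (pv : l1path mv v) (tvu : forall t, (TV (u t) <= bu%:E)%E).
Hypotheses (tvv : forall t, (TV (v t) <= bv%:E)%E).
Hypotheses (cA : coefficient M A A') (cB : coefficient M B B').
Hypothesis hk1 : forall t x, `|A t x - B t x| <= k1.
Hypothesis hk2 : forall t x, `|A' t x - B' t x| <= k2.
Hypotheses (Ku : kruzkov lo hi f u A A') (Kv : kruzkov lo hi f v B B').
Variables (d e : R).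
Hypotheses (d0 : 0 < d) (e0 : 0 < e).

Let g a (Z : T4) : R := `|u Z.1.1 Z.1.2 - v Z.2.1 Z.2.2| * moll e (Z.1.2 - Z.2.2)
  * (moll d (Z.1.1 - a) * moll d (Z.2.1 - a)).
Let dg a (Z : T4) : R := `|u Z.1.1 Z.1.2 - v Z.2.1 Z.2.2| *
    moll e (Z.1.2 - Z.2.2) * ('D_1 (moll d) (Z.1.1 - a) * moll d (Z.2.1 - a)
                            + moll d (Z.1.1 - a) * 'D_1 (moll d) (Z.2.1 - a)).
Let G a := \int[leb4]_Z g a Z.

Let m11 : measurable_fun [set: T4] (fun Z => Z.1.1).
Proof. exact: measurableT_comp. Qed.
Let m12 : measurable_fun [set: T4] (fun Z => Z.1.2).
Proof. exact: measurableT_comp. Qed.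
Let m21 : measurable_fun [set: T4] (fun Z => Z.2.1).
Proof. exact: measurableT_comp. Qed.
Let m22 : measurable_fun [set: T4] (fun Z => Z.2.2).
Proof. exact: measurableT_comp. Qed.
Let mU : measurable_fun [set: T4] (fun Z => u Z.1.1 Z.1.2).
Proof. by have [h _ _] := pu; exact: (measurableT_comp h measurable_fst). Qed.
Let mV : measurable_fun [set: T4] (fun Z => v Z.2.1 Z.2.2).
Proof. by have [h _ _] := pv; exact: (measurableT_comp h measurable_snd). Qed.
Let mabs : measurable_fun [set: T4] (fun Z => `|u Z.1.1 Z.1.2 - v Z.2.1 Z.2.2|).
Proof. exact: (measurableT_comp (@normr_measurable R setT) (measurable_funB mU mV)). Qed.
Let mw : measurable_fun [set: T4] (fun Z => moll e (Z.1.2 - Z.2.2)).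
Proof. exact: (measurableT_comp (@measurable_moll R e) (measurable_funB m12 m22)). Qed.
Let mt1 a : measurable_fun [set: T4] (fun Z => moll d (Z.1.1 - a)).
Proof. exact: (measurableT_comp (@measurable_moll R d) (measurable_funB m11 (measurable_cst a))). Qed.
Let mt2 a : measurable_fun [set: T4] (fun Z => moll d (Z.2.1 - a)).
Proof. exact: (measurableT_comp (@measurable_moll R d) (measurable_funB m21 (measurable_cst a))). Qed.

Let mg a : measurable_fun setT (g a).
Proof. exact: measurable_funM (measurable_funM mabs mw) (measurable_funM (mt1 a) (mt2 a)). Qed.

Let is_derive_g (a : R) Z : is_derive (a : R) 1 (g^~ Z) (- dg a Z).
Proof.
have D (t : R) : is_derive a 1 (fun a : R => moll d (t - a)) (- 'D_1 (moll d) (t - a)).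
  have E : (fun a : R => moll d (t - a)) = (fun a => moll d (a - t)).
    by apply/funext => b; rewrite -mollN opprB.
  rewrite E -moll_deriveN opprB.
  have := @is_derive1_comp _ (moll d) (fun y => y - t) a ('D_1 (moll d) (a - t)) 1.
  by rewrite mulr1; apply; [exact: moll_derive|exact: is_derive_shift].
have := is_deriveZ (`|u Z.1.1 Z.1.2 - v Z.2.1 Z.2.2| * moll e (Z.1.2 - Z.2.2))
  (is_deriveM (D Z.1.1) (D Z.2.1)).
move=> H; apply: is_derive_eq H _.
by rewrite /dg /GRing.scale/=; ring.
Qed.

Let large : exists n : nat, `|lo| + `|hi| + d + e + 3 <= n%:R.
Proof.
exists (Num.truncn (`|lo| + `|hi| + d + e + 3)).+1.
by apply/ltW; exact: truncnS_gt.
Qed.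

Let g_dom : exists n C, forall a, lo + d < a < hi - d -> forall Z : T4,
  `|g a Z| <= C * dom u v n Z /\ `|dg a Z| <= C * dom u v n Z.
Proof.
have [n hn] := large; exists n.
have [Kd [Kd0 D1 D2 _]] := moll_bounds d; have [Ke [Ke0 E1 _ _]] := moll_bounds e.
exists (Kd * Kd * Ke * 1 + Kd * Kd * Ke * 1) => a ha.
have S1 t := moll_tent d0 e0 hn t ha D1.
have S2 t := dmoll_tent d0 e0 hn t ha D2.
have S3 x := w_tent d0 hn x E1.
have uvC (Z : T4) : `| `|u Z.1.1 Z.1.2 - v Z.2.1 Z.2.2| | <= 1 * (`|u Z.1.1 Z.1.2| + `|v Z.2.1 Z.2.2|).
  by rewrite normr_id mul1r; exact: ler_normB.
have h1 := dom_prod (al := fun t => moll d (t - a)) (be := fun t => moll d (t - a)) S1 S1 S3 uvC.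
have h2 := dom_prod (al := fun t => 'D_1 (moll d) (t - a)) (be := fun t => moll d (t - a)) S2 S1 S3 uvC.
have h3 := dom_prod (al := fun t => moll d (t - a)) (be := fun t => 'D_1 (moll d) (t - a)) S1 S2 S3 uvC.
move=> Z; have := h1 Z; have := h2 Z; have := h3 Z.
set q := Kd * Kd * Ke * 1 * _ => H3 H2 H1; rewrite mulrDl -/q.
have q0 : 0 <= q by apply: le_trans H1.
split.
  apply: le_trans (_ : _ <= q) _; last by rewrite lerDl.
  by apply: le_trans H1; rewrite le_eqVlt; apply/orP; left; apply/eqP; congr (Num.norm _); rewrite /g; ring.
rewrite (_ : dg a Z = 'D_1 (moll d) (Z.1.1 - a) * moll d (Z.2.1 - a) * moll e (Z.1.2 - Z.2.2) *
     `|u Z.1.1 Z.1.2 - v Z.2.1 Z.2.2| + moll d (Z.1.1 - a) * 'D_1 (moll d) (Z.2.1 - a) *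
     moll e (Z.1.2 - Z.2.2) * `|u Z.1.1 Z.1.2 - v Z.2.1 Z.2.2|); last by rewrite /dg; ring.
by apply: le_trans (ler_normD _ _) _; exact: lerD.
Qed.

Let kappa := (k1 + M * (2 * d + e)) * L * bu + (k2 + M * (2 * d + e)) * (L * mu).

(** Differentiation under the integral sign; a single multiple of [dom] majorises the derivatives
    for all centres in the open interval. *)
Let G_derive (a : R) : lo + d < a < hi - d -> derivable G a 1 /\ G^`() a <= kappa.
Proof.
move=> ha; have [n [C H]] := g_dom; have [n' hn] := large.
have Ia : `]lo + d, hi - d[%classic a by rewrite /= in_itv/=.
have ig x : `]lo + d, hi - d[%classic x -> leb4.-integrable setT (EFin \o g x).
  rewrite /= in_itv/= => hx.
  by have [] := dom_bound pu pv (mg x) (fun Z => (H x hx Z).1).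
have C0 : 0 <= C * 0 by rewrite mulr0.
have iD : leb4.-integrable setT (EFin \o (fun Z : T4 => `|C * dom u v n Z|)).
  by apply: integrable_nrm; apply: (integrable_scale C); exact: dom_int pu pv.
have pE x Z : partial1of2 g x Z = - dg x Z.
  by rewrite partial1of2E; have [_ ->] := is_derive_g x Z.
have hb x (Z : T4) : `]lo + d, hi - d[%classic x -> [set: T4] Z -> `|partial1of2 g x Z| <= `|C * dom u v n Z|.
  rewrite /= in_itv/= => hx _; rewrite pE normrN.
  by apply: le_trans (H x hx Z).2 _; exact: ler_norm.
have hd x (Z : T4) : `]lo + d, hi - d[%classic x -> [set: T4] Z -> derivable (g^~ Z) x 1.
  by move=> _ _; have [] := is_derive_g x Z.
have dG := derivable_under_integral measurableT Ia ig hd (fun Z => normr_ge0 _) iD hb.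
have EG := differentiation_under_integral measurableT Ia ig hd (fun Z => normr_ge0 _) iD hb.
split; first exact: dG.
rewrite EG.
have [i1 h1] := doubled_derivative fL f0 pu pv tvu cA cB hk1 hk2 Ku Kv d0 e0 hn ha.
under eq_Rintegral do rewrite pE.
rewrite (_ : \int[leb4]_Z - dg a Z = - \int[leb4]_Z dg a Z); first by rewrite lerNl.
rewrite -mulN1r -(Rint_scale _ i1).
by apply: eq_Rintegral => Z _; rewrite mulN1r.
Qed.

Lemma doubled_growth a1 a2 : lo + d < a1 -> a1 <= a2 -> a2 < hi - d ->
  G a2 - G a1 <= kappa * (a2 - a1).
Proof.
exact: derive_growth G_derive.
Qed.

(** Replacing u(t, x) by u(a, x) and v(s, y) by v(a, y) costs [eta] each, and then v(a, y) by v(a,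
    x) costs [bv * e]. The kernel now integrates to 1 and leaves exactly the distance at time a.
    This is the only use of the variation of [v]. *)
Lemma doubled_close a eta : lo + d < a < hi - d ->
  (forall t, `|t - a| < d -> \int[leb]_x `|u t x - u a x| <= eta) ->
  (forall t, `|t - a| < d -> \int[leb]_x `|v t x - v a x| <= eta) ->
  `|G a - \int[leb]_x `|u a x - v a x| | <= 2 * eta + bv * e.
Proof.
move=> ha hu hv.
have [mu' iu _] := pu; have [mv' iv _] := pv.
have [imd Emd] := moll_shift_int a d0.
have ime := integrable_moll e.
have md : measurable_fun [set: TR] (fun t : TR => moll d (t - a)) by exact: integrable_measurable imd.
have mtime (q : R -> R -> R) m : l1path m q -> (forall t, `|t - a| < d -> \int[leb]_x `|q t x - q a x| <= eta) ->
    leb2.-integrable setT (EFin \o (fun z : TR * TR => moll d (z.1 - a) * `|q z.1 z.2 - q a z.2|)) /\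
    \int[leb2]_z (moll d (z.1 - a) * `|q z.1 z.2 - q a z.2|) <= eta.
  move=> [mq iq _] hq.
  have mm : measurable_fun [set: TR * TR] (fun z : TR * TR => moll d (z.1 - a) * `|q z.1 z.2 - q a z.2|).
    apply: measurable_funM; first exact: (measurableT_comp md measurable_fst).
    apply: (measurableT_comp (@normr_measurable R setT)); apply: measurable_funB => //.
    by apply: (measurableT_comp (integrable_measurable (iq a)) measurable_snd).
  have i0 (t : R) : leb.-integrable setT (EFin \o (fun x : TR => `|q t x - q a x|)).
    by apply: integrable_nrm; apply: integrable_sub.
  have := @prod_bound1 _ _ TR TR R leb leb _ (fun t => eta * moll d (t - a)) mm.
  move=> [].
  - by move=> t /=; apply: (@integrable_scale _ TR R leb (moll d (t - a))); exact: i0.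
  - move=> t /=; under eq_Rintegral do rewrite normrM normr_id.
    rewrite (Rint_scale _ (i0 _)).
    rewrite ger0_norm ?moll_ge0// mulrC.
    have [td|dt] := leP d `|t - a|; first by rewrite (moll_out td) !mulr0.
    by rewrite ler_wpM2r ?moll_ge0// hq.
  - exact: (integrable_scale eta imd).
  - move=> i1 h1; split=> //; apply: le_trans (ler_norm _) _.
    apply: le_trans (Rint_abs_le mm (integrable_nrm i1) _) _ => //.
    by apply: le_trans h1 _; rewrite RintegralZl// Emd mulr1.
have [iu2 uE] := mtime u mu pu hu; have [iv2 vE] := mtime v mv pv hv.
have {}uE : \int[leb4]_Z (moll d (Z.1.1 - a) * `|u Z.1.1 Z.1.2 - u a Z.1.2| *
    (moll d (Z.2.1 - a) * moll e (Z.1.2 - Z.2.2))) <= eta.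
  by have [_ ->] := weight1 iu2 imd ime (mollN e); rewrite Emd integral_moll// !mulr1.
have [{}iu2 _] := weight1 iu2 imd ime (mollN e).
have {}vE : \int[leb4]_Z (moll d (Z.2.1 - a) * `|v Z.2.1 Z.2.2 - v a Z.2.2| *
    (moll d (Z.1.1 - a) * moll e (Z.1.2 - Z.2.2))) <= eta.
  by have [_ ->] := weight2 iv2 imd ime (mollN e); rewrite Emd integral_moll// !mulr1.
have [{}iv2 _] := weight2 iv2 imd ime (mollN e).
have [iQ EQ] := mollified_TV e0 (iv a) (tvv a).
(* The cost of moving from y to x in v(a, .), to be integrated by [mollified_TV]. *)
pose X (Z : T4) := moll d (Z.1.1 - a) * moll d (Z.2.1 - a) * (moll e (Z.1.2 - Z.2.2) * `|v a Z.2.2 - v a Z.1.2|).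
have mva := integrable_measurable (iv a).
have mX : measurable_fun setT X.
  apply: measurable_funM; first exact: measurable_funM (mt1 a) (mt2 a).
  apply: measurable_funM; first exact: mw.
  apply: (measurableT_comp (@normr_measurable R setT)); apply: measurable_funB.
    exact: (measurableT_comp mva m22).
  exact: (measurableT_comp mva m12).
have iy (y : R) : leb.-integrable setT (EFin \o (fun x : TR => moll e (x - y) * `|v a y - v a x|)).
  have [Ke [Ke0 E1 _ _]] := moll_bounds e.
  have [imy _] := moll_shift_int y e0.
  have my := integrable_measurable imy.
  apply: (@integrable_bound _ TR R leb _ (fun x => `|v a y| * moll e (x - y) + Ke * `|v a x|)).
  - apply: measurable_funM => //; apply: (measurableT_comp (@normr_measurable R setT)).
    by apply: measurable_funB => //; exact: measurable_cst.
  - apply: integrable_add; first exact: (integrable_scale _ imy).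
    by apply: (@integrable_scale _ TR R leb Ke (fun h : TR => `|v a h|)); exact: integrable_nrm.
  - move=> x; rewrite normrM normr_id.
    have m0 := moll_ge0 e0 (x - y); rewrite (ger0_norm m0).
    apply: le_trans (ler_wpM2l m0 (ler_normB _ _)) _; rewrite mulrDr [X in X + _]mulrC lerD2l.
    by rewrite ler_wpM2r//; have := E1 (x - y); rewrite ger0_norm.
have [itQ EtQ] := integrable_tensor imd iQ.
have sX (z' : TR * TR) := integrable_tensor (integrable_scale (moll d (z'.1 - a)) imd) (iy z'.2).
have XE Z : X Z = moll d (Z.2.1 - a) * moll d (Z.1.1 - a) * (moll e (Z.1.2 - Z.2.2) * `|v a Z.2.2 - v a Z.1.2|).
  by rewrite /X; ring.
have X0 Z : 0 <= X Z by rewrite /X; apply: mulr_ge0; apply: mulr_ge0 => //; exact: moll_ge0.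
have [iX leX] : leb4.-integrable setT (EFin \o X) /\ \int[leb4]_Z X Z <= bv * e.
  have := @prod_bound2 _ _ _ _ R leb2 leb2 X (fun z' => moll d (z'.1 - a) * \int[leb]_x (moll e (x - z'.2) * `|v a z'.2 - v a x|)) mX.
  move=> [].
  - move=> z'; have [h _] := sX z'; apply: eq_integrable h => // z _ /=.
    by rewrite XE.
  - move=> z'; have [_ h] := sX z'.
    rewrite (_ : \int[leb2]_z `|X (z, z')| = \int[leb2]_z (moll d (z'.1 - a) * moll d (z.1 - a) * (moll e (z.2 - z'.2) * `|v a z'.2 - v a z.2|))); last first.
      by apply: eq_Rintegral => z _; rewrite ger0_norm// XE.
    by rewrite h RintegralZl// Emd mulr1.
  - exact: itQ.
  - move=> i1 h1; split=> //.
    have E : \int[leb4]_Z X Z = \int[leb4]_Z `|X Z| by apply: eq_Rintegral => Z _; rewrite ger0_norm.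
    by rewrite E; apply: le_trans h1 _; rewrite EtQ Emd mul1r.
have idiff : leb.-integrable setT (EFin \o (fun x : TR => `|u a x - v a x|)).
  by apply: integrable_nrm; exact: integrable_sub.
have [itn Etn] := integrable_tensor imd idiff.
have [iN EN] := weight1 itn imd ime (mollN e).
rewrite Etn Emd integral_moll// !mulr1 mul1r in EN; rewrite -EN.
have [n [C H]] := g_dom.
have [ig _ _] := dom_bound pu pv (mg a) (fun Z => (H a ha Z).1).
rewrite -RintegralB//.
apply: (@le_trans _ _ (\int[leb4]_Z (moll d (Z.1.1 - a) * `|u Z.1.1 Z.1.2 - u a Z.1.2| *
    (moll d (Z.2.1 - a) * moll e (Z.1.2 - Z.2.2)) + moll d (Z.2.1 - a) * `|v Z.2.1 Z.2.2 - v a Z.2.2| *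
    (moll d (Z.1.1 - a) * moll e (Z.1.2 - Z.2.2)) + X Z))); last first.
  rewrite RintegralD//; last exact: integrable_add.
  rewrite RintegralD//; apply: le_trans (lerD (lerD uE vE) leX) _.
  by rewrite -mulr2n mulr_natl.
apply: Rint_abs_le.
- exact: (integrable_measurable (integrable_sub ig iN)).
- by apply: integrable_add => //; exact: integrable_add.
move=> Z; set a1 := moll d (Z.1.1 - a); set a2 := moll d (Z.2.1 - a); set w := moll e (Z.1.2 - Z.2.2).
have p0 : 0 <= a1 * a2 * w by apply: mulr_ge0; [apply: mulr_ge0|]; exact: moll_ge0.
rewrite /g /X -/a1 -/a2 -/w.
rewrite (_ : _ - _ = a1 * a2 * w * (`|u Z.1.1 Z.1.2 - v Z.2.1 Z.2.2| - `|u a Z.1.2 - v a Z.1.2|)); last by ring.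
rewrite (_ : _ + _ + _ = a1 * a2 * w * (`|u Z.1.1 Z.1.2 - u a Z.1.2| + `|v Z.2.1 Z.2.2 - v a Z.2.2| + `|v a Z.2.2 - v a Z.1.2|)); last by ring.
rewrite normrM (ger0_norm p0) ler_wpM2l//.
apply: le_trans (ler_dist_dist _ _) _.
rewrite (_ : _ - _ = (u Z.1.1 Z.1.2 - u a Z.1.2) - (v Z.2.1 Z.2.2 - v a Z.2.2) - (v a Z.2.2 - v a Z.1.2)); last by ring.
apply: le_trans (ler_normB _ _) _; rewrite lerD2r.
exact: ler_normB.
Qed.

End doubled.

(** * Stability with respect to the coefficient *)

Lemma le_small (R : realType) (x y C : R) : 0 <= C ->
  (forall s, 0 < s -> s <= 1 -> x <= y + s * C) -> x <= y.
Proof.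
move=> C0 H; apply/ler_addgt0Pr => eps eps0.
have C1 : 0 < C + 1 by rewrite ltr_wpDl.
pose s := Num.min 1 (eps / (C + 1)).
have s0 : 0 < s by rewrite lt_min ltr01 divr_gt0.
have s1 : s <= 1 by rewrite ge_min lexx.
have s2 : s * (C + 1) <= eps by rewrite -ler_pdivlMr// ge_min lexx orbT.
apply: le_trans (H s s0 s1) _; rewrite lerD2l; apply: le_trans s2.
by rewrite ler_wpM2l ?(ltW s0)// lerDl.
Qed.

Lemma margins (R : realFieldType) (lo hi a1 a2 d : R) : lo < a1 -> a1 <= a2 -> a2 < hi ->
  d <= (a1 - lo) / 2 -> d <= (hi - a2) / 2 -> (lo + d < a1 < hi - d) /\ (lo + d < a2 < hi - d).
Proof. by move=> *; split; apply/andP; split; lra. Qed.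

Lemma le_diff_close (R : realFieldType) (x1 x2 g1 g2 e K : R) :
  - e <= g2 - x2 -> g1 - x1 <= e -> g2 - g1 <= K -> x2 - x1 <= 2 * e + K.
Proof. by move=> *; lra. Qed.

Section stability.
Context {R : realType}.
Local Notation TR := (measurableTypeR R).
Local Notation leb := (@lebesgue_measure R).
Local Notation leb2 := (prodm leb leb).

Definition l1continuous (u : R -> R -> R) : Prop :=
  forall t s, 0 < s -> exists2 r, 0 < r &
    forall t', `|t' - t| < r -> \int[leb]_x `|u t' x - u t x| <= s.

Lemma l1dist_le (u v u' v' : R -> R) :
  leb.-integrable setT (EFin \o u) -> leb.-integrable setT (EFin \o v) ->
  leb.-integrable setT (EFin \o u') -> leb.-integrable setT (EFin \o v') ->
  \int[leb]_x `|u x - v x| <=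
  \int[leb]_x `|u' x - v' x| + \int[leb]_x `|u' x - u x| + \int[leb]_x `|v' x - v x|.
Proof.
move=> iu iv iu' iv'.
have i a b : leb.-integrable setT (EFin \o a) -> leb.-integrable setT (EFin \o b) ->
    leb.-integrable setT (EFin \o (fun x : TR => `|a x - b x|)).
  by move=> ia ib; apply: integrable_nrm; exact: integrable_sub.
have i1 := i _ _ iu' iv'; have i2 := i _ _ iu' iu; have i3 := i _ _ iv' iv.
rewrite -RintegralD// -RintegralD//; last exact: integrable_add.
apply: Rint_le; [exact: i|by apply: integrable_add => //; exact: integrable_add|move=> x].
rewrite (_ : u x - v x = (u' x - v' x) - (u' x - u x) + (v' x - v x)); last by ring.
apply: le_trans (ler_normD _ _) _; rewrite lerD2r; exact: ler_normB.
Qed.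

Variables (f : R -> R) (L : R).
Hypothesis fL : forall x y, `|f x - f y| <= L * `|x - y|.
Hypothesis f0 : f 0 = 0.
Variables (u v A A' B B' : R -> R -> R) (mu mv bu bv k1 k2 M lo hi : R).
Hypotheses (pu : l1path mu u) (pv : l1path mv v) (tvu : forall t, (TV (u t) <= bu%:E)%E).
Hypotheses (tvv : forall t, (TV (v t) <= bv%:E)%E).
Hypotheses (uc : l1continuous u) (vc : l1continuous v).
Hypotheses (cA : coefficient M A A') (cB : coefficient M B B').
Hypothesis hk1 : forall t x, `|A t x - B t x| <= k1.
Hypothesis hk2 : forall t x, `|A' t x - B' t x| <= k2.
Hypotheses (Ku : kruzkov lo hi f u A A') (Kv : kruzkov lo hi f v B B').

Let n a := \int[leb]_x `|u a x - v a x|.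
Let kappa := k1 * L * bu + k2 * (L * mu).

Let L0 : 0 <= L.
Proof. by have := le_trans (normr_ge0 _) (fL 1 0); rewrite subr0 normr1 mulr1. Qed.
Let M0 : 0 <= M.
Proof. by have [_ h _ _ _] := cA; exact: le_trans (normr_ge0 _) (h 0 0). Qed.
Let mu0 : 0 <= mu.
Proof. by have [_ _ h] := pu; apply: le_trans (h 0); exact: Rintegral_ge0. Qed.
Let tv_ge0 (w : R -> R -> R) b m : l1path m w -> (forall t, (TV (w t) <= b%:E)%E) -> 0 <= b.
Proof.
move=> [_ h _] tvw.
have := TV_shift 1 (h 0) (tvw 0); rewrite normr1 mulr1; apply: le_trans.
exact: Rintegral_ge0.
Qed.
Let bu0 : 0 <= bu. Proof. exact: tv_ge0 pu tvu. Qed.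
Let bv0 : 0 <= bv. Proof. exact: tv_ge0 pv tvv. Qed.
Let k10 : 0 <= k1. Proof. exact: le_trans (normr_ge0 _) (hk1 0 0). Qed.
Let k20 : 0 <= k2. Proof. exact: le_trans (normr_ge0 _) (hk2 0 0). Qed.
Let kappa0 : 0 <= kappa.
Proof. by rewrite /kappa addr_ge0// !mulr_ge0. Qed.

Let growth_inside a1 a2 : lo < a1 -> a1 <= a2 -> a2 < hi -> n a2 - n a1 <= kappa * (a2 - a1).
Proof.
move=> h1 h2 h3.
have a120 : 0 <= a2 - a1 by rewrite subr_ge0.
(* Total error per unit of s when e = s and d <= s: [doubled_close] at two times costs 2 (2 s + bv
   s), and 2 d + e <= 3 s in the growth rate. *)
have C0 : 0 <= 4 + 2 * bv + 3 * M * (L * bu + L * mu) * (a2 - a1).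
  have q1 : 0 <= L * bu by exact: mulr_ge0. have q2 : 0 <= L * mu by exact: mulr_ge0.
  have q3 : 0 <= 3 * M * (L * bu + L * mu) * (a2 - a1) by rewrite mulr_ge0// mulr_ge0 ?addr_ge0// mulr_ge0.
  by have := bv0; lra.
apply: (le_small C0) => s s0 s1.
have [r1 r10 u1] := uc a1 s0; have [r2 r20 u2] := uc a2 s0.
have [r3 r30 v1] := vc a1 s0; have [r4 r40 v2] := vc a2 s0.
(* Small enough for the L^1 modulus s of u and v at both times, and for keeping both times at
   distance more than d from [lo] and [hi]. *)
pose d := Num.min s (Num.min (Num.min (Num.min r1 r2) (Num.min r3 r4)) (Num.min ((a1 - lo) / 2) ((hi - a2) / 2))).
have d0 : 0 < d by rewrite /d !lt_min s0 r10 r20 r30 r40/=; apply/andP; split; lra.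
have : d <= d by []. rewrite {2}/d !le_min => /andP[ds /andP[/andP[/andP[dr1 dr2] /andP[dr3 dr4]] /andP[d1 d2]]].
have [ha1 ha2] := margins h1 h2 h3 d1 d2.
have G := doubled_growth fL f0 pu pv tvu cA cB hk1 hk2 Ku Kv d0 s0 _ h2 _.
have {G} := G _ _; move: (ha1) (ha2) => /andP[x1 _] /andP[_ x2] => /(_ x1 x2).
have := doubled_close pu pv tvv d0 s0 ha1 (fun t h => u1 t (lt_le_trans h dr1)) (fun t h => v1 t (lt_le_trans h dr3)).
have := doubled_close pu pv tvv d0 s0 ha2 (fun t h => u2 t (lt_le_trans h dr2)) (fun t h => v2 t (lt_le_trans h dr4)).
rewrite -/(n a1) -/(n a2); set g2 := Rintegral _ _ _; set g1 := Rintegral _ _ _.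
rewrite !ler_norml => /andP[p1 p2] /andP[p3 p4] p5.
have : (k1 + M * (2 * d + s)) * L * bu + (k2 + M * (2 * d + s)) * (L * mu) <= kappa + s * (3 * M * (L * bu + L * mu)).
  have -> : (k1 + M * (2 * d + s)) * L * bu + (k2 + M * (2 * d + s)) * (L * mu) =
     kappa + (2 * d + s) * (M * (L * bu + L * mu)) by rewrite /kappa; ring.
  rewrite lerD2l (_ : s * _ = 3 * s * (M * (L * bu + L * mu))); last by ring.
  apply: ler_wpM2r; first by rewrite mulr_ge0// addr_ge0// mulr_ge0.
  by rewrite (_ : 3 * s = 2 * s + s); [rewrite lerD2r; exact: ler_wpM2l|ring].
move=> /(ler_wpM2r a120); rewrite [X in _ <= X -> _]mulrDl.
set K := kappa * _; set Q := s * _ * _; move: p5; set Q' := _ * (a2 - a1) => p5 p6.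
have -> : s * (4 + 2 * bv + 3 * M * (L * bu + L * mu) * (a2 - a1)) =
  2 * (2 * s + bv * s) + Q by rewrite /Q; ring.
by have := le_diff_close p1 p4 (le_trans p5 p6); rewrite addrCA.
Qed.

(** The estimate at interior times lo + d and b - d passes to the end points by L^1 continuity; the
    four moduli, of u and v at either end, give the error 4 s. *)
Lemma kruzkov_stability b : lo <= b <= hi -> n b <= n lo + kappa * (b - lo).
Proof.
move=> /andP[b1 b2]; have [<-|lb] := eqVneq lo b; first by rewrite subrr mulr0 addr0.
have {}b1 : lo < b by rewrite lt_neqAle lb.
have [_ iu _] := pu; have [_ iv _] := pv.
apply: (@le_small _ _ _ 4) => // s s0 s1.
have [r1 r10 u1] := uc lo s0; have [r2 r20 u2] := uc b s0.
have [r3 r30 v1] := vc lo s0; have [r4 r40 v2] := vc b s0.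
pose m := Num.min (Num.min (Num.min r1 r2) (Num.min r3 r4)) (b - lo).
have m0 : 0 < m by rewrite !lt_min r10 r20 r30 r40/=; lra.
have : m <= m by []. rewrite {2}/m !le_min => /andP[/andP[/andP[dr1 dr2] /andP[dr3 dr4]] d1].
pose d := m / 3; have d0 : 0 < d by rewrite divr_gt0.
have d3 : 3 * d = m by rewrite /d mulrC divfK//; lra.
have e1 : `|lo + d - lo| = d by rewrite addrAC subrr add0r gtr0_norm.
have e2 : `|b - d - b| = d by rewrite addrAC subrr add0r normrN gtr0_norm.
have h1 : lo < lo + d by lra. have h2 : lo + d <= b - d by lra. have h3 : b - d < hi by lra.
have := growth_inside h1 h2 h3.
have c1 : `|lo + d - lo| < r1 by rewrite e1; lra. have c2 : `|b - d - b| < r2 by rewrite e2; lra.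
have c3 : `|lo + d - lo| < r3 by rewrite e1; lra. have c4 : `|b - d - b| < r4 by rewrite e2; lra.
have := l1dist_le (iu b) (iv b) (iu (b - d)) (iv (b - d)).
have := l1dist_le (iu (lo + d)) (iv (lo + d)) (iu lo) (iv lo).
have := u1 _ c1; have := u2 _ c2; have := v1 _ c3; have := v2 _ c4.
have dist (w : R -> R -> R) t t' : \int[leb]_x `|w t x - w t' x| = \int[leb]_x `|w t' x - w t x| :> R.
  by apply: eq_Rintegral => x _; rewrite distrC.
rewrite (dist u (lo + d)) (dist v (lo + d)) -/(n _) -/(n _) -/(n _) -/(n _).
have : kappa * (b - d - (lo + d)) <= kappa * (b - lo) by apply: ler_wpM2l => //; lra.
by rewrite /n; lra.
Qed.
End stability.

Section smooth_step.
Context {R : realType}.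
Local Notation TR := (measurableTypeR R).
Local Notation leb := (@lebesgue_measure R).
Variable d : R.
Hypothesis d0 : 0 < d.

Definition step (x : R) : R := \int[leb]_(t in `]-oo, x]) moll d t.

Lemma step_derive (x : R) : is_derive x 1 step (moll d x).
Proof.
have x1 : x < x + 1 by rewrite ltrDl.
have ig1 : leb.-integrable `]-oo, (x + 1)] (EFin \o moll d).
  by apply: integrableS (integrable_moll d).
have := @continuous_FTC1 R (moll d) -oo%O x (x + 1) x1 ig1.
move=> /= /(_ _ (@continuous_moll _ d x)) []; first exact: ltNyr.
move=> dG dGE.
by rewrite derive1E in dGE; exact: DeriveDef dG dGE.
Qed.

Lemma Cn_step n : Cn n step.
Proof. by apply: CnW; exact: (CnS_R step_derive (Cn_moll d n)). Qed.

Lemma stepE x : step x = \int[leb]_t (moll d \_ `]-oo, x]) t.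
Proof. by rewrite /step Rintegral_mkcond. Qed.

Let istep (x : R) : leb.-integrable setT (EFin \o (moll d \_ `]-oo, x])).
Proof.
rewrite -restrict_EFin -integrable_mkcond//.
by apply: integrableS (integrable_moll d).
Qed.

Lemma step_mono x y : x <= y -> step x <= step y.
Proof.
move=> xy; rewrite !stepE; apply: Rint_le => // t; rewrite !patchE.
case: ifPn; rewrite ?inE/= ?in_itv/= => tx.
  by rewrite ifT// inE/= in_itv/= (le_trans tx).
by case: ifPn => // _; exact: moll_ge0.
Qed.

Lemma step0 x : x <= - d -> step x = 0.
Proof.
move=> xd; rewrite stepE [RHS](_ : 0 = \int[leb]_t (cst 0 t)); last by rewrite Rintegral_cst// mul0r.
apply: eq_Rintegral => t _; rewrite patchE; case: ifPn => //; rewrite inE/= in_itv/= => tx.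
apply: moll_out; have := ler_norm (- t); rewrite normrN; lra.
Qed.

Lemma step1 x : d <= x -> step x = 1.
Proof.
move=> xd; rewrite stepE -(integral_moll d0).
apply: eq_Rintegral => t _; rewrite patchE; case: ifPn => //.
rewrite notin_setE/= in_itv/= => /negP; rewrite -ltNge => tx.
by rewrite moll_out//; have := ler_norm t; lra.
Qed.

Lemma step_ge0 x : 0 <= step x.
Proof.
have -> : 0 = step (Num.min x (- d)) by rewrite step0// ge_min lexx orbT.
by apply: step_mono; rewrite ge_min lexx.
Qed.

Lemma step_le1 x : step x <= 1.
Proof.
have <- : step (Num.max x d) = 1 by rewrite step1// le_max lexx orbT.
by apply: step_mono; rewrite le_max lexx.
Qed.

Lemma step_shift_derive c (x : R) : is_derive x 1 (fun x => step (x + c)) (moll d (x + c)).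
Proof.
have := @is_derive1_comp _ step (fun y => y + c) x (moll d (x + c)) 1.
by rewrite mulr1; apply; [exact: step_derive|exact: is_derive_shift].
Qed.

Lemma Cn_step_shift n c : Cn n (fun x => step (x + c)).
Proof.
apply: (@Cn_affine _ _ _ (fun t : R => t + c) id); last exact: Cn_step.
- by move=> h v b; rewrite addrA.
- by move=> x; apply: continuousD; [exact: id|exact: cst_continuous].
Qed.
End smooth_step.

(** * Initial trace and mass *)

Section initial_trace.
Context {R : realType}.
Local Notation TR := (measurableTypeR R).
Local Notation leb := (@lebesgue_measure R).
Local Notation leb2 := (prodm leb leb).

(* In contrast with [kruzkov], the test functions need not vanish at t = 0. *)
Definition kruzkov_init (T : R) (f : R -> R) (u0 : R -> R) (u A A' : R -> R -> R) : Prop :=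
  forall (al : R) (chi psi : R -> R) a b d,
  (forall n, Cn n chi) -> (forall n, Cn n psi) ->
  (forall t, 0 <= chi t) -> (forall x, 0 <= psi x) ->
  (forall t, ~~ (a <= t <= b) -> chi t = 0) -> b < T ->
  (forall x, d <= `|x| -> psi x = 0) ->
  0 <= \int[leb2]_z (\1_`]0%R, T[ z.1 * (`|u z.1 z.2 - al| * 'D_1 chi z.1 * psi z.2
     + Num.sg (u z.1 z.2 - al) * A z.1 z.2 * (f (u z.1 z.2) - f al) * chi z.1 * 'D_1 psi z.2
     - f al * Num.sg (u z.1 z.2 - al) * A' z.1 z.2 * chi z.1 * psi z.2))
     + chi 0 * \int[leb]_x (`|u0 x - al| * psi x).

Lemma derive_out_itv (chi : R -> R) c r t : (forall t, ~~ (c <= t <= r) -> chi t = 0) ->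
  ~~ (c <= t <= r) -> 'D_1 chi t = 0.
Proof.
move=> h ht; have : \forall s \near t, cst 0 s = chi s.
  have [tc|ct] := ltP t c.
    by near=> s; rewrite h// negb_and -ltNge; apply/orP; left; near: s; exact: lt_nbhsl.
  have tr : r < t by move: ht; rewrite ct/= -ltNge.
  by near=> s; rewrite h// negb_and -!ltNge; apply/orP; right; near: s; exact: lt_nbhsr.
move=> /near_eq_derive <-; exact: derive_cst.
Unshelve. all: by end_near. Qed.

Lemma kruzkov_init_kruzkov T f u0 u A A' : kruzkov_init T f u0 u A A' -> kruzkov 0 T f u A A'.
Proof.
move=> K al chi psi c r d C1 C2 p1 p2 h1 c0 rT h2.
have := K al chi psi c r d C1 C2 p1 p2 h1 rT h2.
rewrite [chi 0]h1 ?mul0r ?addr0; last by rewrite negb_and -ltNge c0.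
set I1 := Rintegral _ _ _; set I2 := Rintegral _ _ _; suff -> : I1 = I2 by [].
apply: eq_Rintegral => z _; rewrite indicE; case: (boolP (z.1 \in _)) => zT.
  by rewrite mul1r.
have hz : ~~ (c <= z.1 <= r).
  apply: contra zT => /andP[cz zr]; rewrite inE/= in_itv/= (lt_le_trans c0 cz).
  exact: le_lt_trans rT.
by rewrite mul0r (derive_out_itv h1 hz) h1// !(mulr0, mul0r) subr0 addr0.
Qed.

Variables (f : R -> R) (L : R).
Hypothesis fL : forall x y, `|f x - f y| <= L * `|x - y|.
Variables (u A A' : R -> R -> R) (u0 : R -> R) (mu M T : R).
Hypotheses (pu : l1path mu u) (iu0 : leb.-integrable setT (EFin \o u0)).
Hypothesis uc : l1continuous u.
Hypotheses (cA : coefficient M A A').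
Hypotheses (T0 : 0 < T) (Ku : kruzkov_init T f u0 u A A').
Variables (al : R) (psi : R -> R) (D K0 K1 : R).
Hypotheses (Cpsi : forall n, Cn n psi) (psi0 : forall x, 0 <= psi x).
Hypothesis psiD : forall x, D <= `|x| -> psi x = 0.
Hypotheses (bpsi : forall x, psi x <= K0) (bdpsi : forall x, `|'D_1 psi x| <= K1).

Let L0 : 0 <= L.
Proof. by have := le_trans (normr_ge0 _) (fL 1 0); rewrite subr0 normr1 mulr1. Qed.
Let M0 : 0 <= M.
Proof. by have [_ h _ _ _] := cA; exact: le_trans (normr_ge0 _) (h 0 0). Qed.
Let mu0 : 0 <= mu.
Proof. by have [_ _ h] := pu; apply: le_trans (h 0); exact: Rintegral_ge0. Qed.
Let K00 : 0 <= K0. Proof. exact: le_trans (psi0 0) (bpsi 0). Qed.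
Let K10 : 0 <= K1. Proof. exact: le_trans (normr_ge0 _) (bdpsi 0). Qed.

Let cpsi : continuous psi. Proof. exact: Cn_continuous (Cpsi 0). Qed.
Let cdpsi : continuous ('D_1 psi).
Proof. by have [_ _ H] := Cpsi 1; exact: H. Qed.
Let ipsi : leb.-integrable setT (EFin \o psi). Proof. exact: integrable_out psiD. Qed.
Let idpsi : leb.-integrable setT (EFin \o 'D_1 psi).
Proof.
apply: (@integrable_out _ _ (D + 1)) => // x hx.
by apply: (derive_out psiD); apply: lt_le_trans hx; rewrite ltrDl.
Qed.

(** Bounds the flux and source terms tested with [psi] per unit of time, through |u - al| <= |u| +
    |al|. For al = 0 and f(0) = 0 it reduces to M L K1 mu, proportional to the bound [K1] of psi',
    which [mass_bound] exploits. *)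
Let flux := M * (L * (K1 * mu + `|al| * \int[leb]_x `|'D_1 psi x|) + `|f al| * \int[leb]_x psi x).

Let flux_ge0 : 0 <= flux.
Proof.
apply: mulr_ge0 => //; apply: addr_ge0; apply: mulr_ge0 => //; last exact: Rintegral_ge0.
by apply: addr_ge0; apply: mulr_ge0 => //; exact: Rintegral_ge0.
Qed.

Let iw t : leb.-integrable setT (EFin \o (fun x : TR => `|u t x - al| * psi x)).
Proof.
have [_ iu _] := pu; have mut := integrable_measurable (iu t).
have mpsi := integrable_measurable ipsi.
apply: (@integrable_bound _ TR R leb _ (fun x => K0 * `|u t x| + `|al| * psi x)).
- apply: measurable_funM => //; apply: (measurableT_comp (@normr_measurable R setT)).
  by apply: measurable_funB => //; exact: measurable_cst.
- apply: integrable_add; last exact: (integrable_scale _ ipsi).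
  by apply: (@integrable_scale _ TR R leb K0 (fun h : TR => `|u t h|)); exact: integrable_nrm.
- move=> x; rewrite normrM normr_id (ger0_norm (psi0 x)).
  apply: le_trans (ler_wpM2r (psi0 x) (ler_normB _ _)) _; rewrite mulrDl lerD2r mulrC.
  exact: ler_wpM2r.
Qed.

Let trace_step a d s : 0 < d -> d <= 1 -> d < a -> a + d < T ->
  (forall t, `|t - a| < d -> \int[leb]_x `|u t x - u a x| <= s) ->
  \int[leb]_x (`|u a x - al| * psi x) <=
  \int[leb]_x (`|u0 x - al| * psi x) + s * K0 + (a + d) * flux.
Proof.
move=> d0 d1 da adT hs.
have [mu' iu ul] := pu; have [[mA mA'] bA bA' _ _] := cA.
(* The rise is placed near t = -2, outside the domain, and the fall near a. Hence chi(0) = 1, and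
   for t > 0 the derivative is - [moll d (t - a)]. *)
pose chi t := step d (t + 2) - step d (t - a).
have Cchi m : Cn m chi.
  rewrite (_ : chi = (fun t => step d (t + 2)) \+ (fun t => -1 * step d (t - a))).
    by apply: CnD; [|apply: CnZ]; exact: Cn_step_shift.
  by apply/funext => t /=; rewrite mulN1r.
have chi0 t : 0 <= chi t by rewrite subr_ge0; apply: step_mono => //; lra.
have chi1 t : chi t <= 1 by have := step_le1 d0 (t + 2); have := step_ge0 d0 (t - a); rewrite /chi; lra.
have chiout t : ~~ (- 3 <= t <= a + d) -> chi t = 0.
  rewrite negb_and -!ltNge => /orP[h|h]; rewrite /chi.
    by rewrite !step0 ?subrr//; lra.
  by rewrite !step1 ?subrr//; lra.
have dchi t : 0 < t -> 'D_1 chi t = - moll d (t - a).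
  move=> t0; have := is_deriveB (step_shift_derive d 2 t) (step_shift_derive d (- a) t).
  move=> [_ ->]; rewrite [moll d (t + 2)]moll_out ?sub0r//.
  by rewrite gtr0_norm; lra.
have tri (x1 x2 x3 g1 a1 a2 a3 : R) : `|x1 + g1| <= a1 -> `|x2| <= a2 -> `|x3| <= a3 ->
    `|x1 + x2 - x3 + g1| <= a1 + (a2 + a3).
  move=> h1 h2 h3; rewrite (_ : _ + g1 = (x1 + g1) + (x2 - x3)); last by ring.
  apply: le_trans (ler_normD _ _) _; apply: lerD => //.
  by apply: le_trans (ler_normB _ _) _; exact: lerD.
have far0 t : t <= 0 -> d <= `|t - a|.
  by move=> h; rewrite distrC; apply: le_trans (ler_norm _); lra.
have farT t : T <= t -> d <= `|t - a| by move=> h; apply: le_trans (ler_norm _); lra.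
have := Ku al Cchi Cpsi chi0 psi0 chiout adT psiD.
have -> : chi 0 = 1 by rewrite /chi add0r sub0r step1 ?step0 ?subr0//; lra.
rewrite mul1r.
set g := (fun z : TR * TR => _ * (_ + _ - _)); rewrite -/(Rintegral _ _ g).
have [imd Emd] := moll_shift_int a d0.
have md : measurable_fun [set: TR] (fun t : TR => moll d (t - a)) by exact: integrable_measurable imd.
have mpsi := integrable_measurable ipsi.
pose J (t : R) : R := \1_`[0%R, a + d] t.
have iJ : leb.-integrable setT (EFin \o J).
  by apply: integrable_indic_itv.
have EJ : \int[leb]_t J t = a + d.
  rewrite /J /Rintegral integral_indic//= setIT lebesgue_measure_itv/= lte_fin.
  by rewrite ifT; [rewrite oppr0 addr0|lra].
have J0 t : 0 <= J t by rewrite /J indicE; case: (_ \in _).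
(* [G1] carries the wanted value at time a. In g + G1 the time terms cancel up to the oscillation
   [G2] of u near a; [G3] and [G4] majorise the flux and source terms, those with |u| and those with
   the constant level [al]. *)
pose G1 (z : TR * TR) := moll d (z.1 - a) * (`|u a z.2 - al| * psi z.2).
pose G2 (z : TR * TR) := moll d (z.1 - a) * `|u z.1 z.2 - u a z.2|.
pose G3 (z : TR * TR) := J z.1 * `|u z.1 z.2|.
pose G4 (z : TR * TR) := J z.1 * (M * (L * `|al|) * `|'D_1 psi z.2| + M * `|f al| * psi z.2).
have [i1 E1] := integrable_tensor imd (iw a); rewrite Emd mul1r in E1.
have Jn t : `|J t| <= J t by rewrite ger0_norm.
have [i3 E3] := weighted_l1path pu iJ Jn iJ.
have i4' : leb.-integrable setT (EFin \o (fun x => M * (L * `|al|) * `|'D_1 psi x| + M * `|f al| * psi x)).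
  apply: integrable_add; last exact: (integrable_scale _ ipsi).
  apply: (@integrable_scale _ TR R leb _ (fun x : TR => `|'D_1 psi x|)); exact: integrable_nrm.
have [i4 E4] := integrable_tensor iJ i4'.
have [i2 E2] : leb2.-integrable setT (EFin \o G2) /\ \int[leb2]_z G2 z <= s.
  have mm : measurable_fun [set: TR * TR] G2.
    apply: measurable_funM; first exact: (measurableT_comp md measurable_fst).
    apply: (measurableT_comp (@normr_measurable R setT)); apply: measurable_funB => //.
    by apply: (measurableT_comp (integrable_measurable (iu a)) measurable_snd).
  have i0 (t : R) : leb.-integrable setT (EFin \o (fun x : TR => `|u t x - u a x|)).
    by apply: integrable_nrm; apply: integrable_sub.
  have := @prod_bound1 _ _ TR TR R leb leb _ (fun t => s * moll d (t - a)) mm.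
  move=> [].
  - by move=> t /=; apply: (@integrable_scale _ TR R leb (moll d (t - a))); exact: i0.
  - move=> t; rewrite /G2/=; under eq_Rintegral do rewrite normrM normr_id.
    rewrite (Rint_scale _ (i0 _)) ger0_norm ?moll_ge0// mulrC.
    have [td|dt] := leP d `|t - a|; first by rewrite (moll_out td) !mulr0.
    by rewrite ler_wpM2r ?moll_ge0// hs.
  - exact: (integrable_scale s imd).
  - move=> j1 h1; split=> //; apply: le_trans (ler_norm _) _.
    apply: le_trans (Rint_abs_le mm (integrable_nrm j1) _) _ => //.
    by apply: le_trans h1 _; rewrite (Rint_scale _ imd) Emd mulr1.
have P z : `|g z + G1 z| <= K0 * G2 z + M * L * K1 * G3 z + G4 z.
  have q1 : 0 <= M * L by exact: mulr_ge0.
  have p2 : 0 <= K0 * G2 z.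
    by rewrite /G2; apply: mulr_ge0 => //; apply: mulr_ge0 => //; exact: moll_ge0.
  have p3 : 0 <= M * L * K1 * G3 z.
    by rewrite /G3; apply: mulr_ge0; apply: mulr_ge0.
  have p4 : 0 <= G4 z.
    rewrite /G4; apply: mulr_ge0 => //; apply: addr_ge0; apply: mulr_ge0 => //.
      by apply: mulr_ge0 => //; exact: mulr_ge0.
    exact: mulr_ge0.
  rewrite /g indicE; case: (boolP (z.1 \in _)) => zT; last first.
    rewrite mul0r add0r /G1 moll_out ?mul0r ?normr0; first by rewrite !addr_ge0.
    move: zT; rewrite notin_setE/= in_itv/= => /negP; rewrite negb_and -!leNgt => /orP[h|h].
      exact: far0.
    exact: farT.
  move: zT; rewrite inE/= in_itv/= => /andP[t0 tT]; rewrite mul1r dchi//.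
  have cJ : chi z.1 <= J z.1.
    rewrite /J indicE; case: (boolP (z.1 \in _)) => zJ; first exact: chi1.
    rewrite chiout//; move: zJ; apply: contraNN => /andP[_ h].
    by rewrite inE/= in_itv/= h (ltW t0).
  pose U := u z.1 z.2; rewrite -/U.
  have sgM (x y C : R) : `|y| <= C -> `|Num.sg x * y| <= C.
    by move=> h; apply: le_trans h; rewrite normrM ler_piMl// normr_sg; case: (_ != 0).
  have h2 : `|Num.sg (U - al) * A z.1 z.2 * (f U - f al) * chi z.1 * 'D_1 psi z.2| <=
      J z.1 * (M * L * (K1 * `|U| + `|al| * `|'D_1 psi z.2|)).
    rewrite (_ : _ * _ = Num.sg (U - al) * (chi z.1 * (A z.1 z.2 * ((f U - f al) * 'D_1 psi z.2)))); last by ring.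
    apply: sgM; rewrite normrM (ger0_norm (chi0 _)).
    apply: ler_pM => //; rewrite normrM -mulrA; apply: ler_pM => //; rewrite normrM.
    apply: le_trans (ler_wpM2r (normr_ge0 _) (fL _ _)) _; rewrite -mulrA ler_wpM2l//.
    apply: le_trans (ler_wpM2r (normr_ge0 _) (ler_normB _ _)) _; rewrite mulrDl lerD2r.
    by rewrite mulrC ler_wpM2r.
  have h3 : `|f al * Num.sg (U - al) * A' z.1 z.2 * chi z.1 * psi z.2| <=
      J z.1 * (M * `|f al| * psi z.2).
    rewrite (_ : _ * _ = Num.sg (U - al) * (chi z.1 * (A' z.1 z.2 * (f al * psi z.2)))); last by ring.
    apply: sgM; rewrite normrM (ger0_norm (chi0 _)).
    apply: ler_pM => //; rewrite normrM -mulrA; apply: ler_pM => //.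
    by rewrite normrM (ger0_norm (psi0 _)).
  have h1 : `| `|U - al| * - moll d (z.1 - a) * psi z.2 + G1 z| <= K0 * G2 z.
    rewrite /G1 /G2 (_ : _ + _ = (moll d (z.1 - a) * psi z.2) * (`|u a z.2 - al| - `|U - al|)); last by ring.
    rewrite normrM ger0_norm; last by apply: mulr_ge0 => //; exact: moll_ge0.
    rewrite [K0 * _]mulrCA -mulrA; apply: ler_wpM2l; first exact: moll_ge0.
    apply: ler_pM => //; apply: le_trans (ler_dist_dist _ _) _.
    by rewrite (_ : _ - _ = u a z.2 - U) 1?distrC//; ring.
  rewrite -[leRHS]addrA (_ : M * L * K1 * G3 z + G4 z = J z.1 * (M * L * (K1 * `|U| + `|al| * `|'D_1 psi z.2|)) +
     J z.1 * (M * `|f al| * psi z.2)); last by rewrite /G3 /G4 -/U; ring.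
  exact: tri h1 h2 h3.
have mchi : measurable_fun [set: TR] chi by apply: continuous_mfun; exact: Cn_continuous (Cchi 0).
have mdchi : measurable_fun [set: TR] ('D_1 chi).
  by apply: continuous_mfun; have [_ _ H] := Cchi 1; exact: H.
have mdpsi := integrable_measurable idpsi.
have m1 : measurable_fun [set: TR * TR] (fun z => z.1) by exact: measurable_fst.
have m2 : measurable_fun [set: TR * TR] (fun z => z.2) by exact: measurable_snd.
have mum : measurable_fun [set: TR * TR] (fun z => u z.1 z.2 - al).
  by apply: measurable_funB => //; exact: measurable_cst.
have mf : measurable_fun [set: TR] f by apply: continuous_mfun; exact: (lipschitz_continuous fL).
have msg : measurable_fun [set: TR * TR] (fun z => Num.sg (u z.1 z.2 - al)).
  exact: (measurableT_comp (@measurable_sg R) mum).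
have mgg : measurable_fun [set: TR * TR] g.
  apply: measurable_funM.
    have mI : measurable_fun [set: TR] (\1_`]0%R, T[%classic : TR -> R) by exact: measurable_indic.
    exact: (measurableT_comp mI m1).
  apply: measurable_funB; first apply: measurable_funD.
  - apply: measurable_funM; last exact: (measurableT_comp mpsi m2).
    apply: measurable_funM; last exact: (measurableT_comp mdchi m1).
    exact: (measurableT_comp (@normr_measurable R setT) mum).
  - apply: measurable_funM; last exact: (measurableT_comp mdpsi m2).
    apply: measurable_funM; last exact: (measurableT_comp mchi m1).
    apply: measurable_funM; first exact: measurable_funM.
    apply: measurable_funB; first exact: (measurableT_comp mf mu').
    exact: measurable_cst.
  - apply: measurable_funM; last exact: (measurableT_comp mpsi m2).
    apply: measurable_funM; last exact: (measurableT_comp mchi m1).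
    apply: measurable_funM => //; apply: measurable_funM => //; exact: measurable_cst.
have iR : leb2.-integrable setT (EFin \o (fun z => K0 * G2 z + M * L * K1 * G3 z + G4 z)).
  apply: integrable_add => //; apply: integrable_add.
    exact: (integrable_scale _ i2).
  exact: (integrable_scale _ i3).
have ih : leb2.-integrable setT (EFin \o (fun z => g z + G1 z)).
  apply: (integrable_bound _ iR P); apply: measurable_funD => //; exact: (integrable_measurable i1).
have leh : \int[leb2]_z (g z + G1 z) <= K0 * s + (a + d) * flux.
  apply: le_trans (_ : \int[leb2]_z (K0 * G2 z + M * L * K1 * G3 z + G4 z) <= _).
    apply: Rint_le => // z; apply: le_trans (P z); exact: ler_norm.
  rewrite RintegralD//; last first.
    by apply: integrable_add; [exact: (integrable_scale _ i2)|exact: (integrable_scale _ i3)].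
  rewrite RintegralD//; [|exact: (integrable_scale _ i2)|exact: (integrable_scale _ i3)].
  rewrite (Rint_scale _ i2) (Rint_scale _ i3) -addrA; apply: lerD; first exact: ler_wpM2l.
  rewrite E4 EJ RintegralD//; last 2 first.
  - apply: (@integrable_scale _ TR R leb _ (fun x : TR => `|'D_1 psi x|)); exact: integrable_nrm.
  - exact: (integrable_scale _ ipsi).
  rewrite (Rint_scale _ (integrable_nrm idpsi)) (Rint_scale _ ipsi).
  have : \int[leb2]_z G3 z <= mu * (a + d).
    rewrite -EJ; apply: le_trans E3; apply: le_trans (ler_norm _) _.
    by apply: Rint_abs_le => //; [exact: (integrable_measurable i3)|exact: integrable_nrm].
  move=> /(ler_wpM2l (_ : 0 <= M * L * K1)) => h.
  apply: le_trans (lerD (h _) (lexx _)) _; first by rewrite mulr_ge0// mulr_ge0.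
  by rewrite /flux le_eqVlt; apply/orP; left; apply/eqP; ring.
have -> : \int[leb2]_z g z = \int[leb2]_z (g z + G1 z) - \int[leb2]_z G1 z.
  by rewrite -RintegralB//; apply: eq_Rintegral => z _; rewrite addrK.
by rewrite E1; lra.
Qed.

Let G a := \int[leb]_x (`|u a x - al| * psi x).

Let G_lip a b s : \int[leb]_x `|u b x - u a x| <= s -> G a <= G b + s * K0.
Proof.
move=> h; have [_ iu _] := pu.
have i1 : leb.-integrable setT (EFin \o (fun x : TR => `|u b x - u a x|)).
  by apply: integrable_nrm; exact: integrable_sub.
apply: (@le_trans _ _ (G b + K0 * \int[leb]_x `|u b x - u a x|)); last first.
  by rewrite lerD2l mulrC ler_wpM2r.
rewrite -(Rint_scale _ i1) -RintegralD//; last exact: (integrable_scale _ i1).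
apply: Rint_le; [exact: iw|by apply: integrable_add => //; exact: (integrable_scale _ i1)|].
move=> x; rewrite -lerBlDl -mulrBl; apply: le_trans (_ : `|u b x - u a x| * psi x <= _).
  apply: ler_wpM2r => //; apply: le_trans (ler_norm _) _; apply: le_trans (ler_dist_dist _ _) _.
  by rewrite (_ : _ - _ = u a x - u b x) 1?distrC//; ring.
by rewrite mulrC ler_wpM2r.
Qed.

Let trace_inside a : 0 < a < T -> G a <= \int[leb]_x (`|u0 x - al| * psi x) + a * flux.
Proof.
move=> /andP[a0 aT]; have C0 : 0 <= K0 + flux by rewrite addr_ge0.
apply: (le_small C0) => s s0 s1; have [r r0 hr] := uc a s0.
pose m := Num.min (Num.min s r) (Num.min a (T - a)).
have m0 : 0 < m by rewrite !lt_min s0 r0 a0/= subr_gt0.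
have : m <= m by []. rewrite {2}/m !le_min => /andP[/andP[ms mr] /andP[ma mT]].
pose d := m / 2; have d0 : 0 < d by rewrite divr_gt0.
have d2 : 2 * d = m by rewrite /d mulrC divfK//; lra.
have := @trace_step a d s d0 _ _ _ _.
have h1 : d <= 1 by lra. have h2 : d < a by lra. have h3 : a + d < T by lra.
have h4 t : `|t - a| < d -> \int[leb]_x `|u t x - u a x| <= s by move=> h; apply: hr; lra.
move=> /(_ h1 h2 h3 h4); rewrite -/(G a).
have : d * flux <= s * flux by apply: ler_wpM2r => //; lra.
by rewrite mulrDr mulrDl; lra.
Qed.

(** The end times 0 and T are reached from an interior time b close to a, by L^1 continuity; b lies
    to the right or left of a according to the half of [0, T] containing a. At a = 0 this compares
    u(0) with the datum. *)
Lemma initial_trace a : 0 <= a <= T ->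
  \int[leb]_x (`|u a x - al| * psi x) <= \int[leb]_x (`|u0 x - al| * psi x) + a * flux.
Proof.
move=> /andP[a0 aT]; have C0 : 0 <= K0 + flux by rewrite addr_ge0.
apply: (le_small C0) => s s0 s1; have [r r0 hr] := uc a s0.
pose m := Num.min (Num.min s r) T.
have m0 : 0 < m by rewrite !lt_min s0 r0.
have : m <= m by []. rewrite {2}/m !le_min => /andP[/andP[ms mr] mT].
have [b [b0 bT ba bs]] : exists b, [/\ 0 < b, b < T, `|b - a| < r & b <= a + s].
  have [aT2|Ta2] := leP a (T / 2).
    exists (a + m / 3); split; [lra|lra| |lra].
    by rewrite addrAC subrr add0r gtr0_norm ?divr_gt0//; lra.
  exists (a - m / 3); split; [lra|lra| |lra].
  by rewrite addrAC subrr add0r normrN gtr0_norm ?divr_gt0//; lra.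
have := G_lip (hr b ba); have := trace_inside (_ : 0 < b < T).
rewrite b0 bT => /(_ isT).
have : b * flux <= (a + s) * flux by apply: ler_wpM2r.
by rewrite mulrDr mulrDl -/(G a); lra.
Qed.
End initial_trace.

Section almost_everywhere.
Context d (T : measurableType d) (R : realType) (m : {measure set T -> \bar R}).

Lemma ae_imp (P Q : T -> Prop) : (forall x, P x -> Q x) ->
  {ae m, forall x, P x} -> {ae m, forall x, Q x}.
Proof. exact: (@filterS _ _ (ae_filter_ringOfSetsType m) P Q). Qed.

End almost_everywhere.

(** * Mass bound and initial value *)

Section trace_consequences.
Context {R : realType}.
Local Notation TR := (measurableTypeR R).
Local Notation leb := (@lebesgue_measure R).
Local Notation leb2 := (prodm leb leb).

Variables (f : R -> R) (L : R).
Hypothesis fL : forall x y, `|f x - f y| <= L * `|x - y|.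
Variables (u A A' : R -> R -> R) (u0 : R -> R) (mu M T : R).
Hypotheses (pu : l1path mu u) (iu0 : leb.-integrable setT (EFin \o u0)).
Hypothesis uc : l1continuous u.
Hypotheses (cA : coefficient M A A').
Hypotheses (T0 : 0 < T) (Ku : kruzkov_init T f u0 u A A').

Definition cut (x : R) : R := step 1 (x + 2) - step 1 (x - 2).

Lemma Cn_cut n : Cn n cut.
Proof.
rewrite (_ : cut = (fun t => step 1 (t + 2)) \+ (fun t => -1 * step 1 (t - 2))).
  by apply: CnD; [|apply: CnZ]; exact: Cn_step_shift.
by apply/funext => t /=; rewrite mulN1r.
Qed.

Lemma cut_ge0 x : 0 <= cut x.
Proof. by rewrite subr_ge0; apply: step_mono => //; lra. Qed.

Lemma cut_le1 x : cut x <= 1.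
Proof. by have := step_le1 ltr01 (x + 2); have := step_ge0 ltr01 (x - 2); rewrite /cut; lra. Qed.

Lemma cut1 x : `|x| <= 1 -> cut x = 1.
Proof. by rewrite ler_norml => /andP[h1 h2]; rewrite /cut step1 ?step0 ?subr0//; lra. Qed.

Lemma cut_out x : 3 <= `|x| -> cut x = 0.
Proof.
rewrite ler_normr => /orP[h|h]; rewrite /cut; first by rewrite !step1 ?subrr//; lra.
by rewrite !step0 ?subrr//; lra.
Qed.

Lemma cut_derive_bound : exists K, forall x, `|'D_1 cut x| <= K.
Proof.
have [_ _ H] := Cn_cut 1.
have [K [K0 HK]] : exists K, 0 <= K /\ forall x, `|'D_1 cut x| <= K.
  apply: (@continuous_bounded_out _ _ 4); first exact: H.
  by move=> x hx; apply: (derive_out cut_out); lra.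
by exists K.
Qed.

Let L0 : 0 <= L.
Proof. by have := le_trans (normr_ge0 _) (fL 1 0); rewrite subr0 normr1 mulr1. Qed.
Let M0 : 0 <= M.
Proof. by have [_ h _ _ _] := cA; exact: le_trans (normr_ge0 _) (h 0 0). Qed.
Let mu0 : 0 <= mu.
Proof. by have [_ _ h] := pu; apply: le_trans (h 0); exact: Rintegral_ge0. Qed.

(** Take level 0 and the cut-off x -> cut(x / (n+1)). The source term vanishes because f(0) = 0, and
    the flux term is O(1/n) because the derivative of the cut-off is; the tents bound the cut-off
    from below and exhaust the line. *)
Lemma mass_bound a : f 0 = 0 -> 0 <= a <= T -> \int[leb]_x `|u a x| <= \int[leb]_x `|u0 x|.
Proof.
move=> f0 ha; have [_ iu _] := pu; have [K hK] := cut_derive_bound.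
have K0 : 0 <= K := le_trans (normr_ge0 _) (hK 0).
pose c (n : nat) (x : R) := cut (n.+1%:R^-1 * x).
have n0 n : 0 < (n.+1%:R : R) by rewrite ltr0n.
have Cc n m : Cn m (c n).
  apply: (@Cn_affine _ _ _ (fun x : R => n.+1%:R^-1 * x) (fun x : R => n.+1%:R^-1 * x)); last exact: Cn_cut.
  - by move=> h v b; rewrite /GRing.scale/=; ring.
  - exact: mulrl_continuous.
have dc n x : `|'D_1 (c n) x| <= K * n.+1%:R^-1.
  have := @is_derive1_comp _ cut (fun x => n.+1%:R^-1 * x) x ('D_1 cut (n.+1%:R^-1 * x)) n.+1%:R^-1.
  case.
  - exact: (Cn_is_derive _ (Cn_cut 1)).
  - have := is_deriveZ (n.+1%:R^-1) (is_derive_id x (1 : R)).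
    by rewrite /GRing.scale/= mulr1.
  - move=> _ ->; rewrite normrM [X in _ * X]ger0_norm; last by rewrite invr_ge0.
    by apply: ler_wpM2r => //; rewrite invr_ge0.
have cout n x : 3 * n.+1%:R <= `|x| -> c n x = 0.
  move=> h; apply: cut_out; rewrite normrM ger0_norm ?invr_ge0// mulrC.
  by rewrite ler_pdivlMr.
have c1 n x : `|x| <= n.+1%:R -> c n x = 1.
  move=> h; apply: cut1; rewrite normrM ger0_norm ?invr_ge0// mulrC.
  by rewrite ler_pdivrMr// mul1r.
have H n : \int[leb]_x (Num.max 0 (Num.min 1 (n.+1%:R - `|x|)) * `|u a x|) <=
    \int[leb]_x `|u0 x| + a * (M * (L * (K * mu))) * n.+1%:R^-1.
  have [ct ct0 ct1 ctout] := tentP (R := R) n.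
  have ict : leb.-integrable setT (EFin \o (fun x : TR => `|u a x| * Num.max 0 (Num.min 1 (n.+1%:R - `|x|)))).
    apply: (@integrableM_bounded _ _ _ 1).
    - exact: integrable_nrm.
    - exact: continuous_mfun.
    - by move=> x; rewrite ger0_norm.
  have icc g : leb.-integrable setT (EFin \o g) -> leb.-integrable setT (EFin \o (fun x : TR => `|g x| * c n x)).
    move=> ig; apply: (@integrableM_bounded _ _ _ 1).
    - exact: integrable_nrm.
    - by apply: continuous_mfun; exact: Cn_continuous (Cc n 0).
    - by move=> x; rewrite ger0_norm ?cut_ge0// cut_le1.
  have := initial_trace fL pu uc cA T0 Ku 0 (Cc n) (fun x => cut_ge0 _) (cout n) (fun x => cut_le1 _) (dc n) ha.
  rewrite f0 normr0 mul0r mul0r !addr0.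
  rewrite (_ : \int[leb]_x (`|u a x - 0| * c n x) = \int[leb]_x (`|u a x| * c n x)); last first.
    by apply: eq_Rintegral => x _; rewrite subr0.
  rewrite (_ : \int[leb]_x (`|u0 x - 0| * c n x) = \int[leb]_x (`|u0 x| * c n x)); last first.
    by apply: eq_Rintegral => x _; rewrite subr0.
  move=> h.
  have h1 : \int[leb]_x (`|u0 x| * c n x) <= \int[leb]_x `|u0 x|.
    apply: Rint_le; [exact: icc|exact: integrable_nrm|move=> x].
    by rewrite ler_piMr// cut_le1.
  have h2 : \int[leb]_x (Num.max 0 (Num.min 1 (n.+1%:R - `|x|)) * `|u a x|) <= \int[leb]_x (`|u a x| * c n x).
    rewrite (_ : Rintegral _ _ _ = \int[leb]_x (`|u a x| * Num.max 0 (Num.min 1 (n.+1%:R - `|x|)))); last first.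
      by apply: eq_Rintegral => x _; rewrite mulrC.
    apply: Rint_le; [exact: ict|exact: icc|move=> x].
    apply: ler_wpM2l => //; have [hx|h'] := leP `|x| n.+1%:R; first by rewrite c1//; exact: ct1.
    by rewrite ctout ?(ltW h')//; exact: cut_ge0.
  apply: le_trans h2 _; apply: le_trans h _.
  rewrite (_ : a * (M * (L * (K * n.+1%:R^-1 * mu))) = a * (M * (L * (K * mu))) * n.+1%:R^-1); last by ring.
  by rewrite lerD2r.
apply: (ler_cvg_to (tent_limit (iu a)) _ (nearW _ H)).
rewrite -[X in _ --> X]addr0; apply: cvgD; first exact: cvg_cst.
rewrite -[X in _ --> X](mulr0 (a * (M * (L * (K * mu))))).
by apply: cvgM; [exact: cvg_cst|exact: cvg_harmonic].
Qed.

(** For values in [0, 1] the levels 0 and 1 give |u - 0| = u and |u - 1| = 1 - u, so the trace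
    inequalities at these levels are opposite and u(0) and u0 have equal mollifications. The bounded
    variation of both removes the mollification at cost (b + b0) e. *)
Lemma initial_value b b0 : (TV (u 0) <= b%:E)%E -> (TV u0 <= b0%:E)%E ->
  {ae leb, forall x, 0 <= u 0 x <= 1} -> {ae leb, forall x, 0 <= u0 x <= 1} ->
  \int[leb]_x `|u 0 x - u0 x| = 0.
Proof.
move=> tvu tvu0 u01 u001; have [_ iu _] := pu.
have bb (g : R -> R) b' : leb.-integrable setT (EFin \o g) -> (TV g <= b'%:E)%E -> 0 <= b'.
  by move=> ig h; have := TV_shift 1 ig h; rewrite normr1 mulr1; apply: le_trans; exact: Rintegral_ge0.
have B0 : 0 <= b + b0 by rewrite addr_ge0 ?(bb _ _ _ tvu) ?(bb _ _ _ tvu0).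
apply/eqP; rewrite eq_le; apply/andP; split; last exact: Rintegral_ge0.
apply: (le_small B0) => e e0 e1; rewrite add0r.
have ime := integrable_moll e.
have [Ke [Ke0 E1 _ _]] := moll_bounds e.
have [Kd Hd] : exists K, forall x, `|'D_1 (moll e) x| <= K.
  by have [K [_ _ h _]] := moll_bounds e; exists K.
have aeR (g h : R -> R) : leb.-integrable setT (EFin \o g) -> leb.-integrable setT (EFin \o h) ->
    {ae leb, forall x, g x = h x} -> \int[leb]_x g x = \int[leb]_x h x.
  move=> ig ih gh; rewrite /Rintegral; congr fine; apply: ae_eq_integral => //.
  - exact: measurable_int ig.
  - exact: measurable_int ih.
  - by apply: ae_imp gh => x /= -> _.
have imy y : leb.-integrable setT (EFin \o (fun x => moll e (x - y))) by have [] := moll_shift_int y e0.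
have mmy y := integrable_measurable (imy y).
have iMy (g : R -> R) y : leb.-integrable setT (EFin \o g) -> leb.-integrable setT (EFin \o (fun x : TR => g x * moll e (x - y))).
  by move=> ig; apply: (integrableM_bounded ig (mmy y)) => x; exact: E1.
have abs0 (g : R -> R) y : leb.-integrable setT (EFin \o g) -> {ae leb, forall x, 0 <= g x <= 1} ->
    \int[leb]_x (`|g x - 0| * moll e (x - y)) = \int[leb]_x (g x * moll e (x - y)).
  move=> ig g01; apply: aeR; [|exact: iMy|].
    apply: (iMy (fun x => `|g x - 0|)); rewrite (_ : (fun x => `|g x - 0|) = (fun x => `|g x|)).
      exact: integrable_nrm.
    by apply/funext => x; rewrite subr0.
  by apply: ae_imp g01 => x /andP[g0 _]; rewrite subr0 ger0_norm.
have i1g (g : R -> R) y : leb.-integrable setT (EFin \o g) ->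
   leb.-integrable setT (EFin \o (fun x : TR => moll e (x - y) - g x * moll e (x - y))).
  by move=> ig; apply: integrable_sub; [exact: imy|exact: iMy].
have abs1 (g : R -> R) y : leb.-integrable setT (EFin \o g) -> {ae leb, forall x, 0 <= g x <= 1} ->
    \int[leb]_x (`|g x - 1| * moll e (x - y)) = 1 - \int[leb]_x (g x * moll e (x - y)).
  move=> ig g01; have [_ E] := moll_shift_int y e0.
  rewrite -[X in _ = X - _]E -(RintegralB measurableT (imy y) (iMy g y ig)).
  apply: aeR; [|exact: i1g|].
    apply: (@integrable_bound _ TR R leb _ (fun x => `|moll e (x - y) - g x * moll e (x - y)|)).
    - apply: measurable_funM => //; apply: (measurableT_comp (@normr_measurable R setT)).
      by apply: measurable_funB; [exact: (integrable_measurable ig)|exact: measurable_cst].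
    - by apply: integrable_nrm; exact: i1g.
    - move=> x; rewrite normrM normr_id (_ : _ - g x * _ = (1 - g x) * moll e (x - y)); last by ring.
      by rewrite distrC -normrM.
  by apply: ae_imp g01 => x /andP[_ g1]; rewrite distrC ger0_norm ?subr_ge0//; ring.
have key y : \int[leb]_x (u 0 x * moll e (x - y)) = \int[leb]_x (u0 x * moll e (x - y)).
  have Cm n : Cn n (fun x => moll e (x - y)).
    rewrite (_ : (fun x => moll e (x - y)) = (fun x => 1 * moll e (x - y))); first exact: Cn_moll_shift.
    by apply/funext => x; rewrite mul1r.
  have mout x : `|y| + e <= `|x| -> moll e (x - y) = 0.
    by move=> h; apply: moll_out; have := lerB_dist x y; lra.
  have m0 x : 0 <= moll e (x - y) by exact: moll_ge0.
  have mK x : moll e (x - y) <= Ke by apply: le_trans (E1 _); exact: ler_norm.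
  have mD x : `|'D_1 (fun x => moll e (x - y)) x| <= Kd.
    have := @is_derive1_comp _ (moll e) (fun z => z - y) x ('D_1 (moll e) (x - y)) 1.
    case; [exact: moll_derive|exact: is_derive_shift|].
    by move=> _ ->; rewrite mulr1.
  have tr al := initial_trace fL pu uc cA T0 Ku al Cm m0 mout mK mD.
  have h0 : 0 <= (0 : R) <= T by rewrite lexx ltW.
  have := tr 0 0 h0; have := tr 1 0 h0; rewrite !mul0r !addr0 !abs0// !abs1//.
  by rewrite lerD2l lerN2 => h1 h2; apply/eqP; rewrite eq_le h1 h2.
have [i1 l1] := mollified_TV e0 (iu 0) tvu; have [i2 l2] := mollified_TV e0 iu0 tvu0.
have iw : leb.-integrable setT (EFin \o (fun x => u 0 x - u0 x)) by exact: integrable_sub.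
have iterm (g : R -> R) y : leb.-integrable setT (EFin \o g) ->
    leb.-integrable setT (EFin \o (fun x : TR => moll e (x - y) * (g y - g x))).
  move=> ig; rewrite (_ : (fun x => _) = (fun x => g y * moll e (x - y) - g x * moll e (x - y))); last first.
    by apply/funext => x; ring.
  by apply: integrable_sub; [exact: (integrable_scale _ (imy y))|exact: iMy].
have itabs (g : R -> R) y : leb.-integrable setT (EFin \o g) ->
    leb.-integrable setT (EFin \o (fun x : TR => moll e (x - y) * `|g y - g x|)).
  move=> ig; have := integrable_nrm (iterm g y ig).
  rewrite (_ : (fun x => `|_ * _|) = (fun x => moll e (x - y) * `|g y - g x|))//.
  by apply/funext => x; rewrite normrM ger0_norm// moll_ge0.
have pt (y : R) : `|u 0 y - u0 y| <= \int[leb]_x (moll e (x - y) * `|u 0 y - u 0 x|) +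
    \int[leb]_x (moll e (x - y) * `|u0 y - u0 x|).
  have E : u 0 y - u0 y = \int[leb]_x (moll e (x - y) * (u 0 y - u 0 x)) - \int[leb]_x (moll e (x - y) * (u0 y - u0 x)).
    have ex (g : R -> R) : leb.-integrable setT (EFin \o g) -> \int[leb]_x (moll e (x - y) * (g y - g x)) =
        g y - \int[leb]_x (g x * moll e (x - y)).
      move=> ig; rewrite (_ : Rintegral _ _ _ = \int[leb]_x (g y * moll e (x - y) - g x * moll e (x - y))); last first.
        by apply: eq_Rintegral => x _; ring.
      rewrite (RintegralB measurableT (integrable_scale _ (imy y)) (iMy g y ig)).
      by rewrite (Rint_scale _ (imy y)) (moll_shift_int y e0).2 mulr1.
    by rewrite !ex// key; ring.
  rewrite E; apply: le_trans (ler_normB _ _) _; apply: lerD.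
  - apply: Rint_abs_le; [exact: (integrable_measurable (iterm _ y (iu 0)))|exact: itabs|move=> x].
    by rewrite normrM ger0_norm// moll_ge0.
  - apply: Rint_abs_le; [exact: (integrable_measurable (iterm _ y iu0))|exact: itabs|move=> x].
    by rewrite normrM ger0_norm// moll_ge0.
have h := Rint_le (integrable_nrm iw) (integrable_add i1 i2) pt; apply: le_trans h _.
rewrite (RintegralD measurableT i1 i2) mulrDr ![e * _]mulrC; exact: lerD.
Qed.
End trace_consequences.

(** * Nonlocal coefficients *)

Section coordinate_path.
Context {R : realType} {N : nat}.
Implicit Types (x y z : 'rV[R]_N) (g : 'rV[R]_N -> R).

(* A path from x to y changing one coordinate at a time. *)
Definition mixed x y (n : nat) : 'rV[R]_N := \row_j (if (j < n)%N then y ord0 j else x ord0 j).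

Lemma mixed0 x y : mixed x y 0 = x.
Proof. by apply/rowP => j; rewrite mxE ltn0. Qed.

Lemma mixedN x y : mixed x y N = y.
Proof. by apply/rowP => j; rewrite mxE ltn_ord. Qed.

Lemma mixedS x y (i : 'I_N) :
  mixed x y i.+1 = mixed x y i + (y ord0 i - x ord0 i) *: delta_mx ord0 i.
Proof.
apply/rowP => j; rewrite !mxE eqxx/= ltnS leq_eqVlt.
have [->|ji] := eqVneq j i; first by rewrite ltnn eqxx/= mulr1 addrC subrK.
by rewrite -val_eqE/= in ji *; rewrite (negbTE ji)/= mulr0 addr0.
Qed.

Lemma mixed_telescope g x y : g y - g x = \sum_(i < N) (g (mixed x y i.+1) - g (mixed x y i)).
Proof.
have := telescope_sumr (fun i => g (mixed x y i)) (leq0n N).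
by rewrite big_mkord mixed0 mixedN.
Qed.

Lemma norm1_ge0 x : 0 <= norm1 x. Proof. exact: sumr_ge0. Qed.

Lemma norm1_mixed x y i (s : R) : `|s| <= `|y ord0 i - x ord0 i| ->
  norm1 (mixed x y i + s *: delta_mx ord0 i - x) <= norm1 (y - x).
Proof.
move=> hs; apply: ler_sum => j _; rewrite !mxE eqxx/=.
have [->|ji] := eqVneq j i; first by rewrite ltnn mulr1 addrAC subrr add0r.
by rewrite mulr0 addr0; case: ifP => _ //; rewrite subrr normr0.
Qed.

Lemma is_derive_line g x i (s : R) : derivable g (x + s *: delta_mx ord0 i) (delta_mx ord0 i) ->
  is_derive s 1 (fun s => g (x + s *: delta_mx ord0 i)) (partial i g (x + s *: delta_mx ord0 i)).
Proof.
pose l (s : R) := x + s *: delta_mx ord0 i; pose l0 (s : R) : 'rV[R]_N := s *: delta_mx ord0 i.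
have ll0 h v a : l (h *: v + a) = h *: l0 v + l a.
  by rewrite /l /l0 scalerDl scalerA addrCA.
have e1 : l0 1 = delta_mx ord0 i by rewrite /l0 scale1r.
move=> dg; split.
  by apply: (derivable_affine ll0); rewrite e1.
by rewrite (derive_affine ll0) e1.
Qed.

(** One mean value theorem for each axis-parallel segment of [mixed], whose points stay within
    [norm1 (y - x)] of x. With p = 0 this is the Lipschitz bound for the 1-norm, with p the gradient
    at x the second-order expansion. *)
Lemma coordinate_taylor g x y (p : 'I_N -> R) (K : R) :
  (forall i z, derivable g z (delta_mx ord0 i)) ->
  (forall i z, norm1 (z - x) <= norm1 (y - x) -> `|partial i g z - p i| <= K) ->
  `|g y - g x - \sum_i p i * (y ord0 i - x ord0 i)| <= K * norm1 (y - x).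
Proof.
move=> dg hp; rewrite mixed_telescope -sumrB.
rewrite /norm1 mulr_sumr; apply: le_trans (ler_norm_sum _ _ _) _; apply: ler_sum => i _.
set h := y ord0 i - x ord0 i; pose G s := g (mixed x y i + s *: delta_mx ord0 i).
have dG (s : R) : is_derive s 1 G (partial i g (mixed x y i + s *: delta_mx ord0 i)).
  exact: is_derive_line.
have [c [ch E]] := MVT_between 0 (- h) dG.
have -> : g (mixed x y i.+1) = G h by rewrite mixedS.
have -> : g (mixed x y i) = G 0 by rewrite /G scale0r addr0.
rewrite opprK add0r in E; rewrite subr0 normrN in ch.
have -> : G h - G 0 = partial i g (mixed x y i + c *: delta_mx ord0 i) * h.
  by rewrite -opprB E mulrN opprK.
rewrite -mulrBl normrM !mxE -/h; apply: ler_wpM2r => //.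
by apply: hp; exact: norm1_mixed.
Qed.

Lemma coordinate_lipschitz g K : (forall i z, derivable g z (delta_mx ord0 i)) ->
  (forall i z, `|partial i g z| <= K) -> forall x y, `|g x - g y| <= K * norm1 (x - y).
Proof.
move=> dg hK x y; have := @coordinate_taylor g y x (fun=> 0) K dg _.
rewrite big1 ?subr0; last by move=> i _; rewrite mul0r.
by apply => i z _; rewrite subr0.
Qed.

Lemma coordinate_taylor2 g K : (forall i z, derivable g z (delta_mx ord0 i)) ->
  (forall i x y, `|partial i g x - partial i g y| <= K * norm1 (x - y)) -> 0 <= K ->
  forall x y, `|g y - g x - \sum_i partial i g x * (y ord0 i - x ord0 i)| <= K * norm1 (y - x) ^+ 2.
Proof.
move=> dg hK K0 x y; rewrite expr2 mulrA; apply: coordinate_taylor => // i z hz.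
by apply: le_trans (hK _ _ _) _; rewrite ler_wpM2l.
Qed.

End coordinate_path.

Section joint_measurability.
Context {R : realType}.
Local Notation TR := (measurableTypeR R).

(** The set g > a is the countable union, over rationals q and naturals n, of the products of |t -
    q| < 1/(n+1) with g(q, .) > a + M/(n+1). *)
Lemma lipschitz_mfun2 (g : R -> R -> R) M : (forall t s x, `|g t x - g s x| <= M * `|t - s|) ->
  (forall t, measurable_fun [set: TR] (g t)) -> measurable_fun [set: TR * TR] (fun z => g z.1 z.2).
Proof.
move=> gL mg.
have M0 : 0 <= M.
  by have := le_trans (normr_ge0 _) (gL 1 0 0); rewrite subr0 normr1 mulr1.
move=> _; apply: (measurability _ (RGenOInfty.measurableE R)) => //.
move=> _ [_ [a ->] <-]; rewrite setTI.
have incl (t x : R) : a < g t x ->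
    exists q n, `|t - ratr q| < n.+1%:R^-1 /\ a + M * n.+1%:R^-1 < g (ratr q) x.
  move=> ag; have [e e0 eE] : exists2 e : R, 0 < e & (2 * M + 1) * e = g t x - a.
    exists ((g t x - a) / (2 * M + 1)); last by rewrite mulrC divfK//; lra.
    by rewrite divr_gt0 ?subr_gt0//; lra.
  pose n := Num.truncn e^-1.
  have ne : n.+1%:R^-1 < e.
    by rewrite -[ltRHS]invrK ltf_pV2 ?posrE ?invr_gt0//; exact: truncnS_gt.
  have n0 : 0 < (n.+1%:R^-1 : R) by rewrite invr_gt0.
  have [q] : exists q, ratr q \in `]t - n.+1%:R^-1, t + n.+1%:R^-1[%R.
    by apply: rat_in_itvoo; rewrite ltrBlDr -addrA ltrDl addr_gt0.
  rewrite in_itv/= => hq.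
  have tq : `|t - ratr q| < n.+1%:R^-1 by rewrite distrC ltr_distl.
  exists q, n; split => //.
  have := gL t (ratr q) x => h.
  have h4 : M * `|t - ratr q| <= M * n.+1%:R^-1 by rewrite ler_wpM2l// ltW.
  have h5 : M * n.+1%:R^-1 <= M * e by rewrite ler_wpM2l// ltW.
  have h6 : g t x - g (ratr q) x <= M * n.+1%:R^-1 := le_trans (ler_norm _) (le_trans h h4).
  move: h5 h6 eE e0; rewrite mulrDl mul1r -mulrA.
  set p := M / _; set r := M * e; set a1 := g t x; set a2 := g _ x.
  by clearbody p r a1 a2; clear; lra.
pose F (q : rat * nat) : set (TR * TR) :=
  [set t : TR | `|t - ratr q.1| < q.2.+1%:R^-1] `*` (g (ratr q.1) @^-1` `]a + M * q.2.+1%:R^-1, +oo[).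
rewrite (_ : _ @^-1` _ = \bigcup_q F q).
  apply: countable_bigcupT_measurable; first exact: countableP.
  move=> q; apply: measurableX; last first.
    by rewrite -[X in measurable X]setTI; apply: mg => //; exact: measurable_itv.
  rewrite (_ : [set _ | _] = `](ratr q.1 - q.2.+1%:R^-1), (ratr q.1 + q.2.+1%:R^-1)[%classic).
    exact: measurable_itv.
  by apply/seteqP; split => t /=; rewrite in_itv/= ltr_distl.
apply/seteqP; split => [[t x]|[t x] [[q n] _]]/=; rewrite !in_itv/= !andbT; last first.
  move=> [/= h1]; rewrite in_itv/= andbT => h2.
  have h3 := gL (ratr q) t x.
  have h4 : M * `|ratr q - t| <= M * n.+1%:R^-1 by rewrite ler_wpM2l// distrC ltW.
  rewrite -(ltrD2r (M * n.+1%:R^-1)); apply: lt_le_trans h2 _; rewrite -lerBlDl.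
  exact: le_trans (ler_norm _) (le_trans h3 h4).
by move=> /incl[q [n [h1 h2]]]; exists (q, n) => //; split => //=; rewrite in_itv/= andbT.
Qed.
End joint_measurability.

(** * Space-time convolutions *)

Section space_time_convolution.
Context {R : realType}.
Local Notation TR := (measurableTypeR R).
Local Notation leb := (@lebesgue_measure R).
Local Notation leb2 := (prodm leb leb).
Implicit Types (W : R -> R -> R) (Ga k : R -> R) (t s x : R).

(** The nonlocal operator as one integral over the plane; the indicator encodes causality, tau in
    [0, t]. *)
Definition stconv W Ga k t x : R :=
  \int[leb2]_z (W z.1 z.2 * (\1_`[0%R, t] z.1 * Ga (t - z.1) * k (x - z.2))).

Section conv_theory.
Variables (W : R -> R -> R) (m g g1 : R) (Ga : R -> R).
Hypotheses (pW : l1path m W) (iW : leb2.-integrable setT (EFin \o (fun z => W z.1 z.2))).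
Hypotheses (bGa : forall t, `|Ga t| <= g) (lGa : forall t s, `|Ga t - Ga s| <= g1 * `|t - s|).

Let I := \int[leb2]_z `|W z.1 z.2|.

Let g0 : 0 <= g. Proof. exact: le_trans (normr_ge0 _) (bGa 0). Qed.
Let g10 : 0 <= g1.
Proof. by have := le_trans (normr_ge0 _) (lGa 1 0); rewrite subr0 normr1 mulr1. Qed.
Let m0 : 0 <= m.
Proof. by have [_ _ h] := pW; apply: le_trans (h 0); exact: Rintegral_ge0. Qed.
Let I0 : 0 <= I. Proof. exact: Rintegral_ge0. Qed.

Lemma measurable_conv_kernel k t x : measurable_fun [set: TR] k ->
  measurable_fun [set: TR * TR] (fun z => \1_`[0%R, t] z.1 * Ga (t - z.1) * k (x - z.2)).
Proof.
move=> mk.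
have m1 : measurable_fun [set: TR * TR] (fun z => z.1) by exact: measurable_fst.
have m2 : measurable_fun [set: TR * TR] (fun z => z.2) by exact: measurable_snd.
have mG : measurable_fun [set: TR] Ga by apply: continuous_mfun; exact: (lipschitz_continuous lGa).
have mI : measurable_fun [set: TR] (\1_`[0%R, t]%classic : TR -> R) by exact: measurable_indic.
apply: measurable_funM; first apply: measurable_funM.
- exact: (measurableT_comp mI m1).
- by apply: (measurableT_comp mG); apply: measurable_funB => //; exact: measurable_cst.
- by apply: (measurableT_comp mk); apply: measurable_funB => //; exact: measurable_cst.
Qed.

Lemma stconv_kernel_le k t x c z : (forall y, `|k y| <= c) ->
  `|\1_`[0%R, t] z.1 * Ga (t - z.1) * k (x - z.2)| <= g * c.
Proof.
move=> bk; have c0 : 0 <= c := le_trans (normr_ge0 _) (bk 0).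
rewrite indicE; case: (_ \in _); last by rewrite !mul0r normr0 mulr_ge0.
by rewrite mul1r normrM ler_pM.
Qed.

Lemma integrable_conv k t x c : measurable_fun [set: TR] k -> (forall y, `|k y| <= c) ->
  leb2.-integrable setT (EFin \o (fun z => W z.1 z.2 * (\1_`[0%R, t] z.1 * Ga (t - z.1) * k (x - z.2)))).
Proof.
move=> mk bk; have [mW _ _] := pW.
apply: (@integrable_bound _ _ R leb2 _ (fun z => (g * c) * `|W z.1 z.2|)).
- by apply: measurable_funM => //; exact: measurable_conv_kernel.
- apply: (@integrable_scale _ _ R leb2 (g * c) (fun z => `|W z.1 z.2|)); exact: integrable_nrm.
- by move=> z; rewrite normrM mulrC ler_wpM2r// stconv_kernel_le.
Qed.

(** The bound is on the product of [Ga] and [k], not on each factor, so that the sup norm of Theta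
    itself enters the constant. *)
Lemma stconv_le k t x c : measurable_fun [set: TR] k -> 0 <= c ->
  (forall s y, 0 <= s <= t -> `|Ga (t - s) * k y| <= c) -> `|stconv W Ga k t x| <= c * I.
Proof.
move=> mk c0 bc; have [mW _ _] := pW.
have iWa := integrable_nrm iW.
rewrite -(Rint_scale c iWa); apply: Rint_abs_le.
- by apply: measurable_funM => //; exact: measurable_conv_kernel.
- exact: (integrable_scale c iWa).
- move=> z; rewrite normrM mulrC ler_wpM2r//.
  rewrite indicE; case: (boolP (z.1 \in _)) => zt; last by rewrite !mul0r normr0.
  by rewrite mul1r bc//; move: zt; rewrite inE/= in_itv.
Qed.

Lemma stconv_x_lipschitz k t x y c c' : measurable_fun [set: TR] k -> (forall y, `|k y| <= c) ->
  (forall x y, `|k x - k y| <= c' * `|x - y|) ->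
  `|stconv W Ga k t x - stconv W Ga k t y| <= (g * c' * I) * `|x - y|.
Proof.
move=> mk bk lk.
have c'0 : 0 <= c' by have := le_trans (normr_ge0 _) (lk 1 0); rewrite subr0 normr1 mulr1.
have iWa := integrable_nrm iW.
have ix := integrable_conv t x mk bk; have iy := integrable_conv t y mk bk.
rewrite /stconv -(RintegralB measurableT ix iy).
rewrite mulrAC -(Rint_scale _ iWa); apply: Rint_abs_le.
- exact: (integrable_measurable (integrable_sub ix iy)).
- exact: (integrable_scale _ iWa).
move=> z; rewrite -mulrBr -mulrBr normrM mulrC ler_wpM2r//.
rewrite indicE; case: (_ \in _); last by rewrite !mul0r normr0 !mulr_ge0.
rewrite mul1r normrM -mulrA ler_pM//; apply: le_trans (lk _ _) _.
by rewrite (_ : x - z.2 - (y - z.2) = x - y)//; ring.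
Qed.

(** Two effects of increasing the time from s to t: [Ga] changes by at most g1 (t - s) on [0, s],
    and the strip [s, t], of mass at most m (t - s), is added. *)
Lemma stconv_t_lipschitz k t s x c : measurable_fun [set: TR] k -> (forall y, `|k y| <= c) ->
  0 <= s -> 0 <= t ->
  `|stconv W Ga k t x - stconv W Ga k s x| <= (c * (g1 * I + g * m)) * `|t - s|.
Proof.
move=> mk bk; have c0 : 0 <= c := le_trans (normr_ge0 _) (bk 0).
have [mW iWs lW] := pW.
wlog st : s t / s <= t.
  move=> H s0 t0; have [st|ts] := leP s t; first exact: H.
  by rewrite distrC [`|t - s|]distrC; apply: H => //; exact: ltW.
move=> s0 t0; have iWa := integrable_nrm iW.
pose J (r : R) : R := \1_`[s, t] r.
have iJ : leb.-integrable setT (EFin \o J) by apply: integrable_indic_itv.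
have EJ : \int[leb]_r J r = t - s.
  rewrite /J /Rintegral integral_indic//= setIT lebesgue_measure_itv/= lte_fin.
  by case: ltgtP st => // -> _; rewrite subrr.
have J0 r : 0 <= J r by rewrite /J indicE; case: (_ \in _).
have Jn r : `|J r| <= J r by rewrite ger0_norm.
have [i3 E3] := weighted_l1path pW iJ Jn iJ.
have i3' : leb2.-integrable setT (EFin \o (fun z => J z.1 * `|W z.1 z.2|)) by exact: i3.
have ix := integrable_conv t x mk bk; have iy := integrable_conv s x mk bk.
rewrite /stconv -(RintegralB measurableT ix iy).
apply: le_trans (_ : \int[leb2]_z (c * g1 * (t - s) * `|W z.1 z.2| + c * g * (J z.1 * `|W z.1 z.2|)) <= _).
  apply: Rint_abs_le.
  - exact: (integrable_measurable (integrable_sub ix iy)).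
  - by apply: integrable_add; [exact: (integrable_scale _ iWa)|exact: (integrable_scale _ i3')].
  move=> z; rewrite -mulrBr -mulrBl normrM mulrC mulrA -mulrDl ler_wpM2r//.
  rewrite normrM mulrC -!mulrA -mulrDr ler_pM// /J !indicE !mem_setE !in_itv/=.
  have ts0 : 0 <= t - s by rewrite subr_ge0.
  have h1 : 0 <= g1 * (t - s) by rewrite mulr_ge0.
  have [z0|z0] := leP 0 z.1; last first.
    by rewrite (lt_geF (lt_le_trans z0 s0))/= !mul0r subrr normr0 mulr0 addr0.
  have [zs|sz]/= := leP z.1 s.
    rewrite (le_trans zs st) !mul1r; apply: le_trans (lGa _ _) _.
    rewrite (_ : t - z.1 - (s - z.1) = t - s); last by ring.
    by rewrite (ger0_norm ts0) lerDl mulr_ge0.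
  rewrite mul0r subr0 (ltW sz)/=; case: (z.1 <= t); last by rewrite mul0r normr0 mulr0 addr0.
  by rewrite mul1r mulr1; apply: le_trans (bGa _) _; rewrite lerDr.
rewrite RintegralD//; [|exact: (integrable_scale _ iWa)|exact: (integrable_scale _ i3')].
rewrite (Rint_scale _ iWa) (Rint_scale _ i3').
have h : \int[leb2]_z (J z.1 * `|W z.1 z.2|) <= m * (t - s).
  rewrite -EJ; apply: le_trans E3; apply: le_trans (ler_norm _) _.
  by apply: Rint_abs_le => //; [exact: (integrable_measurable i3')|exact: integrable_nrm].
apply: le_trans (lerD (lexx _) (ler_wpM2l _ h)) _; first exact: mulr_ge0.
by rewrite ger0_norm ?subr_ge0// le_eqVlt; apply/orP; left; apply/eqP; rewrite -/I; ring.
Qed.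

(** Taylor's formula for [k], integrated against W, leaves a quadratic remainder. *)
Lemma stconv_derive k k' t x c c' c'' : (forall x, `|k x| <= c) -> (forall x, `|k' x| <= c') ->
  (forall x : R, is_derive x 1 k (k' x)) -> (forall x y, `|k' x - k' y| <= c'' * `|x - y|) ->
  is_derive (x : R) 1 (stconv W Ga k t) (stconv W Ga k' t x).
Proof.
move=> bk bk' dk lk'.
have c''0 : 0 <= c'' by have := le_trans (normr_ge0 _) (lk' 1 0); rewrite subr0 normr1 mulr1.
have mk : measurable_fun [set: TR] k by apply: continuous_mfun; exact: is_derive_continuous dk.
have mk' : measurable_fun [set: TR] k' by apply: continuous_mfun; exact: (lipschitz_continuous lk').
have iWa := integrable_nrm iW.
apply: (@is_derive_quad _ _ _ _ (g * c'' * I)) => h _.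
have ix := integrable_conv t (x + h) mk bk; have iy := integrable_conv t x mk bk.
have i' := integrable_conv t x mk' bk'.
have i'h := integrable_scale h i'.
rewrite /stconv -(RintegralB measurableT ix iy) mulrC -(Rint_scale h i').
rewrite -(RintegralB measurableT (integrable_sub ix iy) i'h).
rewrite mulrAC -(Rint_scale _ iWa); apply: Rint_abs_le.
- exact: (integrable_measurable (integrable_sub (integrable_sub ix iy) i'h)).
- exact: (integrable_scale _ iWa).
move=> z; set J := \1__ _; set G := Ga _.
rewrite (_ : _ - _ = W z.1 z.2 * (J * G * (k (x - z.2 + h) - k (x - z.2) - k' (x - z.2) * h))); last first.
  by rewrite (_ : x + h - z.2 = x - z.2 + h); ring.
rewrite normrM mulrC ler_wpM2r// normrM -mulrA; apply: ler_pM => //.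
  have b1 (y : R) : `|(fun=> 1) y : R| <= 1 by rewrite normr1.
  by have := stconv_kernel_le t x z b1; rewrite !mulr1.
exact: taylor2.
Qed.

End conv_theory.

Lemma stconv_sub W1 W2 Ga k t x m1 m2 g g1 c : l1path m1 W1 -> l1path m2 W2 ->
  leb2.-integrable setT (EFin \o (fun z => W1 z.1 z.2)) ->
  leb2.-integrable setT (EFin \o (fun z => W2 z.1 z.2)) ->
  (forall t, `|Ga t| <= g) -> (forall t s, `|Ga t - Ga s| <= g1 * `|t - s|) ->
  measurable_fun [set: TR] k -> (forall y, `|k y| <= c) ->
  stconv W1 Ga k t x - stconv W2 Ga k t x = stconv (fun t x => W1 t x - W2 t x) Ga k t x.
Proof.
move=> p1 p2 i1 i2 bG lG mk bk.
have j1 := integrable_conv p1 i1 bG lG t x mk bk; have j2 := integrable_conv p2 i2 bG lG t x mk bk.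
rewrite /stconv -(RintegralB measurableT j1 j2); apply: eq_Rintegral => z _.
by rewrite mulrBl.
Qed.
End space_time_convolution.

Section clamp.
Context {R : realType}.
Variable T : R.
Hypothesis T0 : 0 <= T.

(** Nearest-point projection to [0, T]. It extends coefficients and solutions to all times while
    preserving Lipschitz bounds and L^1 continuity in time. *)
Definition clamp (t : R) : R := Num.min T (Num.max 0 t).

Lemma clamp_ge0 t : 0 <= clamp t.
Proof. by rewrite le_min T0 le_max lexx. Qed.

Lemma clamp_le t : clamp t <= T.
Proof. by rewrite ge_min lexx. Qed.

Lemma clamp_id t : 0 <= t <= T -> clamp t = t.
Proof. by move=> /andP[t0 tT]; rewrite /clamp max_r// min_r. Qed.

Lemma clamp_dist t s : `|clamp t - clamp s| <= `|t - s|.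
Proof.
have hmin (a b : R) : `|Num.min T a - Num.min T b| <= `|a - b|.
  wlog ab : a b / b <= a.
    by move=> H; case/orP: (le_total a b) => h; [rewrite distrC [leRHS]distrC|]; exact: H.
  rewrite [leRHS]ger0_norm ?subr_ge0// ler_norml.
  by case: (leP T a) => h1; case: (leP T b) => h2; apply/andP; split; lra.
have hmax (a b : R) : `|Num.max 0 a - Num.max 0 b| <= `|a - b|.
  wlog ab : a b / b <= a.
    by move=> H; case/orP: (le_total a b) => h; [rewrite distrC [leRHS]distrC|]; exact: H.
  rewrite [leRHS]ger0_norm ?subr_ge0// ler_norml.
  by case: (leP 0 a) => h1; case: (leP 0 b) => h2; apply/andP; split; lra.
exact: le_trans (hmin _ _) (hmax _ _).
Qed.
End clamp.

Lemma mulr_diff (R : comNzRingType) (a b c d : R) : a * b - c * d = a * (b - d) + d * (a - c).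
Proof. by ring. Qed.

Section coefficient.
Context {R : realType} {N : nat}.
Local Notation TR := (measurableTypeR R).
Local Notation leb := (@lebesgue_measure R).
Local Notation leb2 := (prodm leb leb).
Variables (T : R) (nu : 'rV[R]_N -> R) (cnu G H : R).
Hypothesis T0 : 0 <= T.
Hypotheses (dnu : forall i z, derivable nu z (delta_mx ord0 i))
  (dpnu : forall i j z, derivable (partial i nu) z (delta_mx ord0 j)).
Hypotheses (bnu : forall z, `|nu z| <= cnu) (bp : forall i z, `|partial i nu z| <= G)
  (bpp : forall i j z, `|partial i (partial j nu) z| <= H) (G0 : 0 <= G) (H0 : 0 <= H).
Variables (k k' Ga : 'I_N -> R -> R) (c c1 c2 g g1 : R).
Hypotheses (bk : forall j x, `|k j x| <= c) (bk' : forall j x, `|k' j x| <= c1)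
  (dk : forall j (x : R), is_derive x 1 (k j) (k' j x))
  (lk' : forall j x y, `|k' j x - k' j y| <= c2 * `|x - y|).
Hypotheses (bGa : forall j t, `|Ga j t| <= g)
  (lGa : forall j t s, `|Ga j t - Ga j s| <= g1 * `|t - s|).
Hypotheses (c0 : 0 <= c) (c10 : 0 <= c1) (g0 : 0 <= g).

Definition nonlocal_conv (W : 'I_N -> R -> R -> R) t x : 'rV[R]_N :=
  \row_j stconv (W j) (Ga j) (k j) (clamp T t) x.
Definition nonlocal_coef W t x : R := nu (nonlocal_conv W t x).
Definition nonlocal_dconv (W : 'I_N -> R -> R -> R) t x j : R :=
  stconv (W j) (Ga j) (k' j) (clamp T t) x.
Definition nonlocal_dcoef W t x : R :=
  \sum_j partial j nu (nonlocal_conv W t x) * nonlocal_dconv W t x j.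

Let mk j : measurable_fun [set: TR] (k j).
Proof. by apply: continuous_mfun; exact: is_derive_continuous (dk j). Qed.
Let mk' j : measurable_fun [set: TR] (k' j).
Proof. by apply: continuous_mfun; exact: lipschitz_continuous (lk' j). Qed.

Let bgk j t s y : 0 <= s <= t -> `|Ga j (t - s) * k' j y| <= g * c1.
Proof. by move=> _; rewrite normrM ler_pM. Qed.

Let lk j x y : `|k j x - k j y| <= c1 * `|x - y|.
Proof. exact: MVT_le (dk j) (bk' j) x y. Qed.

Section one.
Variable (W : 'I_N -> R -> R -> R) (m : R).
Hypotheses (pW : forall j, l1path m (W j))
  (iW : forall j, leb2.-integrable setT (EFin \o (fun z => W j z.1 z.2))).
Let w := nonlocal_conv W.
Let w' := nonlocal_dconv W.

Let conv_lip j (q : R -> R) a b : measurable_fun [set: TR] q -> (forall x, `|q x| <= a) ->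
  (forall x y, `|q x - q y| <= b * `|x - y|) ->
  exists Q, 0 <= Q /\ forall t s x y,
   `|stconv (W j) (Ga j) q (clamp T t) x - stconv (W j) (Ga j) q (clamp T s) y| <= Q * (`|t - s| + `|x - y|).
Proof.
move=> mq bq lq; have a0 : 0 <= a := le_trans (normr_ge0 _) (bq 0).
have m0 : 0 <= m by have [_ _ h] := pW j; apply: le_trans (h 0); exact: Rintegral_ge0.
have g10 : 0 <= g1.
  by have := le_trans (normr_ge0 _) (lGa j 1 0); rewrite subr0 normr1 mulr1.
have b0 : 0 <= b by have := le_trans (normr_ge0 _) (lq 1 0); rewrite subr0 normr1 mulr1.
set I := \int[leb2]_z `|W j z.1 z.2|.
have I0 : 0 <= I by exact: Rintegral_ge0.
have p1 : 0 <= a * (g1 * I + g * m) by rewrite mulr_ge0// addr_ge0// mulr_ge0.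
have p2 : 0 <= g * b * I by rewrite !mulr_ge0.
exists (a * (g1 * I + g * m) + g * b * I); split; first exact: addr_ge0.
move=> t s x y.
have h1 := stconv_t_lipschitz (pW j) (iW j) (bGa j) (lGa j) x mq bq (clamp_ge0 T0 s) (clamp_ge0 T0 t).
have h2 := stconv_x_lipschitz (pW j) (iW j) (bGa j) (lGa j) (clamp T s) x y mq bq lq.
apply: le_trans (ler_distD (stconv (W j) (Ga j) q (clamp T s) x) _ _) _.
apply: le_trans (lerD (h1) (h2)) _; rewrite -/I mulrDr !mulrDl.
have h3 : a * (g1 * I + g * m) * `|clamp T t - clamp T s| <= a * (g1 * I + g * m) * `|t - s|.
  by rewrite ler_wpM2l// clamp_dist.
have h4 : 0 <= a * (g1 * I + g * m) * `|x - y| by exact: mulr_ge0.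
have h5 : 0 <= g * b * I * `|t - s| by exact: mulr_ge0.
by lra.
Qed.

Let Qex : exists Q, [/\ 0 <= Q,
  forall t s x y, norm1 (w t x - w s y) <= Q * (`|t - s| + `|x - y|),
  forall j t s x y, `|w' t x j - w' s y j| <= Q * (`|t - s| + `|x - y|) &
  forall j t x, `|w' t x j| <= Q].
Proof.
have h1 j := conv_lip j (mk j) (bk j) (lk j).
have h2 j := conv_lip j (mk' j) (bk' j) (lk' j).
pose q1 j := projT1 (cid (h1 j)); pose q2 j := projT1 (cid (h2 j)).
have p1 j : 0 <= q1 j by have [] := projT2 (cid (h1 j)).
have p2 j : 0 <= q2 j by have [] := projT2 (cid (h2 j)).
pose I j := \int[leb2]_z `|W j z.1 z.2|.
have I0 j : 0 <= I j by exact: Rintegral_ge0.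
have gc0 : 0 <= g * c1 by exact: mulr_ge0.
exists (\sum_j q1 j + \sum_j q2 j + \sum_j g * c1 * I j).
have s1 : 0 <= \sum_j q1 j by exact: sumr_ge0.
have s2 : 0 <= \sum_j q2 j by exact: sumr_ge0.
have s3 : 0 <= \sum_j g * c1 * I j by apply: sumr_ge0 => j _; exact: mulr_ge0.
have le_s (q : 'I_N -> R) j : (forall j, 0 <= q j) -> q j <= \sum_j q j.
  by move=> q0; rewrite (bigD1 j)//= lerDl sumr_ge0.
split.
- by rewrite !addr_ge0.
- move=> t s x y; apply: (@le_trans _ _ ((\sum_j q1 j) * (`|t - s| + `|x - y|))).
    rewrite mulr_suml; apply: ler_sum => j _; rewrite !mxE.
    by have [_] := projT2 (cid (h1 j)); apply.
  by rewrite ler_wpM2r ?addr_ge0// -addrA lerDl addr_ge0.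
- move=> j t s x y; apply: (@le_trans _ _ (q2 j * (`|t - s| + `|x - y|))).
    by have [_] := projT2 (cid (h2 j)); apply.
  rewrite ler_wpM2r ?addr_ge0//; apply: le_trans (le_s q2 j p2) _.
  by rewrite [X in _ <= X + _]addrC -addrA lerDl addr_ge0.
- move=> j t x; apply: (@le_trans _ _ (g * c1 * I j)).
    by have := stconv_le (pW j) (iW j) (lGa j) x (mk' j) gc0 (@bgk j (clamp T t)).
  apply: le_trans (le_s (fun j => g * c1 * I j) j _) _ => [i|]; first exact: mulr_ge0.
  by rewrite lerDr addr_ge0.
Qed.

Let lp i x y : `|partial i nu x - partial i nu y| <= H * norm1 (x - y).
Proof. by apply: coordinate_lipschitz => [j z|j z]; [exact: dpnu|exact: bpp]. Qed.
Let lnu x y : `|nu x - nu y| <= G * norm1 (x - y).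
Proof. by apply: coordinate_lipschitz => // j z; exact: bp. Qed.

(** The quantification over all larger [M'] lets two solutions share one constant. *)
Lemma nonlocal_coefficient : exists M, forall M', M <= M' ->
  coefficient M' (nonlocal_coef W) (nonlocal_dcoef W).
Proof.
have [Q [Q0 q1 q2 q3]] := Qex.
pose L1 := G * Q; pose L2 := \sum_(j < N) (G * Q + Q * (H * Q)).
have L10 : 0 <= L1 by exact: mulr_ge0.
have L20 : 0 <= L2 by apply: sumr_ge0 => j _; rewrite addr_ge0// !mulr_ge0.
have A1 t s x y : `|nonlocal_coef W t x - nonlocal_coef W s y| <= L1 * (`|t - s| + `|x - y|).
  by apply: le_trans (lnu _ _) _; rewrite -mulrA ler_wpM2l.
have A2 t s x y : `|nonlocal_dcoef W t x - nonlocal_dcoef W s y| <= L2 * (`|t - s| + `|x - y|).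
  rewrite /nonlocal_dcoef -sumrB mulr_suml; apply: le_trans (ler_norm_sum _ _ _) _.
  apply: ler_sum => j _.
  rewrite mulr_diff -/(w' t x j) -/(w' s y j).
  apply: le_trans (ler_normD _ _) _; rewrite mulrDl !normrM; apply: lerD.
    by rewrite -mulrA; apply: ler_pM => //; exact: q2.
  rewrite -!mulrA; apply: ler_pM => //; apply: le_trans (lp _ _ _) _.
  by rewrite ler_wpM2l//; exact: q1.
have B2 t x : `|nonlocal_dcoef W t x| <= \sum_(j < N) G * Q.
  apply: le_trans (ler_norm_sum _ _ _) _; apply: ler_sum => j _; rewrite normrM.
  by apply: ler_pM => //; exact: q3.
(* Chain rule by quadratic remainders: [coordinate_taylor2] expands nu around w(t, x), and [taylor2]
   expands each component of w in x. *)
have dA t (x : R) : is_derive x 1 (nonlocal_coef W t) (nonlocal_dcoef W t x).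
  apply: (@is_derive_quad _ _ _ _ (H * Q ^+ 2 + \sum_(j < N) G * Q)) => h _.
  have ty := coordinate_taylor2 dnu lp H0 (w t x) (w t (x + h)).
  have qh : norm1 (w t (x + h) - w t x) <= Q * `|h|.
    by have := q1 t t (x + h) x; rewrite subrr normr0 add0r addrAC subrr add0r.
  have tc j : `|w t (x + h) ord0 j - w t x ord0 j - w' t x j * h| <= Q * h ^+ 2.
    rewrite !mxE; apply: taylor2 => [y|y z].
      exact: (stconv_derive (pW j) (iW j) (bGa j) (lGa j) (clamp T t) y (bk j) (bk' j) (dk j) (lk' j)).
    by have := q2 j t t y z; rewrite subrr normr0 add0r.
  rewrite (_ : _ - _ = (nu (w t (x + h)) - nu (w t x) -
      \sum_j partial j nu (w t x) * (w t (x + h) ord0 j - w t x ord0 j)) +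
      \sum_j partial j nu (w t x) * (w t (x + h) ord0 j - w t x ord0 j - w' t x j * h)); last first.
    rewrite [X in _ = _ + X](_ : _ = \sum_j partial j nu (w t x) * (w t (x + h) ord0 j - w t x ord0 j)
       - (\sum_j partial j nu (w t x) * w' t x j) * h); last first.
      by rewrite mulr_suml -sumrB; apply: eq_bigr => j _; ring.
    by rewrite addrA subrK.
  apply: le_trans (ler_normD _ _) _; rewrite mulrDl; apply: lerD.
    apply: le_trans ty _; rewrite -mulrA -[h ^+ 2]real_normK ?num_real// -exprMn ler_wpM2l//.
    by rewrite lerXn2r// ?nnegrE ?norm1_ge0 ?mulr_ge0.
  apply: le_trans (ler_norm_sum _ _ _) _; rewrite mulr_suml; apply: ler_sum => j _.
  by rewrite normrM -mulrA; apply: ler_pM => //; exact: tc.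
pose M := cnu + L1 + L2 + \sum_(j < N) G * Q.
have cnu0 : 0 <= cnu := le_trans (normr_ge0 _) (bnu 0).
have GQ0 : 0 <= \sum_(j < N) G * Q by apply: sumr_ge0 => j _; exact: mulr_ge0.
exists M => M' MM'.
have lx C q : 0 <= C -> (forall t s x y : R, `|q t x - q s y| <= C * (`|t - s| + `|x - y|)) ->
    measurable_fun [set: TR * TR] (fun z => q z.1 z.2 : R).
  move=> C0 hq; apply: (@lipschitz_mfun2 _ q C).
    by move=> t s x; have := hq t s x x; rewrite subrr normr0 addr0.
  move=> t; apply: continuous_mfun; apply: (@lipschitz_continuous _ _ C) => x y.
  by have := hq t t x y; rewrite subrr normr0 add0r.
split.
- by split; [exact: (lx L1)|exact: (lx L2)].
- by move=> t x; apply: le_trans (bnu _) _; apply: le_trans MM'; rewrite /M; lra.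
- by move=> t x; apply: le_trans (B2 _ _) _; apply: le_trans MM'; rewrite /M; lra.
- split=> t s x y.
    apply: le_trans (A1 _ _ _ _) _; rewrite ler_wpM2r ?addr_ge0//.
    by apply: le_trans MM'; rewrite /M; lra.
  apply: le_trans (A2 _ _ _ _) _; rewrite ler_wpM2r ?addr_ge0//.
  by apply: le_trans MM'; rewrite /M; lra.
- exact: dA.
Qed.
End one.

Section two.
Variables (W V : 'I_N -> R -> R -> R) (m mv Lnu th : R).
Hypotheses (pW : forall j, l1path m (W j)) (pV : forall j, l1path mv (V j))
  (iW : forall j, leb2.-integrable setT (EFin \o (fun z => W j z.1 z.2)))
  (iV : forall j, leb2.-integrable setT (EFin \o (fun z => V j z.1 z.2))).
Hypotheses (Lnu0 : 0 <= Lnu) (hLnu : forall x y, `|nu x - nu y| <= Lnu * norm1 (x - y)).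
Hypotheses (th0 : 0 <= th) (hth : forall j t x, 0 <= t <= T -> `|Ga j t * k j x| <= th).

Let D := \sum_j \int[leb2]_z `|W j z.1 z.2 - V j z.1 z.2|.

Let pWV j : l1path (m + mv) (fun t x => W j t x - V j t x).
Proof.
have [mW iWs lW] := pW j; have [mV iVs lV] := pV j; split.
- exact: measurable_funB.
- by move=> t; exact: integrable_sub.
- move=> t; apply: le_trans (lerD (lW t) (lV t)).
  rewrite -(RintegralD measurableT (integrable_nrm (iWs t)) (integrable_nrm (iVs t))).
  apply: Rint_le => [||x]; last exact: ler_normB.
  + by apply: integrable_nrm; exact: integrable_sub.
  + by apply: integrable_add; exact: integrable_nrm.
Qed.
Let iWV j : leb2.-integrable setT (EFin \o (fun z => W j z.1 z.2 - V j z.1 z.2)).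
Proof. exact: (integrable_sub (iW j) (iV j)). Qed.

Let conv_diff t x : norm1 (nonlocal_conv W t x - nonlocal_conv V t x) <= th * D.
Proof.
rewrite /D mulr_sumr; apply: ler_sum => j _; rewrite !mxE.
rewrite (stconv_sub _ _ (pW j) (pV j) (iW j) (iV j) (bGa j) (lGa j) (mk j) (bk j)).
have := @stconv_le _ _ _ _ _ (pWV j) (iWV j) (lGa j) _ (clamp T t) x th (mk j) th0.
apply => s y /andP[s0 st].
apply: hth; rewrite subr_ge0 st/=; apply: le_trans (clamp_le T t).
by rewrite lerBlDr lerDl.
Qed.

Lemma nonlocal_coef_diff t x : `|nonlocal_coef W t x - nonlocal_coef V t x| <= Lnu * (th * D).
Proof. by apply: le_trans (hLnu _ _) _; rewrite ler_wpM2l. Qed.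

(** Product rule on partial_j nu times w'_j: the change of w'_j is bounded with the gradient of nu,
    giving the second term of C; the change of the partial derivative is bounded with the Hessian
    and multiplies the convolution of V with mu', giving the third term and its factor, the L^1 norm
    of V. *)
Lemma nonlocal_dcoef_diff t x : `|nonlocal_dcoef W t x - nonlocal_dcoef V t x| <=
  G * (g * c1) * D + H * (th * D) * (g * c1) * \sum_j \int[leb2]_z `|V j z.1 z.2|.
Proof.
have gc0 : 0 <= g * c1 by exact: mulr_ge0.
rewrite /nonlocal_dcoef -sumrB /D !mulr_sumr -big_split/=.
apply: le_trans (ler_norm_sum _ _ _) _; apply: ler_sum => j _.
rewrite mulr_diff [X in _ + X]mulrC.
apply: le_trans (ler_normD _ _) _; rewrite !normrM; apply: lerD.
  rewrite -mulrA; apply: ler_pM => //.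
  rewrite /nonlocal_dconv (stconv_sub _ _ (pW j) (pV j) (iW j) (iV j) (bGa j) (lGa j) (mk' j) (bk' j)).
  by have := stconv_le (pWV j) (iWV j) (lGa j) x (mk' j) gc0 (@bgk j (clamp T t)).
rewrite -[leRHS]mulrA; apply: ler_pM => //.
  apply: le_trans (_ : H * norm1 (nonlocal_conv W t x - nonlocal_conv V t x) <= _).
    by apply: coordinate_lipschitz => [i z|i z]; [exact: dpnu|exact: bpp].
  by rewrite -!mulr_sumr; apply: ler_wpM2l => //; exact: conv_diff.
by have := stconv_le (pV j) (iV j) (lGa j) x (mk' j) gc0 (@bgk j (clamp T t)).
Qed.
End two.
End coefficient.

(** * Essential suprema of continuous functions *)

Section essential_bounds.
Context d (T : measurableType d) (R : realType) (m : {measure set T -> \bar R}).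

Lemma Lnorm_oo_ge (f : T -> \bar R) (S : set T) (a : \bar R) : measurable S -> (0 < m S)%E ->
  (forall x, S x -> a <= `|f x|)%E -> (a <= 'N[m]_+oo[f])%E.
Proof.
move=> mS S0 Sf; rewrite unlock /Lnorm.
have T0 : (0 < m [set: T])%E by apply: lt_le_trans S0 _; apply: le_measure; rewrite ?inE.
rewrite T0 leNgt; apply/negP => fa.
have [N [mN N0 NS]] := ess_sup_inf.ess_sup_ge m (abse \o f).
have : (m S <= m N)%E.
  apply: le_measure; rewrite ?inE// => x Sx; apply: NS => /= h.
  by have := lt_le_trans (le_lt_trans h fa) (Sf x Sx); rewrite ltxx.
by rewrite N0 leNgt S0.
Qed.

Lemma Lnorm_oo_le (f : T -> \bar R) (M : \bar R) : (0 <= M)%E -> (forall x, `|f x| <= M)%E ->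
  ('N[m]_+oo[f] <= M)%E.
Proof.
move=> M0 fM; rewrite unlock /Lnorm; case: ifPn => // _.
apply/ess_sup_inf.ess_supP; exists set0; split => //= x /= h.
by apply: h; exact: fM.
Qed.
End essential_bounds.

Section pointwise_bounds.
Context {R : realType}.
Local Notation TR := (measurableTypeR R).
Local Notation leb := (@lebesgue_measure R).

Lemma leb_itv_gt0 (a b : R) : a < b -> (0 < leb (`]a, b[%classic : set TR))%E.
Proof. by move=> ab; rewrite lebesgue_measure_itv/= lte_fin ab lte_fin subr_gt0. Qed.

(** The interval may lie on one side of x, which covers boundary points of [D] such as time 0. *)
Lemma le_Linf (D : set R) (u : R -> R) x :
  (forall eps, 0 < eps -> exists a b, a < b /\
    forall y, a < y < b -> D y /\ `|u x| - eps <= `|u y|) ->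
  (`|u x|%:E <= Linf D u)%E.
Proof.
move=> H; apply/lee_addgt0Pr => eps eps0; have [a [b [ab Hab]]] := H eps eps0.
rewrite -leeBlDr// -EFinB; apply: (@Lnorm_oo_ge _ _ _ _ _ (`]a, b[%classic : set TR)).
- exact: measurable_itv.
- exact: leb_itv_gt0.
- move=> y /=; rewrite in_itv/= => /Hab[Dy uy].
  by rewrite patchE mem_set//= lee_fin.
Qed.

Lemma Linf_le (D : set R) (u : R -> R) M : 0 <= M -> (forall x, D x -> `|u x| <= M) ->
  (Linf D u <= M%:E)%E.
Proof.
move=> M0 uM; apply: Lnorm_oo_le => [|x]; first by rewrite lee_fin.
rewrite /= lee_fin patchE; case: ifPn => [|_]; first by rewrite inE => /uM.
by rewrite normr0.
Qed.

Lemma near_interval (P : R -> Prop) (x : R) : (\forall y \near x, P y) ->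
  exists e, 0 < e /\ forall y, `|x - y| < e -> P y.
Proof. by move=> /nbhs_ballP[e/= e0 eP]; exists e; split => // y xy; exact: eP. Qed.

Lemma continuous_Linf (u : R -> R) x : continuous u -> (`|u x|%:E <= Linf setT u)%E.
Proof.
move=> cu; apply: le_Linf => eps eps0.
have /near_interval[e [e0 He]] : \forall y \near x, `|u x - u y| < eps.
  by have /cvgrPdist_lt/(_ _ eps0) := cu x.
exists x, (x + e); split; first by rewrite ltrDl.
move=> y /andP[xy ye]; split => //; have := He y _.
rewrite distrC gtr0_norm ?subr_gt0// ltrBlDr addrC => /(_ ye) h.
by have := lerB_dist (u x) (u y); lra.
Qed.

(** Freezing g at g(0) for negative times turns one-sided continuity at 0 into continuity on the
    line; the arbitrary values of g on negative times are discarded. *)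
Lemma halfline_continuous (g : R -> R) : {within `[0%R, +oo[, continuous g} ->
  continuous (fun t : R => g (Num.max 0 t)).
Proof.
move=> /subspace_continuousP H t.
have A0 s : `[0%R, +oo[%classic (Num.max 0 s : R) by rewrite /= in_itv/= andbT le_max lexx.
have := H _ (A0 t) => /cvgrPdist_lt Ht; apply/cvgrPdist_lt => eps eps0.
have := Ht eps eps0; rewrite near_withinE => near1.
have cm : (fun s : R => Num.max 0 s) @ t --> Num.max 0 t.
  by apply: (@continuous_max _ _ (cst 0) id t); [exact: cst_continuous|exact: cvg_id].
have near2 : \forall s \near t, `[0%R, +oo[%classic (Num.max 0 s : R) ->
    `|g (Num.max 0 t) - g (Num.max 0 s)| < eps := cm _ near1.
by move: near2; apply: filterS => s; apply; exact: A0.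
Qed.

Lemma continuous_Linf_halfline (D : set R) (g : R -> R) t :
  continuous (fun t : R => g (Num.max 0 t)) -> 0 <= t -> (forall s, t < s -> D s) ->
  (`|g t|%:E <= Linf D g)%E.
Proof.
move=> cg t0 Dt; apply: le_Linf => eps eps0.
have /near_interval[e [e0 He]] : \forall y \near t, `|g (Num.max 0 t) - g (Num.max 0 y)| < eps.
  by have /cvgrPdist_lt/(_ _ eps0) := cg t.
exists t, (t + e); split; first by rewrite ltrDl.
move=> y /andP[ty ye]; split; first exact: Dt.
have := He y _; rewrite distrC gtr0_norm ?subr_gt0// ltrBlDr addrC => /(_ ye).
rewrite !max_r ?(le_trans t0 (ltW ty))// => h.
by have := lerB_dist (g t) (g y); lra.
Qed.

(** The derivative of g agrees with [g1] on the open half-line, where its sup is finite; the mean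
    value theorem asks for derivatives only inside the interval, so intervals starting at 0 are
    covered. *)
Lemma halfline_lipschitz (g : R -> R) : C2_halfline g -> W2inf_halfline g ->
  exists K, 0 <= K /\ forall t s, `|g (Num.max 0 t) - g (Num.max 0 s)| <= K * `|t - s|.
Proof.
move=> [g1 [_ [cg cg1 _ dg _]]] wg.
have hc1 := halfline_continuous cg1; have hc := halfline_continuous cg.
have fin := wg 1%N isT.
have fin' : (Linf `]0%R, +oo[ g1 < +oo)%E.
  rewrite /Linf (_ : g1 \_ _ = (derive1 g) \_ `]0%R, +oo[)//.
  apply/funext => t; rewrite !patchE; case: ifPn => //; rewrite inE/= in_itv/= andbT => t0.
  by rewrite derive1E; have [_ ->] := dg t t0.
pose K := fine (Linf `]0%R, +oo[ g1).
have L0 : (0 <= Linf `]0%R, +oo[ g1)%E by exact: Lnorm_ge0.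
have finK : Linf `]0%R, +oo[ g1 = K%:E by rewrite fineK// ge0_fin_numE.
have g1K t : 0 < t -> `|g1 t| <= K.
  move=> t0; rewrite -lee_fin -finK; apply: continuous_Linf_halfline => //; first exact: ltW.
  by move=> s ts; rewrite /= in_itv/= andbT (lt_trans t0).
have K0 : 0 <= K by rewrite -lee_fin -finK.
exists K; split => //.
have lip s t : 0 <= s -> s < t -> `|g t - g s| <= K * (t - s).
  move=> s0 st.
  have dgi x : x \in `]s, t[%R -> is_derive x 1 g (g1 x).
    by rewrite in_itv/= => /andP[sx _]; apply: dg; exact: le_lt_trans sx.
  have cst : {within `[s, t], continuous g}.
    apply: continuous_subspaceW cg => x /=; rewrite !in_itv/= andbT => /andP[sx _].
    exact: le_trans sx.
  have [c] := MVT st dgi cst.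
  rewrite in_itv/= => /andP[sc _] ->.
  rewrite normrM [X in _ * X]gtr0_norm ?subr_gt0//.
  by rewrite ler_wpM2r ?subr_ge0 ?(ltW st)// g1K// (le_lt_trans s0).
move=> t s; wlog st : t s / s <= t.
  by move=> H; case/orP: (le_total t s) => h; [rewrite distrC [`|t - s|]distrC|]; exact: H.
rewrite [`|t - s|]ger0_norm ?subr_ge0//.
have ms0 : 0 <= Num.max 0 s by rewrite le_max lexx.
have mst : Num.max 0 s <= Num.max 0 t by rewrite ge_max !le_max lexx/= st orbT.
have mle : Num.max 0 t - Num.max 0 s <= t - s.
  by case: (leP 0 t) => h1; case: (leP 0 s) => h2; lra.
have [->|ne] := eqVneq (Num.max 0 s) (Num.max 0 t).
  by rewrite subrr normr0 mulr_ge0// subr_ge0.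
apply: le_trans (lip _ _ ms0 _) _; first by rewrite lt_neqAle ne.
by rewrite ler_wpM2l.
Qed.

Lemma le_Linf2 (T : R) (u v : R -> R) t x : 0 < T -> continuous u ->
  continuous (fun t : R => v (Num.max 0 t)) -> 0 <= t <= T ->
  (`|u x * v t|%:E <= Linf2 (`[0%R, T] `*` setT) (fun z => (u z.2 * v z.1)%R))%E.
Proof.
move=> T0 cu cv /andP[t0 tT]; apply/lee_addgt0Pr => eps eps0.
have cuv : {for (t, x), continuous (fun z : R * R => u z.2 * v (Num.max 0 z.1))}.
  apply: (@continuousM _ _ (fun z : R * R => u z.2) (fun z : R * R => v (Num.max 0 z.1))).
    by apply: continuous_comp; [exact: cvg_snd|exact: cu].
  by apply: (continuous_comp (g := fun t : R => v (Num.max 0 t))); [exact: cvg_fst|exact: cv].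
have /nbhs_ballP[e/= e0 He] : \forall z \near (t, x), `|u x * v t - u z.2 * v (Num.max 0 z.1)| < eps.
  by have /cvgrPdist_lt/(_ _ eps0) := cuv; rewrite /= max_r.
(* The time interval is taken to the right of t, except at t = T, where it is taken to the left. *)
have [a [b [ab Hab]]] : exists a b, a < b /\ forall s, a < s < b -> 0 <= s <= T /\ `|t - s| < e.
  have [tT'|tT'] := ltP t T.
    exists t, (Num.min T (t + e)); rewrite lt_min tT' ltrDl e0; split => // s.
    rewrite lt_min => /andP[ts /andP[sT se]].
    by rewrite ltr0_norm ?subr_lt0//; split; [apply/andP; split|]; lra.
  exists (Num.max 0 (t - e)), t; rewrite gt_max (lt_le_trans T0 tT')/= gtrBl e0; split => // s.
  rewrite gt_max => /andP[/andP[ts se] sT].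
  by rewrite gtr0_norm ?subr_gt0//; split; [apply/andP; split|]; lra.
rewrite -leeBlDr// -EFinB.
apply: (@Lnorm_oo_ge _ _ _ (leb \x leb)%E _ (`]a, b[%classic `*` `]x, (x + e)[%classic : set (TR * TR))).
- by apply: measurableX; exact: measurable_itv.
- change (0 < (leb \x leb)%E (`]a, b[%classic `*` `]x, (x + e)%R[%classic : set (TR * TR)))%E.
  rewrite product_measure1E; [|exact: measurable_itv|exact: measurable_itv].
  by apply: mule_gt0; apply: leb_itv_gt0 => //; rewrite ltrDl.
- move=> [s y] [/=]; rewrite !in_itv/= => hs /andP[xy ye].
  have [sT ts] := Hab s hs; have s0 : 0 <= s by case/andP: sT.
  have := He (s, y) _; rewrite /= max_r// => h.
  rewrite patchE mem_set/=; last by rewrite in_itv.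
  rewrite lee_fin; have := lerB_dist (u x * v t) (u y * v s).
  suff : `|u x * v t - u y * v s| < eps by lra.
  by apply: h; split => //=; rewrite /ball/= ltr0_norm ?subr_lt0//; lra.
Qed.

Lemma Linf2_le (D : set (R * R)) (u : R * R -> R) M : 0 <= M -> (forall z, D z -> `|u z| <= M) ->
  (Linf2 D u <= M%:E)%E.
Proof.
move=> M0 uM; apply: Lnorm_oo_le => [|x]; first by rewrite lee_fin.
rewrite /= lee_fin patchE; case: ifPn => [|_]; first by rewrite inE => /uM.
by rewrite normr0.
Qed.

(** The ball of the entrywise maximum norm, read on tuples; it is a product of intervals, so its
    measure is accessible by induction on n. *)
Definition box (e : R) n (x : 'I_n -> R) : set (n.-tuple TR) :=
  [set t | forall i, `|x i - tnth t i| < e].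

Lemma measurable_box e n (x : 'I_n -> R) : measurable (box e x).
Proof.
rewrite (_ : box e x = \bigcap_(i in [set: 'I_n])
    ((fun t : n.-tuple TR => tnth t i) @^-1` `]x i - e, x i + e[%classic)).
  apply: fin_bigcap_measurable; first exact: finite_finset.
  move=> i _; rewrite -[X in measurable X]setTI.
  by apply: measurable_tnth => //; exact: measurable_itv.
apply/seteqP; split => t /=.
  by move=> h i _; rewrite /= in_itv/= -ltr_distl distrC.
by move=> h i; have := h i I; rewrite /= in_itv/= -ltr_distl distrC.
Qed.

Lemma box_gt0 e n (x : 'I_n -> R) : 0 < e -> (0 < leb_tuple n (box e x))%E.
Proof.
move=> e0; elim: n x => [|n IH] x.
  rewrite /= diracE mem_set ?lte_fin//= => -[].
  by [].
rewrite /= /cons_measure /pushforward.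
rewrite (_ : _ @^-1` _ = `]x ord0 - e, x ord0 + e[%classic `*` box e (fun i => x (lift ord0 i))).
  rewrite product_measure1E; [|exact: measurable_itv|exact: measurable_box].
  by apply: mule_gt0 => //; apply: leb_itv_gt0; lra.
apply/seteqP; split => -[a t] /=.
  move=> h; split; first by have := h ord0; rewrite /= in_itv/= -ltr_distl distrC.
  by move=> i; have := h (lift ord0 i); rewrite tnthS.
rewrite in_itv/= -ltr_distl => -[h1 h2] i.
have [j ->|->] := unliftP ord0 i; first by rewrite tnthS.
by rewrite distrC.
Qed.

Lemma continuous_Linfn n (g : 'rV[R]_n -> R) z : continuous g -> (`|g z|%:E <= Linfn g)%E.
Proof.
move=> cg; apply/lee_addgt0Pr => eps eps0.
have /nbhs_ballP[e/= e0 He] : \forall y \near z, `|g z - g y| < eps.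
  by have /cvgrPdist_lt/(_ _ eps0) := cg z.
rewrite -leeBlDr// -EFinB.
apply: (@Lnorm_oo_ge _ _ _ (leb_tuple n) _ (box e (fun i => z ord0 i))).
- exact: measurable_box.
- exact: box_gt0.
- move=> t ht; rewrite lee_fin.
  have h : `|g z - g (rowv t)| < eps.
    by apply: He; split => // i j; rewrite ord1 mxE; exact: ht.
  by have := lerB_dist (g z) (g (rowv t)); lra.
Qed.
End pointwise_bounds.

(** * Entropy solutions of the system *)

Section solution_path.
Context {R : realType}.
Local Notation TR := (measurableTypeR R).
Local Notation leb := (@lebesgue_measure R).
Local Notation leb2 := (prodm leb leb).
Variables (T : R) (u : R -> R -> R).
Hypotheses (T0 : 0 < T) (su : solution_space T u).

(* The solution frozen outside [0, T], so that estimates hold for all times. *)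
Definition clamped t := u (clamp T t).

Let T0' : 0 <= T. Proof. exact: ltW. Qed.
Let ct t : 0 <= clamp T t <= T. Proof. by rewrite clamp_ge0// clamp_le. Qed.

Lemma clamped_id t : 0 <= t <= T -> clamped t = u t.
Proof. by move=> h; rewrite /clamped clamp_id. Qed.

Lemma measurable_clamped : measurable_fun [set: TR * TR] (fun z => clamped z.1 z.2).
Proof.
have [mu _ _ _ _] := su.
have mc : measurable_fun [set: TR] (clamp T).
  apply: continuous_mfun; apply: (@lipschitz_continuous _ _ 1) => x y.
  by rewrite mul1r clamp_dist.
have mp : measurable_fun [set: TR * TR] (fun z : TR * TR => (clamp T z.1, z.2)).
  apply: measurable_fun_pair; last exact: measurable_snd.
  exact: (measurableT_comp mc measurable_fst).
apply: (measurable_comp (F := (`[0%R, T] `*` setT : set (TR * TR))) (f := fun z : TR * TR => u z.1 z.2) (g := fun z : TR * TR => (clamp T z.1, z.2))) => //.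
- by apply: measurableX => //; exact: measurable_itv.
- by move=> _ [z _ <-]; split => //=; rewrite in_itv/=.
Qed.

Lemma integrable_clamped t : leb.-integrable setT (EFin \o clamped t).
Proof. by have [_ iu _ _ _] := su; exact: iu. Qed.

Lemma L1norm_Rint (g : R -> R) : leb.-integrable setT (EFin \o g) ->
  L1norm g = (\int[leb]_x `|g x|)%:E.
Proof.
move=> ig; rewrite /L1norm Lnorm1 -Rint_EFin; last exact: integrable_nrm.
by apply: eq_integral.
Qed.

Lemma l1continuous_clamped : l1continuous clamped.
Proof.
move=> t s s0; have [_ iu _ cu _] := su.
have /fine_cvgP[_ h] := cu _ (ct t).
have /cvgrPdist_lt/(_ _ s0) := h; rewrite near_withinE => /near_interval[e [e0 He]].
exists e => // t' tt'.
have := He (clamp T t'); rewrite /= in_itv/= ct => /(_ _ isT).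
rewrite distrC => /(_ (le_lt_trans (clamp_dist T _ _) tt')).
have iuu : leb.-integrable setT (EFin \o (u (clamp T t') \- u (clamp T t))).
  by apply: integrable_sub; exact: iu.
rewrite /= (L1norm_Rint iuu) sub0r normrN/= => hs; apply: ltW.
apply: le_lt_trans hs; exact: ler_norm.
Qed.

Let mass t := \int[leb]_x `|clamped t x|.

Lemma mass_dist t t' : `|mass t - mass t'| <= \int[leb]_x `|clamped t x - clamped t' x|.
Proof.
have i1 := integrable_nrm (integrable_clamped t); have i2 := integrable_nrm (integrable_clamped t').
rewrite /mass -(RintegralB measurableT i1 i2); apply: Rint_abs_le.
- exact: (integrable_measurable (integrable_sub i1 i2)).
- by apply: integrable_nrm; apply: integrable_sub; exact: integrable_clamped.
- by move=> x; exact: ler_dist_dist.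
Qed.

(** The mass is continuous in time and so attains its maximum on [0, T]. This bound is provisional:
    [mass_bound] replaces it by the initial mass. *)
Lemma l1path_clamped : exists m, l1path m clamped.
Proof.
have cm : continuous mass.
  move=> t; apply/cvgrPdist_le => s s0; have [r r0 hr] := l1continuous_clamped t s0.
  near=> t'; rewrite distrC; apply: le_trans (mass_dist _ _) _; apply: hr.
  by near: t'; apply/nbhs_ballP; exists r => // y /=; rewrite /ball/= distrC.
have [c cT hc] := EVT_max T0' (continuous_subspaceT cm).
exists (mass c); split.
- exact: measurable_clamped.
- exact: integrable_clamped.
- move=> t; rewrite -/(mass t).
  have -> : mass t = mass (clamp T t) by rewrite /mass /clamped (clamp_id (ct t)).
  by apply: hc; rewrite in_itv/=.
Unshelve. all: by end_near. Qed.

Lemma TV_clamped t b : (ereal_sup [set TV (u t) | t in `[0%R, T]] <= b%:E)%E -> (TV (clamped t) <= b%:E)%E.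
Proof.
move=> h; apply: le_trans h; apply: ereal_sup_ubound; exists (clamp T t) => //=.
by rewrite in_itv/=.
Qed.

(** Unlike [clamped] it is integrable in space-time, and convolutions at times in [0, T] see no
    difference. *)
Definition truncated t x := \1_`[0%R, T] t * clamped t x.

Lemma l1path_truncated m : l1path m clamped -> l1path m truncated /\
  leb2.-integrable setT (EFin \o (fun z => truncated z.1 z.2)).
Proof.
move=> [mu iu um]; have m0 : 0 <= m by apply: le_trans (um 0); exact: Rintegral_ge0.
have mI : measurable_fun [set: TR] (\1_`[0%R, T]%classic : TR -> R) by exact: measurable_indic.
have mW : measurable_fun [set: TR * TR] (fun z => truncated z.1 z.2).
  by apply: measurable_funM => //; exact: (measurableT_comp mI measurable_fst).
have J01 (t : R) : 0 <= (\1_`[0%R, T] t : R) <= 1.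
  by rewrite indicE; case: (_ \in _); rewrite !lexx ?ler01.
have iW t : leb.-integrable setT (EFin \o truncated t).
  exact: (@integrable_scale _ TR R leb (\1_`[0%R, T] t) (clamped t) (iu t)).
have nW t : \int[leb]_x `|truncated t x| = \1_`[0%R, T] t * \int[leb]_x `|clamped t x|.
  rewrite -(Rint_scale _ (integrable_nrm (iu t))); apply: eq_Rintegral => x _.
  by rewrite normrM ger0_norm//; case/andP: (J01 t).
split; first split => //.
- move=> t; rewrite nW; apply: le_trans (um t); apply: ler_piMl; first exact: Rintegral_ge0.
  by case/andP: (J01 t).
have iJ : leb.-integrable setT (EFin \o (fun t => m * \1_`[0%R, T] t)).
  by apply: (@integrable_scale _ TR R leb m); apply: integrable_indic_itv.
have [] // := @prod_bound1 _ _ TR TR R leb leb _ (fun t => m * \1_`[0%R, T] t) mW _ _ iJ.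
by move=> t; rewrite /= nW mulrC; apply: ler_wpM2r => //; case/andP: (J01 t).
Qed.
End solution_path.

Section nonlocal_term.
Context {R : realType}.
Local Notation TR := (measurableTypeR R).
Local Notation leb := (@lebesgue_measure R).
Local Notation leb2 := (prodm leb leb).

(** Fubini turns the iterated integral into the plane integral; on tau <= t neither the truncation
    nor the maximum with 0 changes the integrand. *)
Lemma nonlocal_stconv (T : R) (u : R -> R -> R) (k Ga : R -> R) m c g g1 t x :
  0 < T -> l1path m (truncated T u) ->
  leb2.-integrable setT (EFin \o (fun z => truncated T u z.1 z.2)) ->
  measurable_fun [set: TR] k -> (forall y, `|k y| <= c) ->
  (forall t, `|Ga (Num.max 0 t)| <= g) ->
  (forall t s, `|Ga (Num.max 0 t) - Ga (Num.max 0 s)| <= g1 * `|t - s|) ->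
  0 <= t <= T ->
  \int[leb]_(tau in `[0, t]) \int[leb]_xi (u tau xi * k (x - xi) * Ga (t - tau)) =
  stconv (truncated T u) (fun t => Ga (Num.max 0 t)) k t x.
Proof.
move=> T0 pW iW mk bk bG lG /andP[t0 tT].
have i2 := integrable_conv pW iW bG lG t x mk bk.
have [mW iWs _] := pW.
have mK := measurable_conv_kernel lG t x mk.
have sec (tau : R) : leb.-integrable setT (fun xi => (truncated T u tau xi *
    (\1_`[0%R, t] tau * Ga (Num.max 0 (t - tau)) * k (x - xi)))%:E).
  apply: (integrableM_bounded (iWs tau)) => [|xi]; first exact: (measurable_fun_pair2 tau mK).
  exact: (stconv_kernel_le bG t x (tau, xi) bk).
rewrite /stconv (prod_int1 i2 sec).2 Rintegral_mkcond.
apply: eq_Rintegral => tau _ /=; rewrite patchE; case: ifPn => ht.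
  move: (ht); rewrite inE/= in_itv/= => /andP[ta tb].
  apply: eq_Rintegral => xi _; rewrite /truncated !indicE ht mem_set/=; last by rewrite in_itv/= ta (le_trans tb).
  rewrite clamped_id; last by rewrite ta (le_trans tb).
  by rewrite max_r ?subr_ge0//; ring.
rewrite [LHS](_ : 0 = \int[leb]_x (cst 0 x)); last by rewrite Rintegral_cst// mul0r.
apply: eq_Rintegral => xi _; rewrite /= [\1_`[0%R, t] tau]indicE (negbTE ht).
by rewrite !mul0r mulr0.
Qed.
End nonlocal_term.

(** * From the entropy inequality of the system to the scalar one *)

Section entropy_inequality.
Context {R : realType}.
Local Notation TR := (measurableTypeR R).
Local Notation leb := (@lebesgue_measure R).
Local Notation leb2 := (prodm leb leb).
Variables (T b : R) (f : R -> R) (L : R) (u u' A A' B : R -> R -> R) (u0 : R -> R) (m M : R).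
Hypothesis fL : forall x y, `|f x - f y| <= L * `|x - y|.
Hypotheses (pu : l1path m u) (iu0 : leb.-integrable setT (EFin \o u0)) (cA : coefficient M A A').
Hypotheses (bT : b <= T) (uu' : forall t, 0 <= t <= b -> u t = u' t)
  (AB : forall t, 0 <= t <= b -> A t = B t).

(** A time factor vanishing after some r < b sees only times before b, where [u] and [A] coincide
    with the solution and its coefficient. In this way the extended objects inherit the inequality,
    and T may be lowered to b. *)
Lemma kruzkov_init_entropy :
  (forall (al : R) phi, test_function T phi ->
    let QT : set (TR * TR) := `]0%R, T[ `*` setT in
    0 <= \int[(leb \x leb)%E]_(z in QT)
           (`|u' z.1 z.2 - al| * 'D_((1, 0) : R * R) phi z)
       + \int[leb]_x (`|u0 x - al| * phi (0, x))
       + \int[(leb \x leb)%E]_(z in QT)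
           (Num.sg (u' z.1 z.2 - al) * B z.1 z.2
            * (f (u' z.1 z.2) - f al) * 'D_((0, 1) : R * R) phi z)
       - \int[(leb \x leb)%E]_(z in QT)
           (f al * Num.sg (u' z.1 z.2 - al) * derive1 (B z.1) z.2 * phi z)) ->
  kruzkov_init b f u0 u A A'.
Proof.
move=> He al chi psi a r d C1 C2 c0 p0 hc rb hp.
have rT : r < T := lt_le_trans rb bT.
have := He al (tensor chi psi) (test_function_tensor C1 C2 hc rT hp c0 p0).
have L0 : 0 <= L by have := le_trans (normr_ge0 _) (fL 1 0); rewrite subr0 normr1 mulr1.
have [[mA mA'] bA bA' _ dA] := cA; have [mu iu um] := pu.
have M0 : 0 <= M := le_trans (normr_ge0 _) (bA 0 0).
pose J (t : R) : R := \1_`]0%R, b[ t.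
have QE (g g' : R * R -> R) : (forall t x, 0 < t < b -> g (t, x) = g' (t, x)) ->
    (forall t x, b <= t -> g (t, x) = 0) ->
    \int[(leb \x leb)%E]_(z in `]0%R, T[ `*` setT) g z = \int[leb2]_z (J z.1 * g' z).
  move=> gg' g0; rewrite Rintegral_mkcond; apply: eq_Rintegral => -[t x] _ /=.
  rewrite patchE /J indicE; have [tb|tb] := boolP (t \in (`]0%R, b[%classic : set R)).
    move: tb; rewrite inE/= in_itv/= => /andP[t0 tb].
    rewrite mem_set/=; last by rewrite in_itv/= t0 (lt_le_trans tb bT).
    by rewrite mul1r gg'// t0.
  rewrite mul0r; case: ifPn => //; rewrite inE/= in_itv/= => -[/andP[t0 _] _].
  apply: g0; rewrite leNgt; apply: contra tb => tb.
  by rewrite inE/= in_itv/= t0.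
have out t : b <= t -> ~~ (a <= t <= r).
  by move=> bt; rewrite negb_and -!ltNge (lt_le_trans rb bt) orbT.
have u'E t x : 0 < t < b -> u' t x = u t x by move=> /andP[t0 tT]; rewrite uu'// !ltW.
have BE t : 0 < t < b -> B t = A t by move=> /andP[t0 tT]; rewrite AB// !ltW.
(* The definition keeps three space-time integrals apart. Real integrals may be added only for
   integrable functions, so each integrand receives its own majorant before they are merged. *)
pose G1 (z : TR * TR) := J z.1 * (`|u z.1 z.2 - al| * 'D_1 chi z.1 * psi z.2).
pose G2 (z : TR * TR) := J z.1 * (Num.sg (u z.1 z.2 - al) * A z.1 z.2 * (f (u z.1 z.2) - f al) * chi z.1 * 'D_1 psi z.2).
pose G3 (z : TR * TR) := J z.1 * (f al * Num.sg (u z.1 z.2 - al) * A' z.1 z.2 * chi z.1 * psi z.2).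
cbv zeta.
rewrite (QE (fun z => `|u' z.1 z.2 - al| * 'D_((1, 0) : R * R) (tensor chi psi) z)
  (fun z => `|u z.1 z.2 - al| * 'D_1 chi z.1 * psi z.2)); last 2 first.
- by move=> t x tT; rewrite (derive_tensor _ _ (C1 1%N) (C2 1%N))/= (u'E _ _ tT); ring.
- move=> t x /out tT; rewrite (derive_tensor _ _ (C1 1%N) (C2 1%N))/= (derive_out_itv hc tT).
  by ring.
rewrite (QE (fun z => Num.sg (u' z.1 z.2 - al) * B z.1 z.2 * (f (u' z.1 z.2) - f al) * 'D_((0, 1) : R * R) (tensor chi psi) z)
  (fun z => Num.sg (u z.1 z.2 - al) * A z.1 z.2 * (f (u z.1 z.2) - f al) * chi z.1 * 'D_1 psi z.2)); last 2 first.
- by move=> t x tT; rewrite (derive_tensor _ _ (C1 1%N) (C2 1%N))/= (u'E _ _ tT) (BE _ tT); ring.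
- move=> t x /out tT; rewrite (derive_tensor _ _ (C1 1%N) (C2 1%N))/= (hc _ tT).
  by ring.
rewrite (QE (fun z => f al * Num.sg (u' z.1 z.2 - al) * derive1 (B z.1) z.2 * tensor chi psi z)
  (fun z => f al * Num.sg (u z.1 z.2 - al) * A' z.1 z.2 * chi z.1 * psi z.2)); last 2 first.
- move=> t x tT /=; rewrite (u'E _ _ tT) (BE _ tT) derive1E; have [_ ->] := dA t x.
  by rewrite /tensor/=; ring.
- by move=> t x /out tT; rewrite /tensor/= (hc _ tT) mul0r mulr0.
have [Kc [Kc0 bc]] : exists K, 0 <= K /\ forall t, `|chi t| <= K.
  apply: (@continuous_bounded_out _ _ (`|a| + `|r| + 1)); first exact: Cn_continuous (C1 0).
  move=> t ht; apply: hc; apply: contraTN ht => /andP[h1 h2]; rewrite -ltNge ltr_norml.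
  have := ler_norm a; have := ler_norm (- a); have := ler_norm r; have := ler_norm (- r).
  by rewrite !normrN => *; apply/andP; split; lra.
have [Kd [Kd0 bd]] : exists K, 0 <= K /\ forall t, `|'D_1 chi t| <= K.
  apply: (@continuous_bounded_out _ _ (`|a| + `|r| + 1)).
    by have [_ _ H] := C1 1; exact: H.
  move=> t ht; apply: (derive_out_itv hc); apply: contraTN ht => /andP[h1 h2]; rewrite -ltNge ltr_norml.
  have := ler_norm a; have := ler_norm (- a); have := ler_norm r; have := ler_norm (- r).
  by rewrite !normrN => *; apply/andP; split; lra.
have cpsi : continuous psi := Cn_continuous (C2 0).
have [_ _ /(_ 1) cdpsi] := C2 1; rewrite /= in cdpsi.
have dout x : d + 1 <= `|x| -> 'D_1 psi x = 0 by move=> hx; apply: (derive_out hp); lra.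
have [Kp [Kp0 bp]] := continuous_bounded_out cpsi hp.
have [Kq [Kq0 bq]] := continuous_bounded_out cdpsi dout.
have ipsi := integrable_out cpsi hp; have idpsi := integrable_out cdpsi dout.
have mpsi := integrable_measurable ipsi; have mdpsi := integrable_measurable idpsi.
have iJ : leb.-integrable setT (EFin \o J) by apply: integrable_indic_itv.
have J0 t : 0 <= J t by rewrite /J indicE; case: (_ \in _).
have Jn t : `|J t| <= J t by rewrite ger0_norm.
have mJ := integrable_measurable iJ.
pose P x := `|psi x| + `|'D_1 psi x|.
have iP : leb.-integrable setT (EFin \o P) by apply: integrable_add; exact: integrable_nrm.
have [iw _] := weighted_l1path pu iJ Jn iJ.
have [it _] := integrable_tensor iJ iP.
have mchi : measurable_fun [set: TR] chi by apply: continuous_mfun; exact: Cn_continuous (C1 0).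
have mdchi : measurable_fun [set: TR] ('D_1 chi).
  by apply: continuous_mfun; have [_ _ H] := C1 1; exact: H.
have m1 : measurable_fun [set: TR * TR] (fun z => z.1) by exact: measurable_fst.
have m2 : measurable_fun [set: TR * TR] (fun z => z.2) by exact: measurable_snd.
have mum : measurable_fun [set: TR * TR] (fun z => u z.1 z.2 - al).
  by apply: measurable_funB => //; exact: measurable_cst.
have mf : measurable_fun [set: TR] f by apply: continuous_mfun; exact: (lipschitz_continuous fL).
have msg : measurable_fun [set: TR * TR] (fun z => Num.sg (u z.1 z.2 - al)).
  exact: (measurableT_comp (@measurable_sg R) mum).
have mJ1 : measurable_fun [set: TR * TR] (fun z => J z.1) := measurableT_comp mJ m1.
have mp2 : measurable_fun [set: TR * TR] (fun z => psi z.2) := measurableT_comp mpsi m2.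
have mq2 : measurable_fun [set: TR * TR] (fun z => 'D_1 psi z.2) := measurableT_comp mdpsi m2.
have mc1 : measurable_fun [set: TR * TR] (fun z => chi z.1) := measurableT_comp mchi m1.
have md1 : measurable_fun [set: TR * TR] (fun z => 'D_1 chi z.1) := measurableT_comp mdchi m1.
have mab : measurable_fun [set: TR * TR] (fun z => `|u z.1 z.2 - al|).
  exact: (measurableT_comp (@normr_measurable R setT) mum).
have mfu : measurable_fun [set: TR * TR] (fun z => f (u z.1 z.2) - f al).
  by apply: measurable_funB; [exact: (measurableT_comp mf mu)|exact: measurable_cst].
have bound (g : TR * TR -> R) K K' : measurable_fun setT g -> 0 <= K -> 0 <= K' ->
    (forall z, `|g z| <= K * `|u z.1 z.2| + K' * P z.2) ->
    leb2.-integrable setT (EFin \o (fun z => J z.1 * g z)).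
  move=> mg K0 K'0 gb.
  apply: (@integrable_bound _ _ R leb2 _ (fun z => K * (J z.1 * `|u z.1 z.2|) + K' * (J z.1 * P z.2))).
  - exact: measurable_funM.
  - apply: integrable_add.
      exact: (@integrable_scale _ _ R leb2 K (fun z => J z.1 * `|u z.1 z.2|)).
    exact: (@integrable_scale _ _ R leb2 K' (fun z => J z.1 * P z.2)).
  - move=> z; rewrite normrM (ger0_norm (J0 _)) mulrCA [K' * _]mulrCA -mulrDr.
    exact: ler_wpM2l.
have uale (z : TR * TR) : `|u z.1 z.2 - al| <= `|u z.1 z.2| + `|al| by exact: ler_normB.
have sgM (x y C : R) : `|y| <= C -> `|Num.sg x * y| <= C.
  by move=> h; apply: le_trans h; rewrite normrM ler_piMl// normr_sg; case: (_ != 0).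
have Pp x : `|psi x| <= P x by rewrite lerDl.
have Pq x : `|'D_1 psi x| <= P x by rewrite lerDr.
have i1 : leb2.-integrable setT (EFin \o G1).
  apply: (bound _ (Kd * Kp) (`|al| * Kd)); [|exact: mulr_ge0|exact: mulr_ge0|].
    exact: measurable_funM (measurable_funM mab md1) mp2.
  move=> z; rewrite !normrM normr_id -mulrA.
  apply: le_trans (ler_wpM2r _ (uale z)) _; first exact: mulr_ge0.
  rewrite mulrDl; apply: lerD.
    by rewrite mulrC; apply: ler_wpM2r => //; exact: ler_pM.
  by rewrite -mulrA; apply: ler_wpM2l => //; exact: ler_pM.
have i2 : leb2.-integrable setT (EFin \o G2).
  apply: (bound _ (M * L * Kc * Kq) (M * L * Kc * `|al|)).
  - exact: measurable_funM (measurable_funM (measurable_funM (measurable_funM msg mA) mfu) mc1) mq2.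
  - by rewrite !mulr_ge0.
  - by rewrite !mulr_ge0.
  move=> z; rewrite (_ : _ * 'D_1 psi z.2 = Num.sg (u z.1 z.2 - al) *
    (A z.1 z.2 * (f (u z.1 z.2) - f al) * chi z.1 * 'D_1 psi z.2)); last by ring.
  apply: sgM; apply: (@le_trans _ _ (M * (L * (`|u z.1 z.2| + `|al|)) * Kc * `|'D_1 psi z.2|)).
    have hf : `|f (u z.1 z.2) - f al| <= L * (`|u z.1 z.2| + `|al|).
      by apply: le_trans (fL _ _) _; exact: ler_wpM2l.
    rewrite !normrM; apply: ler_wpM2r; first exact: normr_ge0.
    by apply: ler_pM (ler_pM _ _ (bA _ _) hf) (bc _); rewrite ?mulr_ge0.
  rewrite (_ : _ * `|'D_1 psi z.2| = M * L * Kc * `|'D_1 psi z.2| * `|u z.1 z.2| +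
    M * L * Kc * `|al| * `|'D_1 psi z.2|); last by ring.
  apply: lerD; first by apply: ler_wpM2r => //; apply: ler_wpM2l => //; rewrite !mulr_ge0.
  by apply: ler_wpM2l => //; rewrite !mulr_ge0.
have i3 : leb2.-integrable setT (EFin \o G3).
  apply: (bound _ 0 (`|f al| * M * Kc)) => //.
  - apply: measurable_funM mp2; apply: measurable_funM mc1; apply: measurable_funM mA'.
    by apply: measurable_funM msg; exact: measurable_cst.
  - by rewrite !mulr_ge0.
  move=> z; rewrite mul0r add0r (_ : _ * psi z.2 = Num.sg (u z.1 z.2 - al) *
    (f al * A' z.1 z.2 * chi z.1 * psi z.2)); last by ring.
  apply: sgM; rewrite !normrM.
  by apply: ler_pM (ler_pM _ _ (ler_wpM2l _ (bA' _ _)) (bc _)) (Pp _); rewrite ?mulr_ge0.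
have -> : \int[leb]_x (`|u0 x - al| * tensor chi psi (0, x)) = chi 0 * \int[leb]_x (`|u0 x - al| * psi x).
  have iw0 : leb.-integrable setT (EFin \o (fun x : TR => `|u0 x - al| * psi x)).
    have mu0 := integrable_measurable iu0.
    apply: (@integrable_bound _ TR R leb _ (fun x => Kp * `|u0 x| + `|al| * `|psi x|)).
    - apply: measurable_funM => //; apply: (measurableT_comp (@normr_measurable R setT)).
      by apply: measurable_funB => //; exact: measurable_cst.
    - apply: integrable_add.
        by apply: (@integrable_scale _ TR R leb Kp (fun h : TR => `|u0 h|)); exact: integrable_nrm.
      by apply: (@integrable_scale _ TR R leb _ (fun h : TR => `|psi h|)); exact: integrable_nrm.
    - move=> x; rewrite normrM normr_id.
      apply: le_trans (ler_wpM2r (normr_ge0 _) (ler_normB _ _)) _; rewrite mulrDl lerD2r mulrC.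
      exact: ler_wpM2r.
  rewrite -(Rint_scale _ iw0); apply: eq_Rintegral => x _; rewrite /tensor/=; ring.
move=> h; suff -> : \int[leb2]_z (\1_`]0%R, b[ z.1 * (`|u z.1 z.2 - al| * 'D_1 chi z.1 * psi z.2
     + Num.sg (u z.1 z.2 - al) * A z.1 z.2 * (f (u z.1 z.2) - f al) * chi z.1 * 'D_1 psi z.2
     - f al * Num.sg (u z.1 z.2 - al) * A' z.1 z.2 * chi z.1 * psi z.2)) =
   \int[leb2]_z G1 z + \int[leb2]_z G2 z - \int[leb2]_z G3 z.
  by rewrite addrAC [_ + _ + chi 0 * _]addrAC.
rewrite -(RintegralD measurableT i1 i2) -(RintegralB measurableT (integrable_add i1 i2) i3).
by apply: eq_Rintegral => z _; rewrite /G1 /G2 /G3 -/(J z.1); ring.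
Qed.
End entropy_inequality.

(** * The estimate for one component up to time b *)

Section contraction.
Context {R : realType} {N : nat}.
Local Notation TR := (measurableTypeR R).
Local Notation leb := (@lebesgue_measure R).
Local Notation leb2 := (prodm leb leb).

Lemma solution_space_le (T b : R) (u : R -> R -> R) : b <= T -> solution_space T u -> solution_space b u.
Proof.
move=> bT [mu iu u01 cu tv].
have sub : (`[0%R, b]%classic : set R) `<=` `[0%R, T]%classic.
  by move=> x /=; rewrite !in_itv/= => /andP[-> xb]; exact: le_trans bT.
have sub' t : 0 <= t <= b -> 0 <= t <= T by move=> /andP[-> tb]; exact: le_trans bT.
split.
- apply: measurable_funS mu; first by apply: measurableX => //; exact: measurable_itv.
  by move=> z [/sub].
- by move=> t /sub'; exact: iu.
- by move=> t /sub'; exact: u01.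
- move=> t /sub' tT; apply: cvg_trans (cu t tT); apply: cvg_app; apply: within_subset.
  exact: sub.
- by apply: le_lt_trans tv; apply: ereal_sup_le => _ [t tb <-]; exists t => //; exact: sub.
Qed.

Variables (T : R) (f : 'I_N -> R -> R) (nu : 'I_N -> 'rV[R]_N -> R) (mu Gam : 'I_N -> 'I_N -> R -> R).
Variables (U0 V0 : 'I_N -> R -> R) (U V : 'I_N -> R -> R -> R).
Variables (Lf cnu G H Lnu c c1 c2 g g1 th be bv : R).
Hypotheses (hU0 : forall k, L1BV01 (U0 k)) (hV0 : forall k, L1BV01 (V0 k)).
Hypotheses (hU : entropy_solution f nu mu Gam T U U0) (hV : entropy_solution f nu mu Gam T V V0).
Hypotheses (fL : forall k x y, `|f k x - f k y| <= Lf * `|x - y|) (f0 : forall k, f k 0 = 0).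
Hypotheses (dnu : forall k i z, derivable (nu k) z (delta_mx ord0 i))
  (dpnu : forall k i j z, derivable (partial i (nu k)) z (delta_mx ord0 j)).
Hypotheses (bnu : forall k z, `|nu k z| <= cnu) (bp : forall k i z, `|partial i (nu k) z| <= G)
  (bpp : forall k i j z, `|partial i (partial j (nu k)) z| <= H) (G0 : 0 <= G) (H0 : 0 <= H).
Hypotheses (Lnu0 : 0 <= Lnu) (hLnu : forall k x y, `|nu k x - nu k y| <= Lnu * norm1 (x - y)).
Hypotheses (bk : forall j k x, `|mu j k x| <= c) (bk' : forall j k x, `|derive1 (mu j k) x| <= c1)
  (dk : forall j k (x : R), is_derive x 1 (mu j k) (derive1 (mu j k) x))
  (lk' : forall j k x y, `|derive1 (mu j k) x - derive1 (mu j k) y| <= c2 * `|x - y|).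
Hypotheses (bGa : forall j k t, `|Gam j k (Num.max 0 t)| <= g)
  (lGa : forall j k t s, `|Gam j k (Num.max 0 t) - Gam j k (Num.max 0 s)| <= g1 * `|t - s|).
Hypotheses (c0 : 0 <= c) (c10 : 0 <= c1) (g0 : 0 <= g).
Hypotheses (th0 : 0 <= th) (hth : forall j k t x, 0 <= t <= T -> `|Gam j k (Num.max 0 t) * mu j k x| <= th).
Hypotheses (tvU : forall k, (ereal_sup [set TV (U k t) | t in `[0%R, T]] <= be%:E)%E)
  (tvV : forall k, (ereal_sup [set TV (V k t) | t in `[0%R, T]] <= bv%:E)%E).

Section one_solution.
Variables (W0 : 'I_N -> R -> R) (W : 'I_N -> R -> R -> R) (b bw : R) (k : 'I_N).
Hypotheses (b0 : 0 < b) (bT : b <= T).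
Hypotheses (hW0 : forall k, L1BV01 (W0 k)) (hW : entropy_solution f nu mu Gam T W W0).
Hypothesis tvW : (ereal_sup [set TV (W k t) | t in `[0%R, T]] <= bw%:E)%E.

Definition coef := nonlocal_coef b (nu k) (fun j => mu j k) (fun j t => Gam j k (Num.max 0 t))
  (fun j => truncated b (W j)).
Definition dcoef := nonlocal_dcoef b (nu k) (fun j => mu j k) (fun j => derive1 (mu j k))
  (fun j t => Gam j k (Num.max 0 t)) (fun j => truncated b (W j)).

Let sW j : solution_space b (W j).
Proof. by apply: solution_space_le bT _; case: hW. Qed.

Lemma l1path_family : exists m, forall j, l1path m (clamped b (W j)).
Proof.
pose m j := projT1 (cid (l1path_clamped b0 (sW j))).
have mP j : l1path (m j) (clamped b (W j)) := projT2 (cid (l1path_clamped b0 (sW j))).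
have m0 j : 0 <= m j by have [_ _ h] := mP j; apply: le_trans (h 0); exact: Rintegral_ge0.
exists (\sum_j m j) => j; have [h1 h2 h3] := mP j; split => // t.
by apply: le_trans (h3 t) _; rewrite (bigD1 j)//= lerDl sumr_ge0.
Qed.

(** A provisional mass bound makes the coefficient Lipschitz; with the coefficient in hand the trace
    argument sharpens that bound to the mass of the datum. The truncation at [b] is harmless because
    the coefficient at time t depends only on times up to t. *)
Lemma solution_facts : exists M, forall M', M <= M' ->
  [/\ coefficient M' coef dcoef, kruzkov 0 b (f k) (clamped b (W k)) coef dcoef,
      l1path (\int[leb]_x `|W0 k x|) (clamped b (W k)) &
      \int[leb]_x `|W k 0 x - W0 k x| = 0].
Proof.
have [m pm] := l1path_family.
have pt j := (l1path_truncated (pm j)).1; have it j := (l1path_truncated (pm j)).2.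
have b0' : 0 <= b := ltW b0.
have [M HM] := nonlocal_coefficient b0' (@dnu k) (@dpnu k) (bnu k) (bp k) (bpp k) G0 H0
  (fun j => bk j k) (fun j => bk' j k) (fun j => dk j k) (fun j => lk' j k)
  (fun j => bGa j k) (fun j => lGa j k) c10 g0 pt it.
exists M => M' MM'; have cA : coefficient M' coef dcoef := HM M' MM'.
have [iW0 tvW0 W001] := hW0 k.
have mk j : measurable_fun [set: TR] (mu j k).
  by apply: continuous_mfun; exact: is_derive_continuous (dk j k).
have AB t : 0 <= t <= b -> coef t = (fun x => nu k (nonlocal mu Gam W k t x)).
  move=> tb; apply/funext => x; rewrite /coef /nonlocal_coef; congr (nu k _).
  apply/rowP => j; rewrite !mxE (clamp_id tb).
  by rewrite (nonlocal_stconv x b0 (pt j) (it j) (mk j) (bk j k) (bGa j k) (lGa j k) tb).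
have Ki : kruzkov_init b (f k) (W0 k) (clamped b (W k)) coef dcoef.
  apply: (kruzkov_init_entropy (fL k) (pm k) iW0 cA bT _ AB).
    by move=> t tb; exact: clamped_id.
  by move=> al phi tphi; have [_ He] := hW; exact: He.
have uc := l1continuous_clamped b0 (sW k).
have c00 : 0 <= (0 : R) <= b by rewrite lexx.
split.
- exact: cA.
- exact: kruzkov_init_kruzkov Ki.
- have [h1 h2 _] := pm k; split => // t.
  have tb : 0 <= clamp b t <= b by rewrite clamp_ge0// clamp_le.
  have := mass_bound (fL k) (pm k) iW0 uc cA b0 Ki (f0 k) tb.
  by rewrite /clamped (clamp_id tb).
- have [_ _ W01 _ _] := sW k.
  have [bw0 fin0] : exists bw0, (TV (W0 k) <= bw0%:E)%E.
    by move: tvW0; case: (TV (W0 k)) => [r _|//|_]; [exists r|exists 0; rewrite leNye].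
  have tv0 : (TV (clamped b (W k) 0) <= bw%:E)%E.
    apply: TV_clamped b0 _ _ _; apply: le_trans tvW; apply: ereal_sup_le => _ [t tb <-].
    exists t => //; move: tb; rewrite /= !in_itv/= => /andP[-> tb].
    exact: le_trans bT.
  have := initial_value (fL k) (pm k) iW0 uc cA b0 Ki tv0 fin0 _ W001.
  by rewrite clamped_id//; apply; exact: W01.
Qed.
End one_solution.

Lemma initial_dist b k : 0 < b -> b <= T ->
  \int[leb]_x `|U k 0 x - V k 0 x| <= \int[leb]_x `|U0 k x - V0 k x|.
Proof.
move=> b0 bT.
have [M1 /(_ _ (lexx _))[_ _ _ EU]] := solution_facts b0 bT hU0 hU (tvU k).
have [M2 /(_ _ (lexx _))[_ _ _ EV]] := solution_facts b0 bT hV0 hV (tvV k).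
have z0 : 0 <= (0 : R) <= T by rewrite lexx (le_trans (ltW b0)).
have [iU0 _ _] := hU0 k; have [iV0 _ _] := hV0 k.
have iU : leb.-integrable setT (EFin \o U k 0).
  by case: hU => /(_ k)[_ iu _ _ _] _; exact: iu.
have iV : leb.-integrable setT (EFin \o V k 0).
  by case: hV => /(_ k)[_ iu _ _ _] _; exact: iu.
apply: le_trans (l1dist_le iU iV iU0 iV0) _.
have sym (p q : R -> R) : \int[leb]_x `|p x - q x| = \int[leb]_x `|q x - p x|.
  by apply: eq_Rintegral => x _; rewrite distrC.
by rewrite (sym _ (U k 0)) EU addr0 (sym _ (V k 0)) EV addr0.
Qed.

(** Stability with sup bounds on A - B and A' - B' valid on all of [0, b]; integrating a constant
    rate over [0, b] produces the factor [b], later bounded by T in C. *)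
Lemma solution_contraction b k : 0 < b -> b <= T ->
  \int[leb]_x `|U k b x - V k b x| <= \int[leb]_x `|U0 k x - V0 k x| +
   (Lnu * (th * \sum_j \int[leb2]_z `|truncated b (U j) z.1 z.2 - truncated b (V j) z.1 z.2|) * Lf * be +
   (G * (g * c1) * (\sum_j \int[leb2]_z `|truncated b (U j) z.1 z.2 - truncated b (V j) z.1 z.2|) +
    H * (th * \sum_j \int[leb2]_z `|truncated b (U j) z.1 z.2 - truncated b (V j) z.1 z.2|) * (g * c1) *
      \sum_j \int[leb2]_z `|truncated b (V j) z.1 z.2|) * (Lf * \int[leb]_x `|U0 k x|)) * b.
Proof.
move=> b0 bT; have b0' : 0 <= b := ltW b0.
have [M1 H1] := solution_facts b0 bT hU0 hU (tvU k); have [M2 H2] := solution_facts b0 bT hV0 hV (tvV k).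
pose M := Num.max M1 M2.
have MM1 : M1 <= M by rewrite le_max lexx.
have MM2 : M2 <= M by rewrite le_max lexx orbT.
have [cA KU pU EU] := H1 M MM1; have [cB KV pV EV] := H2 M MM2.
have sU j : solution_space b (U j) by apply: solution_space_le bT _; case: hU.
have sV j : solution_space b (V j) by apply: solution_space_le bT _; case: hV.
have [mU qU] := l1path_family b0 bT hU; have [mV qV] := l1path_family b0 bT hV.
have ptU j := (l1path_truncated (qU j)).1; have itU j := (l1path_truncated (qU j)).2.
have ptV j := (l1path_truncated (qV j)).1; have itV j := (l1path_truncated (qV j)).2.
have hth' j (t x : R) : 0 <= t <= b -> `|Gam j k (Num.max 0 t) * mu j k x| <= th.
  by move=> /andP[t0 tb]; apply: hth; rewrite t0 (le_trans tb).
have k1P := nonlocal_coef_diff (fun j => bk j k) (fun j => dk j k) (fun j => bGa j k) (fun j => lGa j k)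
  ptU ptV itU itV Lnu0 (hLnu k) th0 hth'.
have k2P := nonlocal_dcoef_diff (@dpnu k) (bp k) (bpp k) H0 (fun j => bk j k) (fun j => bk' j k)
  (fun j => dk j k) (fun j => lk' j k) (fun j => bGa j k) (fun j => lGa j k) c10 g0
  ptU ptV itU itV th0 hth'.
have tb W bw : (ereal_sup [set TV (W k t) | t in `[0%R, T]] <= bw%:E)%E ->
    forall t, (TV (clamped b (W k) t) <= bw%:E)%E.
  move=> tvW t; apply: TV_clamped b0 _ _ _; apply: le_trans tvW; apply: ereal_sup_le => _ [t' tb <-].
  exists t' => //; move: tb; rewrite /= !in_itv/= => /andP[-> tb].
  exact: le_trans bT.
have bb : 0 <= b <= b by rewrite b0' lexx.
have z0 : 0 <= (0 : R) <= b by rewrite lexx.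
have := kruzkov_stability (fL k) (f0 k) pU pV (tb _ _ (tvU k)) (tb _ _ (tvV k))
  (l1continuous_clamped b0 (sU k)) (l1continuous_clamped b0 (sV k)) cA cB k1P k2P KU KV bb.
rewrite subr0 (clamped_id _ bb) (clamped_id _ z0) (clamped_id (V k) bb) (clamped_id (V k) z0).
move=> h; apply: le_trans h _; rewrite lerD2r.
exact: initial_dist b0 bT.
Qed.
End contraction.

(** * Constants and Gronwall's argument *)

Section real_constants.
Context {R : realType}.
Local Open Scope ereal_scope.

Lemma nneg_real (x : \bar R) : 0 <= x -> x < +oo -> exists r, (0 <= r)%R /\ x = r%:E.
Proof.
move=> x0 xoo; exists (fine x); split; first exact: fine_ge0.
by rewrite fineK// ge0_fin_numE.
Qed.

Lemma bigmaxe_real (I : finType) (F : I -> \bar R) : (forall i, F i < +oo) ->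
  exists m, [/\ (0 <= m)%R, \big[maxe/0%E]_i F i = m%:E & forall i, F i <= m%:E].
Proof.
move=> HF; have h0 : 0 <= \big[maxe/0%E]_i F i by exact: bigmax_ge_id.
have h1 : \big[maxe/0%E]_i F i < +oo.
  apply: (big_ind (fun x => x < +oo)) => // x y x1 y1.
  by rewrite gt_max x1.
have [m [m0 E]] := nneg_real h0 h1.
by exists m; split => // i; rewrite -E; exact: le_bigmax.
Qed.

(** The infimum defining [lip] is attained: admissible constants within any s > 0 of it exist, and
    the excess s [nm (x - y)] tends to 0. *)
Lemma lip_real (V : zmodType) (nm f : V -> R) (L : R) : (forall x, 0 <= nm x)%R -> (0 <= L)%R ->
  (forall x y, `|f x - f y| <= L * nm (x - y))%R ->
  exists l, [/\ (0 <= l)%R, lip nm f = l%:E & forall x y, (`|f x - f y| <= l * nm (x - y))%R].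
Proof.
move=> nm0 L0 fL.
have h0 : 0 <= lip nm f.
  by apply: le_ereal_inf_tmp => _ [l [l0 _] <-]; rewrite lee_fin.
have h1 : lip nm f <= L%:E by apply: ereal_inf_lbound; exists L.
have [l [l0 E]] := nneg_real h0 (le_lt_trans h1 (ltry _)).
exists l; split => // x y; apply: (@le_small R _ _ (nm (x - y)%R)) => // s s0 s1.
have fin : lip nm f \is a fin_num by rewrite E.
have [_ [l' [l'0 Hl'] <-]] := lb_ereal_inf_adherent s0 fin.
rewrite -/(lip nm f) E -EFinD lte_fin => ll'; apply: le_trans (Hl' x y) _.
by rewrite -mulrDl; apply: ler_wpM2r => //; exact: ltW.
Qed.
End real_constants.

Section regularity.
Context {R : realType}.

Lemma lipschitz_bound (f : R -> R) : lipschitz f ->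
  exists L, 0 <= L /\ forall x y, `|f x - f y| <= L * `|x - y|.
Proof.
move=> fl; have fl' : \forall M \near +oo, 0 <= M /\ forall x y, `|f x - f y| <= M * `|x - y|.
  near=> M; split; first by near: M; exact: nbhs_pinfty_ge.
  have : (globally (setT `*` setT)) (fun xy : R * R => `|f xy.1 - f xy.2| <= M * `|xy.1 - xy.2|).
    by near: M; exact: fl.
  by move=> h x y; exact: (h (x, y)).
by have [M HM] := filter_ex fl'; exists M.
Unshelve. all: by end_near. Qed.

Lemma C2_derive (m : R -> R) : Cn 2 m ->
  [/\ continuous m, continuous (derive1 m), continuous (derive1 (derive1 m)),
      forall x : R, is_derive x 1 m (derive1 m x) &
      forall x : R, is_derive x 1 (derive1 m) (derive1 (derive1 m) x)].
Proof.
have E (g : R -> R) : derive1 g = 'D_1 g by apply/funext => x; rewrite derive1E.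
move=> Cm; have [cm dm /(_ 1)Cm'] := Cm; have [cm' dm' /(_ 1)/= cm''] := Cm'.
by rewrite !E; split => // x; apply: DeriveDef.
Qed.

Lemma Linf_bound (m : R -> R) : continuous m -> (Linf setT m < +oo)%E ->
  exists r, [/\ 0 <= r, Linf setT m = r%:E & forall x, `|m x| <= r].
Proof.
move=> cm moo; have [r [r0 E]] := nneg_real (Lnorm_ge0 _ _ _) moo.
by exists r; split => // x; rewrite -lee_fin -E; exact: continuous_Linf.
Qed.

Lemma W2inf_bounds (m : R -> R) : Cn 2 m -> W2inf m ->
  exists c c1 c2, [/\ forall x, `|m x| <= c, Linf setT (derive1 m) = c1%:E,
    forall x, `|derive1 m x| <= c1, 0 <= c1 &
    forall x y, `|derive1 m x - derive1 m y| <= c2 * `|x - y|].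
Proof.
move=> Cm W; have [cm cm' cm'' dm dm'] := C2_derive Cm.
have [c [_ _ hc]] := Linf_bound cm (W 0%N isT).
have [c1 [c10 E1 hc1]] := Linf_bound cm' (W 1%N isT).
have [c2 [_ _ hc2]] := Linf_bound cm'' (W 2%N isT).
by exists c, c1, c2; split => //; exact: MVT_le dm' hc2.
Qed.

Lemma halfline_bounds (g : R -> R) : C2_halfline g -> W2inf_halfline g ->
  exists r K, [/\ 0 <= r, Linf `[0%R, +oo[ g = r%:E, forall t, `|g (Num.max 0 t)| <= r,
    forall t s, `|g (Num.max 0 t) - g (Num.max 0 s)| <= K * `|t - s| &
    continuous (fun t : R => g (Num.max 0 t))].
Proof.
move=> Cg Wg; have [K [_ hK]] := halfline_lipschitz Cg Wg.
have cg : continuous (fun t : R => g (Num.max 0 t)).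
  by case: Cg => g1 [g2 [cg _ _ _ _]]; exact: halfline_continuous.
have [r0 [r00 E0]] := nneg_real (Lnorm_ge0 _ _ _) (Wg 0%N isT : (Linf `]0%R, +oo[ g < +oo)%E).
(* The regularity hypothesis bounds g on the open half-line; continuity carries the bound to 0, so
   the norm over the closed half-line in C is finite. *)
have b0 t : 0 <= t -> `|g t| <= r0.
  move=> t0; rewrite -lee_fin -E0; apply: continuous_Linf_halfline => // s ts.
  by rewrite /= in_itv/= andbT (le_lt_trans t0).
have le0 : (Linf `[0%R, +oo[ g <= r0%:E)%E.
  by apply: Linf_le => // t; rewrite /= in_itv/= andbT; exact: b0.
have [r [r00' E]] := nneg_real (Lnorm_ge0 _ _ _) (le_lt_trans le0 (ltry _)).
exists r, K; split => // t; rewrite -lee_fin -E.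
apply: continuous_Linf_halfline => //; first by rewrite le_max lexx.
move=> s ts; rewrite /= in_itv/= andbT; apply: le_trans (ltW ts).
by rewrite le_max lexx.
Qed.

Lemma Linfn_bound n (h : 'rV[R]_n -> R) : continuous h -> (Linfn h < +oo)%E ->
  exists r, [/\ 0 <= r, Linfn h = r%:E & forall z, `|h z| <= r].
Proof.
move=> ch hoo; have [r [r0 E]] := nneg_real (Lnorm_ge0 _ _ _) hoo.
by exists r; split => // z; rewrite -lee_fin -E; exact: continuous_Linfn.
Qed.
End regularity.

(** * Space-time norms as time integrals *)

Section time_integrals.
Context {R : realType}.
Local Notation TR := (measurableTypeR R).
Local Notation leb := (@lebesgue_measure R).
Local Notation leb2 := (prodm leb leb).
Variables (T : R) (u v : R -> R -> R).
Hypotheses (T0 : 0 < T) (su : solution_space T u) (sv : solution_space T v).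

Lemma truncated_restrict b t x : b <= T -> truncated b u t x = \1_`[0%R, b] t * clamped T u t x.
Proof.
move=> bT; rewrite /truncated indicE; have [tb|_] := boolP (t \in _); last by rewrite !mul0r.
move: tb; rewrite inE/= in_itv/= => /andP[t0 tb].
by rewrite !clamped_id// t0//= (le_trans tb).
Qed.

Lemma truncated_abs b : 0 < b -> b <= T -> \int[leb2]_z `|truncated b u z.1 z.2| <=
  \int[leb2]_z `|truncated T u z.1 z.2|.
Proof.
move=> b0 bT; have [m1 p1] := l1path_clamped b0 (solution_space_le bT su).
have [m2 p2] := l1path_clamped T0 su.
apply: Rint_le; [exact: integrable_nrm (l1path_truncated p1).2|exact: integrable_nrm (l1path_truncated p2).2|].
move=> [t x]; rewrite /= truncated_restrict// /truncated !normrM; apply: ler_wpM2r => //.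
rewrite !indicE; have [tb|_] := boolP (t \in (`[0%R, b]%classic : set R)); last by rewrite normr0.
rewrite mem_set//=; move: tb; rewrite inE/= !in_itv/= => /andP[-> tb].
exact: le_trans bT.
Qed.

(** The norm lives on the open time interval and [truncated] on the closed one; after Fubini they
    differ only at two times, a null set. *)
Lemma L1norm_space_time :
  ('N[(leb \x leb)%E]_1[EFin \o ((fun z => u z.1 z.2) \_ (`]0%R, T[ `*` setT))])%E =
  (\int[leb2]_z `|truncated T u z.1 z.2|)%:E.
Proof.
have [m p] := l1path_clamped T0 su; have [[_ iu _] /integrable_nrm it] := l1path_truncated p.
have iW : leb2.-integrable setT (EFin \o (fun z => \1_`]0%R, T[ z.1 * `|truncated T u z.1 z.2|)).
  apply: (@integrable_bound _ _ R leb2 _ (fun z => `|truncated T u z.1 z.2|)) => //.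
    apply: measurable_funM; last exact: integrable_measurable it.
    have mI : measurable_fun [set: TR] (\1_`]0%R, T[%classic : TR -> R) by exact: measurable_indic.
    exact: (measurableT_comp mI measurable_fst).
  move=> z; rewrite normrM normr_id; apply: ler_piMl => //.
  by rewrite indicE; case: (_ \in _); rewrite ?normr1 ?normr0.
have iuS t : leb.-integrable setT (EFin \o (fun x => `|truncated T u t x|)).
  exact: (integrable_nrm (iu t)).
have [_ E1] := prod_int1 it iuS.
have [j1 E2] := prod_int1 iW (fun t => @integrable_scale _ TR R leb (\1_`]0%R, T[ t) _ (iuS t)).
transitivity (\int[leb2]_z (\1_`]0%R, T[ z.1 * `|truncated T u z.1 z.2|))%:E.
  rewrite Lnorm1 -Rint_EFin//; apply: eq_integral => -[t x] _ /=.
  rewrite patchE indicE /truncated indicE; have [tb|tb] := boolP (t \in (`]0%R, T[%classic : set R)).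
    move: (tb); rewrite inE/= in_itv/= => /andP[t0 tT].
    do 2![rewrite mem_set/=; last by rewrite in_itv/= ?(ltW t0) ?(ltW tT) ?t0 ?tT].
    by rewrite !mul1r clamped_id// !ltW.
  by rewrite memNset ?mul0r ?normr0// => -[tb' _]; move: tb; rewrite mem_set.
congr (_%:E); rewrite E1 E2.
have E t : \int[leb]_x (\1_`]0%R, T[ t * `|truncated T u t x|) =
    \1_`]0%R, T[ t * \int[leb]_x `|truncated T u t x| by rewrite Rint_scale.
pose m' t := \int[leb]_x `|truncated T u t x|.
have C (A : set R) : measurable A ->
   \int[leb]_t (\1_A t * m' t) = \int[leb]_(t in A) m' t.
  move=> mA; rewrite [RHS]Rintegral_mkcond; apply: eq_Rintegral => t _.
  by rewrite patchE indicE; case: (_ \in _); rewrite ?mul1r ?mul0r.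
have im : leb.-integrable setT (EFin \o m') by have [] := prod_int1 it iuS.
have imA (A : set TR) : measurable A -> leb.-integrable A (EFin \o m').
  by move=> mA; exact: (integrableS measurableT mA (@subsetT _ A) im).
under eq_Rintegral do rewrite E.
rewrite (C _ (measurable_itv _)) Rintegral_itv_bndo_bndc; last exact: imA.
rewrite Rintegral_itv_obnd_cbnd; last exact: imA.
rewrite -(C _ (measurable_itv _)); apply: eq_Rintegral => t _ /=.
rewrite indicE /m'; have [tb|tb] := boolP (t \in _); first by rewrite mul1r.
rewrite mul0r -[LHS](_ : \int[leb]_x (cst 0 x) = 0); last by rewrite Rintegral_cst// mul0r.
by apply: eq_Rintegral => x _; rewrite /truncated indicE (negbTE tb) mul0r normr0.
Qed.

Let n t := \int[leb]_x `|clamped T u t x - clamped T v t x|.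

Let iu t : leb.-integrable setT (EFin \o clamped T u t).
Proof. exact: integrable_clamped. Qed.
Let iv t : leb.-integrable setT (EFin \o clamped T v t).
Proof. exact: integrable_clamped. Qed.

Lemma dist_continuous : continuous n.
Proof.
move=> t; apply/cvgrPdist_le => s s0; have s2 : 0 < s / 2 by rewrite divr_gt0.
have [r1 r10 hr1] := l1continuous_clamped T0 su t s2.
have [r2 r20 hr2] := l1continuous_clamped T0 sv t s2.
near=> t'.
have d1 : `|t' - t| < r1.
  by near: t'; apply/nbhs_ballP; exists r1 => // y /=; rewrite /ball/= distrC.
have d2 : `|t' - t| < r2.
  by near: t'; apply/nbhs_ballP; exists r2 => // y /=; rewrite /ball/= distrC.
have h1 := hr1 _ d1; have h2 := hr2 _ d2.
have sym (p q : R -> R) : \int[leb]_x `|p x - q x| = \int[leb]_x `|q x - p x|.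
  by apply: eq_Rintegral => x _; rewrite distrC.
have e1 := l1dist_le (iu t) (iv t) (iu t') (iv t').
have e2 := l1dist_le (iu t') (iv t') (iu t) (iv t).
rewrite (sym (clamped T u t) (clamped T u t')) (sym (clamped T v t) (clamped T v t')) in e2.
rewrite -/(n t) -/(n t') in e1 e2; rewrite ler_norml; apply/andP; split; lra.
Unshelve. all: by end_near. Qed.
End time_integrals.

Section time_dist.
Context {R : realType}.
Local Notation TR := (measurableTypeR R).
Local Notation leb := (@lebesgue_measure R).
Local Notation leb2 := (prodm leb leb).
Variables (T b : R) (u v : R -> R -> R).
Hypotheses (b0 : 0 < b) (bT : b <= T) (su : solution_space T u) (sv : solution_space T v).

Let n t := \int[leb]_x `|clamped T u t x - clamped T v t x|.

Let T0 : 0 < T. Proof. exact: lt_le_trans bT. Qed.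

Let iuv : leb2.-integrable setT (EFin \o (fun z => truncated b u z.1 z.2 - truncated b v z.1 z.2)).
Proof.
have [m1 p1] := l1path_clamped b0 (solution_space_le bT su).
have [m2 p2] := l1path_clamped b0 (solution_space_le bT sv).
exact: (integrable_sub (l1path_truncated p1).2 (l1path_truncated p2).2).
Qed.

Let iu t : leb.-integrable setT (EFin \o clamped T u t).
Proof. exact: integrable_clamped. Qed.
Let iv t : leb.-integrable setT (EFin \o clamped T v t).
Proof. exact: integrable_clamped. Qed.

Let tE t x : `|truncated b u t x - truncated b v t x| =
  \1_`[0%R, b] t * `|clamped T u t x - clamped T v t x|.
Proof.
rewrite (truncated_restrict u t x bT) (truncated_restrict v t x bT) -mulrBr normrM ger0_norm//.
Qed.

Let nE t : \int[leb]_x `|truncated b u t x - truncated b v t x| = \1_`[0%R, b] t * n t.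
Proof.
rewrite -Rint_scale; last by apply: integrable_nrm; exact: integrable_sub.
by apply: eq_Rintegral => x _; rewrite tE.
Qed.

Let fub : leb.-integrable setT (fun t => (\int[leb]_x `|truncated b u t x - truncated b v t x|)%:E) /\
  \int[leb2]_z `|truncated b u z.1 z.2 - truncated b v z.1 z.2| =
  \int[leb]_t \int[leb]_x `|truncated b u t x - truncated b v t x|.
Proof.
have [] // := prod_int1 (integrable_nrm iuv) _ => t /=.
rewrite (_ : (fun y => _) = EFin \o (fun x => \1_`[0%R, b] t * `|clamped T u t x - clamped T v t x|)).
  apply: (@integrable_scale _ TR R leb _ (fun x => `|clamped T u t x - clamped T v t x|)).
  by apply: integrable_nrm; exact: integrable_sub.
by apply/funext => x; rewrite tE.
Qed.

Lemma space_time_dist : leb.-integrable setT (fun t => (\1_`[0%R, b] t * n t)%:E) /\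
  \int[leb2]_z `|truncated b u z.1 z.2 - truncated b v z.1 z.2| =
  \int[leb]_t (\1_`[0%R, b] t * n t).
Proof.
have [h1 h2] := fub; split.
  by apply: eq_integrable h1 => // t _; rewrite nE.
by rewrite h2; apply: eq_Rintegral => t _; rewrite nE.
Qed.

Lemma integral_L1norm : (\int[leb]_(tau in `[0%R, b]) L1norm (u tau \- v tau)%R)%E =
  (\int[leb2]_z `|truncated b u z.1 z.2 - truncated b v z.1 z.2|)%:E.
Proof.
have [h1 ->] := space_time_dist; rewrite -Rint_EFin// [LHS]integral_mkcond.
apply: eq_integral => t _ /=; rewrite patchE indicE; case: ifPn => ht; last by rewrite mul0r.
move: ht; rewrite inE/= in_itv/= mul1r => /andP[t0 tb].
have ht : 0 <= t <= T by rewrite t0 (le_trans tb).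
rewrite L1norm_Rint /n ?(clamped_id u ht) ?(clamped_id v ht)//.
have := iu t; have := iv t; rewrite (clamped_id u ht) (clamped_id v ht) => i1 i2.
exact: integrable_sub.
Qed.

Lemma truncated_ae_eq : \int[leb2]_z `|truncated b u z.1 z.2 - truncated b v z.1 z.2| = 0 ->
  {ae leb2, forall z, z \in `[0%R, b] `*` setT -> u z.1 z.2 = v z.1 z.2}.
Proof.
move=> h; have mw := integrable_measurable iuv.
have /(ae_eq_integral_abs leb2 measurableT ((measurable_EFinP _ _).2 mw)) :
    (\int[leb2]_z `|(EFin \o (fun z : R * R => truncated b u z.1 z.2 - truncated b v z.1 z.2)%R) z| = 0)%E.
  by under eq_integral do rewrite /=; rewrite Rint_EFin ?h//; exact: integrable_nrm.
apply: ae_imp => -[t x] /= /(_ I) [] e; rewrite inE => -[/= tb _].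
move: (tb) e; rewrite in_itv/= /truncated indicE mem_set//= !mul1r => tb'.
by rewrite !clamped_id// => /subr0_eq.
Qed.
End time_dist.

Section gronwall.
Context {R : realType}.
Local Notation leb := (@lebesgue_measure R).

(* On a step of length h with C h <= 1/2 beyond the set where n vanishes, the
   maximum c of n satisfies n c <= n c / 2. *)
Lemma gronwall_zero (T C : R) (n : R -> R) : 0 <= C -> continuous n -> (forall t, 0 <= n t) -> n 0 <= 0 ->
  (forall b, 0 < b -> b <= T -> leb.-integrable setT (fun t => (\1_`[0%R, b] t * n t)%:E) /\
     n b <= C * \int[leb]_t (\1_`[0%R, b] t * n t)) ->
  forall t, 0 <= t <= T -> n t = 0.
Proof.
move=> C0 cn n0 n00 H.
have [h h0 Ch] : exists2 h, 0 < h & C * h <= 1 / 2.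
  have C1 : 0 < 2 * (C + 1) by lra.
  exists (2 * (C + 1))^-1; first by rewrite invr_gt0.
  by rewrite ler_pdivrMr//; lra.
have step (i : nat) : forall t, 0 <= t <= T -> t <= i%:R * h -> n t = 0.
  elim: i => [|i IH] t /andP[t0 tT] ti.
    rewrite mul0r in ti; have -> : t = 0 by apply/eqP; rewrite eq_le ti.
    by apply/eqP; rewrite eq_le n00 n0.
  have [c] := EVT_max t0 (continuous_subspaceT cn).
  rewrite in_itv/= => /andP[c0 ct] hc.
  suff nc : n c <= 0.
    apply/eqP; rewrite eq_le n0 andbT; apply: le_trans nc; apply: hc.
    by rewrite in_itv/= t0 lexx.
  have [ci|ci] := leP c (i%:R * h).
    by rewrite IH// c0 (le_trans ct).
  have ih0 : 0 <= i%:R * h by rewrite mulr_ge0// ltW.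
  have c0' : 0 < c by apply: le_lt_trans ci.
  have cT : c <= T := le_trans ct tT.
  have [ic nb] := H c c0' cT.
  have iJ : leb.-integrable setT (EFin \o (fun s : R => n c * \1_`[i%:R * h, c] s)).
    by apply: (@integrable_scale _ _ R leb); apply: integrable_indic_itv.
  have : \int[leb]_t (\1_`[0%R, c] t * n t) <= \int[leb]_t (n c * \1_`[i%:R * h, c] t).
    apply: Rint_le => // s; rewrite !indicE.
    have [sc|_] := boolP (s \in _); last by rewrite mul0r mulr_ge0.
    move: sc; rewrite inE/= in_itv/= mul1r => /andP[s0 sc].
    have [si|si] := leP s (i%:R * h).
      by rewrite (IH _ _ si) ?mulr_ge0// s0 (le_trans sc).
    rewrite mem_set/=; last by rewrite in_itv/= (ltW si).
    by rewrite mulr1; apply: hc; rewrite in_itv/= s0 (le_trans sc).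
  rewrite Rint_scale; last exact: integrable_indic_itv.
  have -> : \int[leb]_s \1_`[i%:R * h, c] s = c - i%:R * h.
    have mI : measurable (`[i%:R * h, c]%classic : set (measurableTypeR R)) := measurable_itv _.
    rewrite /Rintegral (integral_indic leb measurableT mI) setIT.
    have := @lebesgue_measure_itv R (`[i%:R * h, c])%R; rewrite /= lte_fin ci -EFinB.
    by move/(congr1 fine).
  move=> hh.
  have ch : c - i%:R * h <= h.
    by rewrite lerBlDl; apply: le_trans ct _; move: ti; rewrite -natr1 mulrDl mul1r.
  have e1 := le_trans nb (ler_wpM2l C0 hh).
  have e2 := le_trans e1 (ler_wpM2l C0 (ler_wpM2l (n0 c) ch)).
  have e3 := ler_wpM2l (n0 c) Ch.
  by move: e2 e3; rewrite mulrCA; move: (n c) (C * h) => x y; lra.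
move=> t /andP[t0 tT]; have [i hi] : exists i : nat, t <= i%:R * h.
  exists (Num.truncn (t / h)).+1; rewrite -ler_pdivrMr//.
  by apply: ltW; exact: truncnS_gt.
by apply: step hi; rewrite t0.
Qed.
End gronwall.

Section finite_families.
Context {R : realType}.

Lemma finite_upper (I : finType) (P : I -> R -> Prop) :
  (forall i r r', r <= r' -> P i r -> P i r') -> (forall i, exists r, P i r) ->
  exists r, 0 <= r /\ forall i, P i r.
Proof.
move=> up HP; pose r i := projT1 (cid (HP i)).
have rP i : P i (r i) := projT2 (cid (HP i)).
exists (\sum_i `|r i|); split; first exact: sumr_ge0.
move=> i; apply: up (rP i); apply: le_trans (ler_norm _) _.
by rewrite (bigD1 i)//= lerDl sumr_ge0.
Qed.

Lemma finite_upper2 (I J : finType) (P : I -> J -> R -> Prop) :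
  (forall i j r r', r <= r' -> P i j r -> P i j r') -> (forall i j, exists r, P i j r) ->
  exists r, 0 <= r /\ forall i j, P i j r.
Proof.
move=> up HP.
have [r [r0 rP]] := @finite_upper _ (fun ij => P ij.1 ij.2) (fun ij => up ij.1 ij.2) (fun ij => HP ij.1 ij.2).
by exists r; split => // i j; exact: (rP (i, j)).
Qed.

Lemma bigmaxe_real2 (I J : finType) (F : I -> J -> \bar R) : (forall i j, F i j < +oo)%E ->
  exists m, [/\ 0 <= m, \big[maxe/0%E]_i \big[maxe/0%E]_j F i j = m%:E & forall i j, (F i j <= m%:E)%E].
Proof.
move=> HF; have HJ i : (\big[maxe/0%E]_j F i j < +oo)%E.
  by have [m [_ -> _]] := bigmaxe_real (HF i); exact: ltry.
have [m [m0 E Hm]] := bigmaxe_real HJ; exists m; split => // i j.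
by apply: le_trans (Hm i); exact: le_bigmax.
Qed.

Lemma bigmaxe_real3 (I J K : finType) (F : I -> J -> K -> \bar R) : (forall i j k, F i j k < +oo)%E ->
  exists m, [/\ 0 <= m, \big[maxe/0%E]_i \big[maxe/0%E]_j \big[maxe/0%E]_k F i j k = m%:E &
    forall i j k, (F i j k <= m%:E)%E].
Proof.
move=> HF; have HJ i j : (\big[maxe/0%E]_k F i j k < +oo)%E.
  by have [m [_ -> _]] := bigmaxe_real (HF i j); exact: ltry.
have [m [m0 E Hm]] := bigmaxe_real2 HJ; exists m; split => // i j k.
by apply: le_trans (Hm i j); exact: le_bigmax.
Qed.

(** The [P]-term is the same for each component, so the sum over k produces N. The [Q]-terms add up
    to the total mass, and their factor N comes from 1 <= N. *)
Lemma sum_contraction (N : nat) (a d m : 'I_N -> R) (P Q L b T : R) : (1 <= N)%N ->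
  0 <= P -> 0 <= Q -> 0 <= L -> 0 <= b -> b <= T -> (forall k, 0 <= m k) ->
  (forall k, a k <= d k + (P + Q * (L * m k)) * b) ->
  \sum_k a k <= \sum_k d k + (N%:R * T * P + N%:R * T * L * (\sum_k m k) * Q).
Proof.
move=> N1 P0 Q0 L0 b0 bT m0 h; apply: le_trans (ler_sum _ (fun k _ => h k)) _.
rewrite big_split/= lerD2l -mulr_suml big_split/= sumr_const card_ord.
rewrite -mulr_sumr -mulr_sumr -[P *+ N]mulr_natl.
have N1' : 1 <= N%:R :> R by rewrite ler1n.
have M0 : 0 <= \sum_k m k by exact: sumr_ge0.
have X0 : 0 <= Q * (L * \sum_k m k) by rewrite !mulr_ge0.
apply: (@le_trans _ _ (N%:R * (P + Q * (L * \sum_k m k)) * T)); last by lra.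
have N0 : 0 <= N%:R :> R by exact: ler0n.
apply: ler_pM => //; first by rewrite addr_ge0// mulr_ge0.
rewrite mulrDr lerD2l; exact: ler_peMl.
Qed.
End finite_families.

Lemma Rint_sum d (X : measurableType d) (R : realType) (m : {measure set X -> \bar R}) (I : Type)
    (s : seq I) (h : I -> X -> R) : (forall i, m.-integrable setT (EFin \o h i)) ->
  m.-integrable setT (EFin \o (fun x => \sum_(i <- s) h i x)) /\
  \int[m]_x \sum_(i <- s) h i x = \sum_(i <- s) \int[m]_x h i x.
Proof.
move=> ih; elim: s => [|i s [IH1 IH2]].
  rewrite big_nil (_ : (fun x => _) = cst 0); last by apply/funext => x; rewrite big_nil.
  by split; [exact: integrable0|rewrite Rintegral_cst// mul0r].
rewrite big_cons (_ : (fun x => _) = (fun x => h i x + \sum_(i <- s) h i x)); last first.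
  by apply/funext => x; rewrite big_cons.
by split; [exact: integrable_add|rewrite (RintegralD measurableT (ih i) IH1) IH2].
Qed.

(** * The constants of the theorem as real numbers *)

Section main.
Context {R : realType} {N : nat}.
Local Notation TR := (measurableTypeR R).
Local Notation leb := (@lebesgue_measure R).
Local Notation leb2 := (prodm leb leb).

Lemma lip_f_real (f : 'I_N -> R -> R) : hyp_f f -> exists L, [/\ 0 <= L, lip_f f = L%:E &
  forall k x y, `|f k x - f k y| <= L * `|x - y|].
Proof.
move=> hf.
have lk k : exists l, [/\ 0 <= l, lip Num.norm (f k) = l%:E & forall x y, `|f k x - f k y| <= l * `|x - y|].
  have [fl _ _] := hf k; have [L [L0 HL]] := lipschitz_bound fl.
  exact: (lip_real (fun x => normr_ge0 x) L0 HL).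
have [k|m [m0 E Hm]] := @bigmaxe_real R _ (fun k => lip Num.norm (f k)).
  by have [l [_ -> _]] := lk k; exact: ltry.
exists m; split => // k x y; have [l [_ El Hl]] := lk k; apply: le_trans (Hl x y) _.
by apply: ler_wpM2r => //; move: (Hm k); rewrite El lee_fin.
Qed.

Lemma nu_regular (nu : 'I_N -> 'rV[R]_N -> R) : hyp_nu nu ->
  [/\ forall k, continuous (nu k), forall k i z, derivable (nu k) z (delta_mx ord0 i),
      forall k i j z, derivable (partial i (nu k)) z (delta_mx ord0 j),
      forall k i, continuous (partial i (nu k)) &
      forall k i j, continuous (partial i (partial j (nu k)))].
Proof.
move=> hnu; split => [k|k i z|k i j z|k i|k i j]; have [[cn dn Cn] _ _] := hnu k => //.
- by have [_ h _] := Cn (delta_mx ord0 i); exact: h.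
- by have [h _ _] := Cn (delta_mx ord0 i); exact: h.
- by have [_ _ h] := Cn (delta_mx ord0 j); exact: h.
Qed.

Lemma lip_nu_real (nu : 'I_N -> 'rV[R]_N -> R) : hyp_nu nu -> exists L, [/\ 0 <= L, lip_nu nu = L%:E &
  forall k x y, `|nu k x - nu k y| <= L * norm1 (x - y)].
Proof.
move=> hnu; have [_ dn _ cp _] := nu_regular hnu.
have lk k : exists l, [/\ 0 <= l, lip (@norm1 R N) (nu k) = l%:E & forall x y, `|nu k x - nu k y| <= l * norm1 (x - y)].
  have [_ _ [_ hp _]] := hnu k.
  have [K [K0 HK]] : exists K, 0 <= K /\ forall i, forall z, `|partial i (nu k) z| <= K.
    apply: finite_upper => [i r r' rr' h z|i]; first exact: le_trans (h z) rr'.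
    by have [r [_ _ h]] := Linfn_bound (cp k i) (hp i); exists r.
  apply: (lip_real (fun x => norm1_ge0 x) K0); exact: coordinate_lipschitz (dn k) HK.
have [k|m [m0 E Hm]] := @bigmaxe_real R _ (fun k => lip (@norm1 R N) (nu k)).
  by have [l [_ -> _]] := lk k; exact: ltry.
exists m; split => // k x y; have [l [_ El Hl]] := lk k; apply: le_trans (Hl x y) _.
by apply: ler_wpM2r; [exact: norm1_ge0|move: (Hm k); rewrite El lee_fin].
Qed.

Lemma nu_bounds (nu : 'I_N -> 'rV[R]_N -> R) : hyp_nu nu ->
  exists c G H, [/\ 0 <= G, 0 <= H, Linf_grad nu = G%:E, Linf_Hess nu = H%:E &
   [/\ forall k z, `|nu k z| <= c, forall k i z, `|partial i (nu k) z| <= G &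
     forall k i j z, `|partial i (partial j (nu k)) z| <= H]].
Proof.
move=> hnu; have [cn _ _ cp cpp] := nu_regular hnu.
have [c [_ hc]] : exists c, 0 <= c /\ forall k z, `|nu k z| <= c.
  apply: (@finite_upper _ _ (fun k c => forall z, `|nu k z| <= c)) => [k r r' rr' h z|k]; first exact: le_trans (h z) rr'.
  by have [_ _ [h _ _]] := hnu k; have [r [_ _ hr]] := Linfn_bound (cn k) h; exists r.
have [i k|G [G0 EG HG]] := @bigmaxe_real2 R _ _ (fun i k => Linfn (partial i (nu k))).
  by have [_ _ [_ h _]] := hnu k; exact: h.
have [i j k|H [H0 EH HH]] := @bigmaxe_real3 R _ _ _ (fun i j k => Linfn (partial i (partial j (nu k)))).
  by have [_ _ [_ _ h]] := hnu k; exact: h.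
exists c, G, H; split => //; split => //.
- by move=> k i z; rewrite -lee_fin; apply: le_trans (HG i k); exact: continuous_Linfn.
- by move=> k i j z; rewrite -lee_fin; apply: le_trans (HH i j k); exact: continuous_Linfn.
Qed.

Lemma mu_bounds (mu : 'I_N -> 'I_N -> R -> R) : hyp_mu mu ->
  exists c c1 c2, [/\ 0 <= c, 0 <= c1, Linf_dmu mu = c1%:E &
   [/\ forall j k x, `|mu j k x| <= c, forall j k x, `|derive1 (mu j k) x| <= c1 &
     forall j k x y, `|derive1 (mu j k) x - derive1 (mu j k) y| <= c2 * `|x - y|]].
Proof.
move=> hmu.
have [c [c0 hc]] : exists c, 0 <= c /\ forall j k x, `|mu j k x| <= c.
  apply: (@finite_upper2 _ _ _ (fun j k c => forall x, `|mu j k x| <= c)) => [j k r r' rr' h z|j k]; first exact: le_trans (h z) rr'.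
  by have [Cm Wm] := hmu j k; have [c' [? [? [h _ _ _ _]]]] := W2inf_bounds Cm Wm; exists c'.
have [c2 [_ hc2]] : exists c, 0 <= c /\ forall j k x y, `|derive1 (mu j k) x - derive1 (mu j k) y| <= c * `|x - y|.
  apply: (@finite_upper2 _ _ _ (fun j k c => forall x y, `|derive1 (mu j k) x - derive1 (mu j k) y| <= c * `|x - y|)) => [j k r r' rr' h x y|j k].
    by apply: le_trans (h x y) _; exact: ler_wpM2r.
  by have [Cm Wm] := hmu j k; have [? [? [c' [_ _ _ _ h]]]] := W2inf_bounds Cm Wm; exists c'.
have [j k|c1 [c10 E H1]] := @bigmaxe_real2 R _ _ (fun j k => Linf setT (mu j k)^`()).
  by have [_ /(_ 1%N isT)] := hmu j k.
exists c, c1, c2; split => //; split => // j k x; rewrite -lee_fin; apply: le_trans (H1 j k).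
by apply: continuous_Linf; have [Cm _] := hmu j k; have [_ h _ _ _] := C2_derive Cm; exact: h.
Qed.

Lemma Gam_bounds (Gam : 'I_N -> 'I_N -> R -> R) : hyp_Gam Gam ->
  exists g g1, [/\ 0 <= g, Linf_Gam Gam = g%:E, forall j k t, `|Gam j k (Num.max 0 t)| <= g,
   forall j k t s, `|Gam j k (Num.max 0 t) - Gam j k (Num.max 0 s)| <= g1 * `|t - s| &
   forall j k, continuous (fun t : R => Gam j k (Num.max 0 t))].
Proof.
move=> hG.
have hb j k : exists r K, [/\ 0 <= r, Linf `[0%R, +oo[ (Gam j k) = r%:E, forall t, `|Gam j k (Num.max 0 t)| <= r,
    forall t s, `|Gam j k (Num.max 0 t) - Gam j k (Num.max 0 s)| <= K * `|t - s| &
    continuous (fun t : R => Gam j k (Num.max 0 t))].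
  by have [h1 h2 _] := hG j k; exact: halfline_bounds.
have [g1 [_ hg1]] : exists c, 0 <= c /\ forall j k t s, `|Gam j k (Num.max 0 t) - Gam j k (Num.max 0 s)| <= c * `|t - s|.
  apply: (@finite_upper2 _ _ _ (fun j k c => forall t s, `|Gam j k (Num.max 0 t) - Gam j k (Num.max 0 s)| <= c * `|t - s|)) => [j k r r' rr' h x y|j k].
    by apply: le_trans (h x y) _; exact: ler_wpM2r.
  by have [r [K [_ _ _ h _]]] := hb j k; exists K.
have [j k|g [g0 E Hg]] := @bigmaxe_real2 R _ _ (fun j k => Linf `[0%R, +oo[ (Gam j k)).
  by have [r [K [_ -> _ _ _]]] := hb j k; exact: ltry.
exists g, g1; split => // j k; last by have [r [K [_ _ _ _ h]]] := hb j k.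
move=> t; have [r [K [_ Er h _ _]]] := hb j k; apply: le_trans (h t) _.
by move: (Hg j k); rewrite Er lee_fin.
Qed.

Lemma Theta_bounds (mu Gam : 'I_N -> 'I_N -> R -> R) (T : R) : 0 < T -> hyp_mu mu -> hyp_Gam Gam ->
  exists th, [/\ 0 <= th, Linf_Theta mu Gam T = th%:E &
    forall j k t x, 0 <= t <= T -> `|Gam j k (Num.max 0 t) * mu j k x| <= th].
Proof.
move=> T0 hmu hG; have [c [_ [_ [c0 _ _ [hc _ _]]]]] := mu_bounds hmu.
have [g [_ [g0 _ hg _ cg]]] := Gam_bounds hG.
have [j k|th [th0 E Hth]] := @bigmaxe_real2 R _ _ (fun j k => Linf2 (`[0%R, T] `*` setT) (Theta mu Gam j k)).
  apply: le_lt_trans (ltry (c * g)); apply: Linf2_le => [|[t x]]; first exact: mulr_ge0.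
  rewrite /= in_itv/= => -[/andP[t0 _] _]; rewrite /Theta normrM/=; apply: ler_pM => //.
  by have := hg j k t; rewrite max_r.
exists th; split => // j k t x tT; rewrite -lee_fin; apply: le_trans (Hth j k).
have [Cm _] := hmu j k; have [cm _ _ _ _] := C2_derive Cm.
have /andP[t0 _] := tT; rewrite max_r// [_ * mu _ _ _]mulrC.
exact: (le_Linf2 x T0 cm (cg j k) tT).
Qed.

Lemma BVnorm_real (T : R) (U : 'I_N -> R -> R -> R) : (forall k, solution_space T (U k)) ->
  exists be, [/\ 0 <= be, BVnorm T U = be%:E &
    forall k, (ereal_sup [set TV (U k t) | t in `[0%R, T]] <= be%:E)%E].
Proof.
move=> sU; apply: (@bigmaxe_real R _ (fun k => ereal_sup [set TV (U k t) | t in `[0%R, T]])).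
by move=> k; have [] := sU k.
Qed.

Lemma L1normN_Rint (Z : 'I_N -> R -> R) : (forall k, leb.-integrable setT (EFin \o Z k)) ->
  L1normN Z = (\sum_k \int[leb]_x `|Z k x|)%:E.
Proof.
by move=> iZ; rewrite /L1normN -sumEFin; apply: eq_bigr => k _; exact: L1norm_Rint.
Qed.

Lemma L1_ae_eq (u v : R -> R) : leb.-integrable setT (EFin \o u) -> leb.-integrable setT (EFin \o v) ->
  {ae leb, forall x, u x = v x} -> \int[leb]_x `|u x - v x| = 0.
Proof.
move=> iu iv uv; have iuv := integrable_sub iu iv; have muv := integrable_measurable iuv.
apply: EFin_inj; rewrite -Rint_EFin; last exact: integrable_nrm.
transitivity (\int[leb]_x `|(EFin \o (fun x => u x - v x)%R) x|)%E; first exact: eq_integral.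
apply/(ae_eq_integral_abs leb measurableT ((measurable_EFinP _ _).2 muv)).
by apply: ae_imp uv => x uvx _; rewrite /= uvx subrr.
Qed.
End main.

Theorem theorem1 (R : realType) (N : nat) (hN : (1 <= N)%N) (T : R)
    (hT : 0 < T)
    (f : 'I_N -> R -> R) (nu : 'I_N -> 'rV[R]_N -> R)
    (mu Gam : 'I_N -> 'I_N -> R -> R)
    (hf : hyp_f f) (hnu : hyp_nu nu) (hmu : hyp_mu mu) (hGam : hyp_Gam Gam)
    (U0 V0 : 'I_N -> R -> R)
    (hU0 : forall k, L1BV01 (U0 k)) (hV0 : forall k, L1BV01 (V0 k))
    (U V : 'I_N -> R -> R -> R)
    (hU : entropy_solution f nu mu Gam T U U0)
    (hV : entropy_solution f nu mu Gam T V V0) :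
  let C : \bar R :=
    (N%:R%:E * T%:E * lip_f f * lip_nu nu * Linf_Theta mu Gam T * BVnorm T U
     + N%:R%:E * T%:E * lip_f f * L1normN U0 * Linf_grad nu
         * Linf_Gam Gam * Linf_dmu mu
     + N%:R%:E * T%:E * lip_f f * L1normN U0 * L1normQN T V
         * Linf_Gam Gam * Linf_dmu mu * Linf_Hess nu * Linf_Theta mu Gam T)%E in
  (L1normN (fun k => U k T \- V k T)%R <=
     L1normN (fun k => U0 k \- V0 k)%R
     + C * \sum_k \int[@lebesgue_measure R]_(tau in `[0%R, T])
             L1norm (U k tau \- V k tau)%R)%E
  /\
  ((forall k, {ae @lebesgue_measure R, forall x, U0 k x = V0 k x}) ->
   forall k, {ae (@lebesgue_measure R \x @lebesgue_measure R)%E,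
     forall z, z \in `[0%R, T] `*` setT -> U k z.1 z.2 = V k z.1 z.2}).
Proof.
have [Lf [Lf0 ELf fL]] := lip_f_real hf.
have [Lnu [Lnu0 ELnu hLnu]] := lip_nu_real hnu.
have [cnu [G [H [G0 H0 EG EH [bnu bp bpp]]]]] := nu_bounds hnu.
have [c [c1 [c2 [c0 c10 Ec1 [bk bk' lk']]]]] := mu_bounds hmu.
have [g [g1 [g0 Eg bGa lGa _]]] := Gam_bounds hGam.
have [th [th0 Eth hth]] := Theta_bounds hT hmu hGam.
have sU k : solution_space T (U k) by case: hU.
have sV k : solution_space T (V k) by case: hV.
have [be [be0 Ebe tvU]] := BVnorm_real sU.
have [bv [_ _ tvV]] := BVnorm_real sV.
have [_ dnu dpnu _ _] := nu_regular hnu.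
have f0 k : f k 0 = 0 by case: (hf k).
have dk j k (x : R) : is_derive x 1 (mu j k) (derive1 (mu j k) x).
  by have [Cm _] := hmu j k; have [_ _ _ h _] := C2_derive Cm; exact: h.
have iU0 k : (@lebesgue_measure R).-integrable setT (EFin \o U0 k) by case: (hU0 k).
have iV0 k : (@lebesgue_measure R).-integrable setT (EFin \o V0 k) by case: (hV0 k).
have Tin : 0 <= T <= T by rewrite ltW//=.
have iU t k : 0 <= t <= T -> (@lebesgue_measure R).-integrable setT (EFin \o U k t).
  by move=> tT; have [_ h _ _ _] := sU k; exact: h.
have iV t k : 0 <= t <= T -> (@lebesgue_measure R).-integrable setT (EFin \o V k t).
  by move=> tT; have [_ h _ _ _] := sV k; exact: h.
pose M0 := \sum_k \int[@lebesgue_measure R]_x `|U0 k x|.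
pose MV := \sum_k \int[prodm (@lebesgue_measure R) (@lebesgue_measure R)]_z `|truncated T (V k) z.1 z.2|.
pose D b := \sum_k \int[prodm (@lebesgue_measure R) (@lebesgue_measure R)]_z
  `|truncated b (U k) z.1 z.2 - truncated b (V k) z.1 z.2|.
pose K := N%:R * T * Lf * Lnu * th * be + N%:R * T * Lf * M0 * G * g * c1 +
  N%:R * T * Lf * M0 * MV * g * c1 * H * th.
have N0 : 0 <= N%:R :> R by exact: ler0n.
have T0 : 0 <= T by exact: ltW.
have M00 : 0 <= M0 by apply: sumr_ge0 => k _; exact: Rintegral_ge0.
have MV0 : 0 <= MV by apply: sumr_ge0 => k _; exact: Rintegral_ge0.
have D0 b : 0 <= D b by apply: sumr_ge0 => k _; exact: Rintegral_ge0.
have K0 : 0 <= K by rewrite /K !addr_ge0// !mulr_ge0.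
(* The estimate at every time b: b = T is the first claim, and all b together feed Gronwall's
   argument. *)
have main b : 0 < b -> b <= T -> \sum_k \int[@lebesgue_measure R]_x `|U k b x - V k b x| <=
    \sum_k \int[@lebesgue_measure R]_x `|U0 k x - V0 k x| + K * D b.
  move=> b0 bT.
  (* The norm of V over [0, b] increases with b, so the constant K can be the same for all b. *)
  have Mb : \sum_j \int[prodm (@lebesgue_measure R) (@lebesgue_measure R)]_z `|truncated b (V j) z.1 z.2| <= MV.
    by apply: ler_sum => j _; exact: truncated_abs.
  (* K regrouped into the [P]- and [Q]-parts of [sum_contraction], with the mass of V already
     enlarged to [MV]. *)
  have E : K * D b = N%:R * T * (Lnu * (th * D b) * Lf * be) +
      N%:R * T * Lf * M0 * (G * (g * c1) * D b + H * (th * D b) * (g * c1) * MV).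
    by rewrite /K; move: (D b) => d; ring.
  have Db := D0 b.
  rewrite E; apply: (sum_contraction hN _ _ Lf0 (ltW b0) bT) => [||k|k].
  - by rewrite !mulr_ge0.
  - by rewrite addr_ge0// !mulr_ge0.
  - exact: Rintegral_ge0.
  apply: le_trans (solution_contraction hU0 hV0 hU hV fL f0 dnu dpnu bnu bp bpp G0 H0 Lnu0 hLnu bk bk' dk lk'
    bGa lGa c10 g0 th0 hth tvU tvV k b0 bT) _.
  rewrite -/(D b) lerD2l; apply: ler_wpM2r; first exact: ltW.
  rewrite lerD2l; apply: ler_wpM2r; first by rewrite mulr_ge0//; exact: Rintegral_ge0.
  by rewrite lerD2l; apply: ler_wpM2l Mb; rewrite !mulr_ge0.
split.
  rewrite ELf ELnu EG EH Ec1 Eg Eth Ebe (L1normN_Rint iU0).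
  rewrite (_ : L1normQN T V = MV%:E); last first.
    by rewrite /MV -sumEFin; apply: eq_bigr => k _; exact: L1norm_space_time.
  rewrite (_ : (\sum_k _)%E = (D T)%:E); last first.
    by rewrite /D -sumEFin; apply: eq_bigr => k _; exact: integral_L1norm hT (lexx T) (sU k) (sV k).
  rewrite !L1normN_Rint; last 2 first.
  - by move=> k; apply: integrable_sub; [exact: iU0|exact: iV0].
  - by move=> k; apply: integrable_sub; [exact: iU|exact: iV].
  rewrite -!EFinM -!EFinD lee_fin -/M0.
  exact: main.
move=> UV0 k.
have Tb : 0 <= (0 : R) <= T by rewrite lexx.
(* With clamped times the distance is continuous on the whole line, as [gronwall_zero] demands, and
   equals the true one on [0, T]. *)
pose n t := \sum_k \int[@lebesgue_measure R]_x `|clamped T (U k) t x - clamped T (V k) t x|.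
have nE t : 0 <= t <= T -> n t = \sum_k \int[@lebesgue_measure R]_x `|U k t x - V k t x|.
  by move=> tT; apply: eq_bigr => j _; rewrite !clamped_id.
have d0 j : \int[@lebesgue_measure R]_x `|U0 j x - V0 j x| = 0 by exact: L1_ae_eq.
have cn : continuous n.
  by apply: continuous_big => [|j _]; [exact: add_continuous|exact: dist_continuous].
have nT t : 0 <= t <= T -> n t = 0.
  apply: (gronwall_zero K0 cn) => [s||b b0 bT].
  - by apply: sumr_ge0 => j _; exact: Rintegral_ge0.
  - rewrite nE//; apply: sumr_le0 => j _.
    apply: le_trans (initial_dist hU0 hV0 hU hV fL f0 dnu dpnu bnu bp bpp G0 H0 bk bk' dk lk'
    bGa lGa c10 g0 tvU tvV j hT (lexx T)) _.
    by rewrite d0.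
  have st j := space_time_dist b0 bT (sU j) (sV j).
  have [i1 E1] := Rint_sum (index_enum 'I_N) (fun j => (st j).1).
  have nS s : \1_`[0%R, b] s * n s = \sum_j (\1_`[0%R, b] s *
      \int[@lebesgue_measure R]_x `|clamped T (U j) s x - clamped T (V j) s x|).
    by rewrite mulr_sumr.
  split; first by apply: eq_integrable i1 => // s _; rewrite /= nS.
  under eq_Rintegral do rewrite nS.
  rewrite E1 -(eq_bigr _ (fun j _ => (st j).2)) nE ?(ltW b0)//.
  by have := main b b0 bT; rewrite [X in X + _]big1 ?add0r.
have nk t : 0 <= t <= T -> \int[@lebesgue_measure R]_x `|clamped T (U k) t x - clamped T (V k) t x| = 0.
  move=> tT; apply: (psumr_eq0P _ (nT t tT)) => // j _; exact: Rintegral_ge0.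
(* Equality a.e. in the strip follows from a vanishing space-time integral, which is the time
   integral of distances already known to be 0 at every time. *)
apply: (truncated_ae_eq hT (lexx T) (sU k) (sV k)).
rewrite (space_time_dist hT (lexx T) (sU k) (sV k)).2.
rewrite -[RHS](_ : \int[@lebesgue_measure R]_x (cst 0 x) = 0); last by rewrite Rintegral_cst// mul0r.
apply: eq_Rintegral => t _; rewrite indicE; have [|_] := boolP (t \in _); last by rewrite mul0r.
by rewrite inE/= in_itv/= => /nk ->; rewrite mulr0.
Qed.
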